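(* Let $\alpha>\frac12$, $\gamma\ge1$, and let $(\rho_0,m_0)$ satisfy $$\rho_0\ge 0 \text{ a.e. in }\Omega,\quad \rho_0\in L^1(\Omega),\quad (\rho_0^{\alpha-1/2})_x\in L^2(\Omega),\quad m_0=0 \text{ a.e. on }\{\rho_0=0\},\quad \frac{|m_0|^2}{\rho_0}\in L^1(\Omega),\quad \int_\Omega\rho_0\,dx=1.$$ Let $(\rho,u)$ be any global entropy weak solution (in the sense defined in the context) to $$\rho_t+(\rho u)_x=0,\qquad (\rho u)_t+(\rho u^2+\rho^\gamma)_x-(\rho^\alpha u_x)_x=0,\qquad (\rho,\rho u)(x,0)=(\rho_0,m_0)(x),$$ with the Dirichlet boundary condition $\rho u(0,t)=\rho u(1,t)=0$ or the periodic boundary condition, and suppose that it contains vacuum states at least at one point for some finite time. Let $T_0>0$ and $T_1\in[0,T_0)$ be times such that, for some constant $\rho_-$ and some nonempty subset $\Omega^0\subset\overline\Omega$, $$\inf_{x\in\overline\Omega}\rho(x,t)\ge\rho_->0\quad\text{for }t\ge T_0,$$ $$\rho(x,T_1)=0\ \ \forall x\in\Omega^0,\qquad \rho(x,T_1)>0\ \ \forall x\in\overline\Omega\setminus\Omega^0,\qquad \rho(x,t)>0\ \ \forall(x,t)\in\overline\Omega\times(T_1,T_0].$$ Then the solution blows up as the vacuum states vanish; namely, for any given fixed $\eta>0$, $$\lim_{t\to T_1^+}\int_t^{T_1+\eta}\|u_x\|_{L^\infty}\,ds=\infty.$$ On the other hand, if there exists some $T_2\in(0,T_0)$ such that $\|u\|_{L^1(0,T_2;W^{1,\infty}(\Omega))}<\infty$,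 then there is a time $T_3\in[T_2,T_0)$ such that $$\lim_{t\to T_3^-}\int_0^t\|u_x\|_{L^\infty}\,ds=\infty.$$
   Context: For such solutions $\rho\in C(\overline\Omega\times[0,T])$ for every $T>0$, so pointwise values of $\rho$ make sense; wherever $\rho>0$, the velocity is $u=\sqrt\rho u/\sqrt\rho$. $\Omega$ denotes the unit interval $(0,1)$ (Dirichlet case), or a periodic domain with period one (periodic case, where the equations are considered on $\mathbb{R}\times(0,\infty)$ and $\rho,u$ are periodic in $x$ of period $1$). Quotients such as $|m_0|^2/\rho_0$ are understood as $0$ where $\rho_0=m_0=0$. Test functions: $\Psi=C_0^\infty(\overline\Omega\times[0,T))$ and $\Phi=C_0^\infty(\Omega\times[0,T))$ in the Dirichlet case; $\Psi=\Phi=C^\infty_{\rm per}(\mathbb{R}\times[0,T))$ in the periodic case, where $C^\infty_{\rm per}(\mathbb{R}\times[0,T))$ is the set of $\varphi\in C^\infty(\mathbb{R}\times[0,T))$ which are periodic in $x$ of period $1$ (as test functions, vanishing for $t$ near $T$). Weak solution. $(\rho,u)$ (more precisely the pair $\rho$, $\sqrt\rho u$) is a weak solution in $\Omega\times(0,T)$ if $0\le\rho\in L^\infty(0,T;L^1(\Omega)\cap L^\gamma(\Omega))$, $(\rho^{\alpha-1/2})_x\in L^\infty(0,T;L^2(\Omega))$, $\sqrt\rho u\in L^\infty(0,T;L^2(\Omega))$, $\rho^\alpha u_x\in L^2(0,T;W^{-1,1}_{\rm loc}(\Omega))$, and $$\int_\Omega\rho_0\psi(x,0)dx+\int_0^T\!\!\int_\Omega\rho\psi_t\,dxdt+\int_0^T\!\!\int_\Omega\sqrt\rho\,\sqrt\rho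 u\,\psi_x\,dxdt=0\quad\forall\psi\in\Psi,$$ $$\int_\Omega m_0\varphi(x,0)dx+\int_0^T\!\!\int_\Omega\sqrt\rho(\sqrt\rho u)\varphi_t\,dxdt+\int_0^T\!\!\int_\Omega\big((\sqrt\rho u)^2+\rho^\gamma\big)\varphi_x\,dxdt-\langle\rho^\alpha u_x,\varphi_x\rangle=0\quad\forall\varphi\in\Phi,$$ where the nonlinear diffusion term is defined by $$\langle\rho^\alpha u_x,\varphi\rangle=-\int_0^T\!\!\int_\Omega\rho^{\alpha-1/2}\sqrt\rho u\,\varphi_x\,dxdt-\frac{2\alpha}{2\alpha-1}\int_0^T\!\!\int_\Omega(\rho^{\alpha-1/2})_x\sqrt\rho u\,\varphi\,dxdt\quad\forall\varphi\in\Phi.$$ In the periodic case $(\rho,\sqrt\rho u)$ is also periodic. Global entropy weak solution. A weak solution $(\rho,u)$ is a global entropy weak solution if there exists $\Lambda\in L^2(\Omega\times(0,T))$ with $$\int_0^T\!\!\int_\Omega\Lambda\varphi\,dxdt=-\int_0^T\!\!\int_\Omega\rho^{\alpha-1/2}\sqrt\rho u\,\varphi_x\,dxdt-\frac{2\alpha}{2\alpha-1}\int_0^T\!\!\int_\Omega(\rho^{\alpha-1/2})_x\sqrt\rho u\,\varphi\,dxdt\quad\forall\varphi\in\Phi,$$ and $$\sup_{0\le t\le T}\int_\Omega\big(|\sqrt\rho u|^2+|(\rho^{\alpha-1/2})_x|^2+\pi(\rho)\big)(x,t)dx+\int_0^T\!\!\int_\Omega\big(|(\rho^{(\gamma+\alpha-1)/2})_x|^2+\Lambda^2\big)dxdt\le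 C_0\int_\Omega\Big(\frac{|m_0|^2}{\rho_0}+|(\rho_0^{\alpha-1/2})_x|^2+\pi_+(\rho_0)\Big)dx$$ with $C_0>0$ independent of $T$, where $\pi(\rho)=\rho\log\rho$, $\pi_+(\rho)=\rho\log_+\rho$ if $\gamma=1$, and $\pi(\rho)=\pi_+(\rho)=\frac{1}{\gamma-1}\rho^\gamma$ if $\gamma>1$. Here the solution is defined for all times, i.e. for every $T>0$ the pair $(\rho,u)$ is a weak solution in $\Omega\times(0,T)$ possessing such a function $\Lambda\in L^2(\Omega\times(0,T))$ and satisfying this entropy inequality on $(0,T)$, with one and the same constant $C_0$ for all $T$. *)

(* Defs.v *)
From HB Require Import structures.
From mathcomp Require Import all_boot all_order all_algebra.
From mathcomp Require Import all_classical all_reals all_analysis.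
Set Implicit Arguments.
Unset Strict Implicit.
Unset Printing Implicit Defensive.
Import Order.TTheory GRing.Theory Num.Theory.
Import numFieldNormedType.Exports.
Local Open Scope classical_set_scope.
Local Open Scope ring_scope.

Inductive boundary := Dirichlet | Periodic.

Section Domain.
Context {R : realType}.
Local Notation mu := (@lebesgue_measure R).
Implicit Types (bc : boundary) (T p : R) (D : set R) (v : R -> R)
  (f : R -> R -> R).

(* Functions on space-time are written f x t, with x in space and t in time.
   In the periodic case functions live on the whole line with period 1, and
   ]0, 1[ is the period cell over which space integrals are taken. *)
Definition Omega : set R := `]0, 1[.

Definition Omega_bar bc : set R :=
  match bc with Dirichlet => `[0, 1] | Periodic => setT end.

Definition periodic_if bc v : Prop :=
  match bc with Dirichlet => True | Periodic => forall x, v (x + 1) = v x end.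

Definition dx f : R -> R -> R := fun x t => derive1 (f^~ t) x.
Definition dt f : R -> R -> R := fun x t => derive1 (f x) t.

Fixpoint Ck (k : nat) f : Prop :=
  continuous (fun z : R * R => f z.1 z.2) /\
  match k with
  | 0 => True
  | k'.+1 => [/\ forall x t, derivable (f^~ t) x 1 /\ derivable (f x) t 1,
                 Ck k' (dx f) & Ck k' (dt f)]
  end.

Definition supported_in (a b : R) v : Prop :=
  exists a' b', [/\ a < a', b' < b & forall x, x \notin `[a', b'] -> v x = 0].

Definition supported_in_x (a b : R) f : Prop :=
  exists a' b', [/\ a < a', b' < b & forall x t, x \notin `[a', b'] -> f x t = 0].

(* The test functions Psi and Phi. Smooth functions on a set with boundary are
   taken to be restrictions of smooth functions on the plane. *)
Definition Psi bc T : set (R -> R -> R) := [set f |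
  [/\ forall k, Ck k f,
      exists2 T', T' < T & forall x t, T' <= t -> f x t = 0 &
      forall t, periodic_if bc (f^~ t)]].

Definition Phi bc T : set (R -> R -> R) := [set f |
  Psi bc T f /\
  match bc with Dirichlet => supported_in_x 0 1 f | Periodic => True end].

Definition test1 bc : set (R -> R) := [set v |
  (forall n x, derivable (derive1n n v) x 1) /\
  match bc with
  | Dirichlet => supported_in 0 1 v
  | Periodic => periodic_if bc v
  end].

Definition L1loc bc v : Prop :=
  match bc with
  | Dirichlet => locally_integrable Omega v
  | Periodic => mu.-integrable Omega (EFin \o v)
  end.

(* g is the distributional derivative of v (on the circle, when periodic) *)
Definition weak_deriv bc v (g : R -> R) : Prop :=
  [/\ L1loc bc v, L1loc bc g &
      forall phi, test1 bc phi ->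
        \int[mu]_(x in Omega) (v x * derive1 phi x) =
        - \int[mu]_(x in Omega) (g x * phi x)].

Definition LpN D (p : \bar R) v : \bar R := 'N[mu]_p[EFin \o (v \_ D)].

(* ||v_x||_{L^oo(Omega)}; the set below has at most one element, and the value
   is +oo when v has no weak derivative. *)
Definition dxLinfN bc v : \bar R :=
  ereal_inf [set LpN Omega +oo g | g in weak_deriv bc v].

Definition W1infN bc v : \bar R := (LpN Omega +oo v + dxLinfN bc v)%E.

Definition jointly_measurable D T f : Prop :=
  measurable_fun (D `*` `]0, T[) (fun z : R * R => f z.1 z.2).

Definition stint D T f : R :=
  \int[mu]_(t in `]0, T[) \int[mu]_(x in D) f x t.

Definition LinfLp T p f : Prop :=
  jointly_measurable Omega T f /\
  exists M : R, {ae mu, forall t, t \in `]0, T[ ->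
    (LpN Omega p%:E (f^~ t) <= M%:E)%E}.

Definition L2L1 D T f : Prop :=
  jointly_measurable D T f /\
  (\int[mu]_(t in `]0%R, T[) (LpN D 1 (f^~ t) ^+ 2) < +oo)%E.

Definition L2L2 T f : Prop :=
  jointly_measurable Omega T f /\
  (\int[mu]_(t in `]0%R, T[) (LpN Omega 2%:E (f^~ t) ^+ 2) < +oo)%E.

(* g = f_x in Omega x (0, T), as functions of t with values in distributions *)
Definition weak_dx bc T f (g : R -> R -> R) : Prop :=
  jointly_measurable Omega T g /\
  {ae mu, forall t, t \in `]0, T[ -> weak_deriv bc (f^~ t) (g^~ t)}.

(* L is in L^2(0, T; W^{-1,1}_loc(Omega)), with W^{-1,1}(D) the space of
   f0 + (f1)_x with f0, f1 in L^1(D); on the circle "loc" is void. *)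
Definition L2_Wm11_loc bc T (L : (R -> R -> R) -> R) : Prop :=
  match bc with
  | Dirichlet => forall a b, 0 < a -> a < b -> b < 1 ->
      exists f0 f1, [/\ L2L1 `]a, b[ T f0, L2L1 `]a, b[ T f1 &
        forall phi, Phi bc T phi -> supported_in_x a b phi ->
          L phi = stint `]a, b[ T (fun x t => f0 x t * phi x t)
                - stint `]a, b[ T (fun x t => f1 x t * dx phi x t)]
  | Periodic =>
      exists f0 f1, [/\ L2L1 Omega T f0, L2L1 Omega T f1 &
        forall phi, Phi bc T phi ->
          L phi = stint Omega T (fun x t => f0 x t * phi x t)
                - stint Omega T (fun x t => f1 x t * dx phi x t)]
  end.

End Domain.

Section Solutions.
Context {R : realType}.
Local Notation mu := (@lebesgue_measure R).
Implicit Types (bc : boundary) (alpha gamma T : R).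

(* Here x / 0 = 0, which is the convention for |m0|^2 / rho0 in vacuum. *)
Definition initial_data bc alpha (rho0 m0 : R -> R) : Prop :=
  [/\ [/\ measurable_fun Omega rho0, measurable_fun Omega m0,
          periodic_if bc rho0 & periodic_if bc m0],
      {ae mu, forall x, Omega x -> 0 <= rho0 x},
      mu.-integrable Omega (EFin \o rho0) /\
        \int[mu]_(x in Omega) rho0 x = 1,
      exists2 g0, weak_deriv bc (fun x => rho0 x `^ (alpha - 2^-1)) g0 &
        (LpN Omega 2%:E g0 < +oo)%E &
      {ae mu, forall x, Omega x -> rho0 x = 0 -> m0 x = 0} /\
        mu.-integrable Omega (EFin \o (fun x => m0 x ^+ 2 / rho0 x))].

(* Below, w stands for sqrt(rho) u and g for (rho^(alpha - 1/2))_x. *)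

(* <rho^alpha u_x, phi> *)
Definition diffusion alpha T (rho w g phi : R -> R -> R) : R :=
  - stint Omega T (fun x t => rho x t `^ (alpha - 2^-1) * w x t * dx phi x t)
  - 2 * alpha / (2 * alpha - 1) *
    stint Omega T (fun x t => g x t * w x t * phi x t).

(* The Dirichlet condition rho u = 0 on the boundary is carried by the mass
   equation, whose test functions do not vanish at x = 0, 1. *)
Definition weak_solution bc alpha gamma T (rho0 m0 : R -> R)
    (rho w g : R -> R -> R) : Prop :=
  [/\ [/\ forall x t, Omega x -> t \in `]0, T[ -> 0 <= rho x t,
          LinfLp T 1 rho & LinfLp T gamma rho],
      weak_dx bc T (fun x t => rho x t `^ (alpha - 2^-1)) g /\ LinfLp T 2 g,
      LinfLp T 2 w /\ L2_Wm11_loc bc T (diffusion alpha T rho w g),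
      forall psi, Psi bc T psi ->
        \int[mu]_(x in Omega) (rho0 x * psi x 0)
        + stint Omega T (fun x t => rho x t * dt psi x t)
        + stint Omega T (fun x t => Num.sqrt (rho x t) * w x t * dx psi x t)
        = 0 &
      forall phi, Phi bc T phi ->
        \int[mu]_(x in Omega) (m0 x * phi x 0)
        + stint Omega T (fun x t => Num.sqrt (rho x t) * w x t * dt phi x t)
        + stint Omega T (fun x t =>
            (w x t ^+ 2 + rho x t `^ gamma) * dx phi x t)
        - diffusion alpha T rho w g (dx phi) = 0].

Definition potential gamma (r : R) : R :=
  if gamma == 1 then r * ln r else (gamma - 1)^-1 * r `^ gamma.

Definition potential_plus gamma (r : R) : R :=
  if gamma == 1 then r * Num.max (ln r) 0 else (gamma - 1)^-1 * r `^ gamma.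

(* g0 = (rho0^(alpha - 1/2))_x, h = (rho^((gamma + alpha - 1)/2))_x; the
   supremum in time is an essential one, w and g being L^oo(0, T; L^2)
   classes. *)
Definition entropy_inequality gamma (C0 : R) T (rho0 m0 g0 : R -> R)
    (rho w g h Lambda : R -> R -> R) : Prop :=
  {ae mu, forall t, t \in `]0, T[ ->
    (\int[mu]_(x in Omega)
       (w x t ^+ 2 + g x t ^+ 2 + potential gamma (rho x t))%:E
     + \int[mu]_(s in `]0%R, T[) \int[mu]_(x in Omega)
         (h x s ^+ 2 + Lambda x s ^+ 2)%:E
     <= C0%:E * \int[mu]_(x in Omega)
         (m0 x ^+ 2 / rho0 x + g0 x ^+ 2 + potential_plus gamma (rho0 x))%:E)%E}.

(* rho denotes the continuous representative of the density. *)
Definition global_entropy_weak_solution bc alpha gamma (rho0 m0 : R -> R)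
    (rho w : R -> R -> R) : Prop :=
  [/\ {within Omega_bar bc `*` `[0, +oo[,
         continuous (fun z : R * R => rho z.1 z.2)},
      forall t, periodic_if bc (rho^~ t) /\ periodic_if bc (w^~ t) &
      exists C0 g0, [/\ 0 < C0,
        weak_deriv bc (fun x => rho0 x `^ (alpha - 2^-1)) g0 &
        forall T, 0 < T -> exists g h Lambda,
          [/\ weak_solution bc alpha gamma T rho0 m0 rho w g,
              weak_dx bc T (fun x t => rho x t `^ ((gamma + alpha - 1) / 2)) h,
              L2L2 T Lambda,
              forall phi, Phi bc T phi ->
                stint Omega T (fun x t => Lambda x t * phi x t)
                = diffusion alpha T rho w g phi &
              entropy_inequality gamma C0 T rho0 m0 g0 rho w g h Lambda]]].

(* The velocity is determined by sqrt(rho) u where rho > 0; its values in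
   vacuum are left arbitrary. *)
Definition is_velocity bc (rho w u : R -> R -> R) : Prop :=
  [/\ forall T, jointly_measurable Omega T u,
      forall t, periodic_if bc (u^~ t) &
      forall x t, Omega x -> 0 < t -> 0 < rho x t ->
        u x t = w x t / Num.sqrt (rho x t)].

End Solutions.

(* Main.v *)
Require Import Defs.
From mathcomp Require Import all_boot all_order all_algebra.
From mathcomp Require Import all_classical all_reals all_analysis.
From mathcomp Require Import measurable_realfun ess_sup_inf ring lra.
Import Order.TTheory GRing.Theory Num.Theory.
Import numFieldNormedType.Exports.
Local Open Scope classical_set_scope.
Local Open Scope ring_scope.

(** The idea is a backward-in-time lower bound for the density.  Along the flow of
    [u] the density satisfies [rho' = - rho u_x], so on a time interval [[s, e]]
    without vacuum its minimum grows at most by the factor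
    [exp (\int ||u_x||_oo)]: every value [rho x s] is at least
    [min rho(., e) * exp (- \int_s^e ||u_x||_oo)] ([slab_backward_bound]).  If the
    integral stayed bounded as [s] decreases to [T1], then [rho] could not vanish at
    time [T1] by continuity, which contradicts the vacuum at [Omega0]
    ([gradient_integral_large]).  This is the first claim.  It says in particular
    that the integral over [[0, t]] is infinite for every [t > T1], so in the second
    claim [T3] may be any time of [[T2, T0)] after [T1].

    The velocity is not regular enough for a flow, so the minimum is followed
    through mollified averages of the density instead.  Let [kavg rho h a] be the
    average of [rho] against a kernel of width [h] based at [a].  The mass equation,
    tested with the kernel, says that its time derivative is the integral of
    [rho u] against the derivative of the kernel.  Replacing [u] by its local average
    leaves an error of at most (density) * [||u_x||_oo] ([flux_split]), and the
    remaining term is the average of [u] times the slope of [a |-> kavg rho h a],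
    which vanishes at a minimizing centre ([kslope_critical]).  Thus over a short
    time step the least average grows by at most its own multiple by the integral of
    [||u_x||_oo], up to errors that vanish with the width and the time step
    ([min_step]); a discrete Gronwall argument concludes
    ([min_density_backward]).

    Between walls, the minimizing centre may sit next to a wall, where the slope need
    not vanish.  There the average of [u] is of order [h ||u_x||_oo] instead, because
    the momentum has zero trace.  This condition is hidden in the mass equation,
    whose test functions do not vanish at the walls: testing with functions
    concentrated in thin layers shows that the momentum tends to 0 at the wall after
    integration in time ([wall_flux_small]), and [wall_velocity] turns this into a
    bound on [u] for almost every time.

    Finally, [||u_x(t)||_oo] is an infimum over weak derivatives and may not be
    measurable in [t].  Its integral is a supremum over simple functions below it,
    of which monotonicity, superadditivity and the comparison with measurable
    minorants ([lower_integral_subset], [lower_integral_superadditive],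
    [ae_le_lower_integral]) are enough. *)

Set Implicit Arguments.
Unset Strict Implicit.
Unset Printing Implicit Defensive.

(** * Smooth functions of one variable *)

Section Smooth.
Context {R : realType}.
Implicit Types (f g v : R -> R) (n : nat) (x : R).

Definition smooth v := forall n x, derivable (derive1n n v) x 1.

(** Smoothness in recursive form: peeling off derivatives from the outside lets
    the product and quotient rules pass by induction on the order. *)
Fixpoint diffn n v : Prop :=
  (forall x, derivable v x 1) /\
  match n with 0 => True | n'.+1 => diffn n' (derive1 v) end.

Lemma diffnW n v : diffn n.+1 v -> diffn n v.
Proof.
elim: n v => [|n ih] v; first by move=> [dv _]; split; [exact: dv|exact: I].
by move=> [dv h]; split; [exact: dv|exact: ih].
Qed.

Lemma smoothP v : smooth v <-> forall n, diffn n v.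
Proof.
split=> [sv n|dv n].
  elim: n v sv => [|n ih] v sv; first by split=> //; exact: (sv 0%N).
  split; first exact: (sv 0%N).
  by apply: ih => k x; rewrite -derive1Sn; exact: (sv k.+1).
elim: n v dv => [|n ih] v dv x; first by have [] := dv 0%N.
by rewrite derive1Sn; apply: ih => k; have [] := dv k.+1.
Qed.

Lemma smooth_derivable v x : smooth v -> derivable v x 1.
Proof. by move=> /(_ 0%N); exact. Qed.

Lemma smooth_derive1 v : smooth v -> smooth (derive1 v).
Proof. by move=> sv n x; rewrite -derive1Sn; exact: (sv n.+1). Qed.

Lemma smooth_is_derive v x : smooth v -> is_derive x (1:R) v (derive1 v x).
Proof. by move=> sv; rewrite derive1E; apply/derivableP/smooth_derivable. Qed.

Lemma smooth_continuous v : smooth v -> continuous v.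
Proof.
by move=> sv x; apply/differentiable_continuous/derivable1_diffP/smooth_derivable.
Qed.

Lemma diffnD n f g : diffn n f -> diffn n g -> diffn n (fun x => f x + g x).
Proof.
elim: n f g => [|n ih] f g [df hf] [dg hg].
  by split; [move=> x; apply: derivableD; [exact: df|exact: dg]|exact: I].
split; first by move=> x; apply: derivableD; [exact: df|exact: dg].
rewrite (_ : derive1 _ = fun x => derive1 f x + derive1 g x).
  by apply: ih; [exact: hf|exact: hg].
by apply/funext => x; rewrite !derive1E deriveD; [|exact: df|exact: dg].
Qed.

Lemma diffnM n f g : diffn n f -> diffn n g -> diffn n (fun x => f x * g x).
Proof.
elim: n f g => [|n ih] f g Hf Hg; have [df hf] := Hf; have [dg hg] := Hg.
  by split; [move=> x; apply: derivableM; [exact: df|exact: dg]|exact: I].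
split; first by move=> x; apply: derivableM; [exact: df|exact: dg].
rewrite (_ : derive1 _ = fun x => f x * derive1 g x + g x * derive1 f x).
  have Hf' := diffnW Hf; have Hg' := diffnW Hg.
  by apply: diffnD; apply: ih; [exact: Hf'|exact: hg|exact: Hg'|exact: hf].
by apply/funext => x; rewrite !derive1E deriveM; [|exact: df|exact: dg].
Qed.

Lemma diffn_cst n (c : R) : diffn n (fun=> c).
Proof.
elim: n c => [|n ih] c; (split; first by move=> x; exact: derivable_cst).
  exact: I.
rewrite (_ : derive1 _ = fun=> 0); first exact: ih.
by apply/funext => x; rewrite derive1_cst.
Qed.

(** The derivative of [1 / f] is a product of [1 / f], [1 / f] and [f'], so the
    order of differentiability climbs one step at a time. *)
Lemma diffnV n f : (forall x, f x != 0) -> diffn n f ->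
  diffn n (fun x => (f x)^-1).
Proof.
move=> f0; elim: n => [|n ih] Hf; have [df hf] := Hf;
  (split; first by move=> x; apply: derivableV; [exact: f0|exact: df]).
  exact: I.
rewrite (_ : derive1 _ = fun x => (f x)^-1 * ((f x)^-1 * (-1 * derive1 f x))).
  have {}ih := ih (diffnW Hf).
  apply: diffnM; first exact: ih.
  apply: diffnM; first exact: ih.
  by apply: diffnM; [exact: diffn_cst|exact: hf].
apply/funext => x; rewrite !derive1E (@deriveV _ _ f); [|exact: f0|exact: df].
by rewrite mulN1r /GRing.scale/= mulNr !mulrN expr2 invfM mulrA.
Qed.

Lemma smoothD f g : smooth f -> smooth g -> smooth (fun x => f x + g x).
Proof. by move=> /smoothP ? /smoothP ?; apply/smoothP => n; exact: diffnD. Qed.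

Lemma smoothM f g : smooth f -> smooth g -> smooth (fun x => f x * g x).
Proof. by move=> /smoothP ? /smoothP ?; apply/smoothP => n; exact: diffnM. Qed.

Lemma smooth_cst (c : R) : smooth (fun=> c).
Proof. by apply/smoothP => n; exact: diffn_cst. Qed.

Lemma smoothV f : (forall x, f x != 0) -> smooth f -> smooth (fun x => (f x)^-1).
Proof. by move=> f0 /smoothP ?; apply/smoothP => n; exact: diffnV. Qed.

Lemma smoothB f g : smooth f -> smooth g -> smooth (fun x => f x - g x).
Proof.
move=> sf sg; rewrite (_ : (fun x => _) = fun x => f x + (-1) * g x).
  apply: smoothD; first exact: sf.
  by apply: smoothM; [exact: smooth_cst|exact: sg].
by apply/funext => x; rewrite mulN1r.
Qed.

Lemma is_derive_affine f (k b x : R) : derivable f (k * x + b) 1 ->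
  is_derive x (1:R) (fun y => f (k * y + b)) (k * derive1 f (k * x + b)).
Proof.
move=> df.
have H1 : is_derive x (1:R) (fun y : R => k * y + b) k.
  have H := is_deriveD (is_deriveZ k (is_derive_id x (1:R))) (is_derive_cst b x (1:R)).
  have E : k *: (1:R) + 0 = k by rewrite addr0 /GRing.scale/= mulr1.
  by rewrite E in H; exact: H.
have H2 : is_derive (k * x + b) (1:R) f (derive1 f (k * x + b)).
  by rewrite derive1E; apply/derivableP.
have := @is_derive1_comp _ f (fun y : R => k * y + b) x _ _ H2 H1.
by rewrite mulrC.
Qed.

Lemma derive1_affine f (k b x : R) : derivable f (k * x + b) 1 ->
  derive1 (fun y => f (k * y + b)) x = k * derive1 f (k * x + b).
Proof. by move=> /is_derive_affine df; rewrite derive1E derive_val. Qed.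

Lemma smooth_affine f (k b : R) : smooth f -> smooth (fun y => f (k * y + b)).
Proof.
move=> /smoothP sf; apply/smoothP => n.
elim: n f sf => [|n ih] f sf; (split;
  first by move=> x; exact: (@ex_derive _ _ _ _ _ _ _ (is_derive_affine ((sf 0%N).1 (k * x + b))))).
  exact: I.
rewrite (_ : derive1 _ = fun x => k * derive1 f (k * x + b)).
  apply: diffnM; first exact: diffn_cst.
  by apply: ih => m; have [] := sf m.+1.
apply/funext => x; apply: derive1_affine; exact: (sf 0%N).1.
Qed.

(** [x ^- n * exp (- 1 / x)] on the positive half-line: the powers of [1 / x] are
    included because differentiation of [exp (- 1 / x)] creates them. *)
Definition flat n (x : R) : R := if 0 < x then x ^- n * expR (- x^-1) else 0.

Lemma flat_ge0 n x : 0 <= flat n x.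
Proof.
rewrite /flat; case: ifP => // x0.
by rewrite mulr_ge0 ?expR_ge0// invr_ge0 exprn_ge0// ltW.
Qed.

Lemma flat_gt0 n x : 0 < x -> 0 < flat n x.
Proof. by move=> x0; rewrite /flat x0 mulr_gt0 ?expR_gt0// invr_gt0 exprn_gt0. Qed.

Lemma flat_le0 n x : x <= 0 -> flat n x = 0.
Proof. by rewrite /flat ltNge => ->. Qed.

(** [exp] dominates every power: [exp (1 / x)] exceeds the term of order [n + 1]
    of its series.  This makes [flat n] differentiable at 0. *)
Lemma flat_bound n x : 0 < x -> flat n x <= (n.+1)`!%:R * x.
Proof.
move=> x0; rewrite /flat x0 expRN.
have y0 : 0 < x^-1 by rewrite invr_gt0.
have := expR_ge1Dxn n (ltW y0).
have fa : 0 < (n.+1)`!%:R :> R by rewrite ltr0n fact_gt0.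
set F := (n.+1)`!%:R in fa *; set E := expR _ => h.
have E0 : 0 < E by exact: expR_gt0.
rewrite ler_pdivrMr//.
have h2 : x^-1 ^+ n.+1 / F <= E by apply: le_trans h; rewrite lerDr.
rewrite ler_pdivrMr// in h2.
rewrite -exprVn -ler_pdivrMl ?mulr_gt0// invfM -mulrA -exprS.
by rewrite ler_pdivrMl// [leRHS]mulrC.
Qed.

Lemma is_derive_flat n x :
  is_derive x (1:R) (flat n) (flat n.+2 x - n%:R * flat n.+1 x).
Proof.
have [x0|x0|x0] := ltgtP x 0.
- rewrite !(flat_le0 _ (ltW x0)) mulr0 subr0.
  apply: (@near_eq_is_derive _ _ _ (cst 0)) => //.
  near=> z; rewrite flat_le0//; apply/ltW.
  by near: z; exact: lt_nbhsl.
- have H1 : is_derive x (1:R) (fun z : R => z ^- n * expR (- z^-1))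
      (flat n.+2 x - n%:R * flat n.+1 x).
    have xn0 : x != 0 by rewrite gt_eqF.
    have HX : is_derive x (1:R) (fun z : R => z ^+ n) (n%:R * x ^+ n.-1).
      have H := is_deriveX n (is_derive_id x (1:R)).
      have E : (n%:R * x ^+ n.-1) *: (1:R) = n%:R * x ^+ n.-1.
        by rewrite /GRing.scale/= mulr1.
      rewrite E in H; rewrite (_ : (fun z : R => z ^+ n) = id ^+ n); first exact: H.
      by apply/funext => z; rewrite exprfctE.
    have HV : is_derive x (1:R) (fun z : R => (z ^+ n)^-1) (- (x ^+ n) ^- 2 * (n%:R * x ^+ n.-1)).
      by apply: (is_deriveV (f := fun z : R => z ^+ n)); rewrite expf_neq0.
    have HI : is_derive x (1:R) (fun z : R => - z^-1) (x ^- 2).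
      have H := is_deriveN (is_deriveV xn0 (is_derive_id x (1:R))).
      have E : - (- x ^- 2 *: (1:R)) = x ^- 2.
        by rewrite /GRing.scale/= mulr1 opprK.
      by rewrite E in H; exact: H.
    have HE : is_derive x (1:R) (fun z : R => expR (- z^-1)) (expR (- x^-1) * x ^- 2).
      exact: (@is_derive1_comp _ expR (fun z : R => - z^-1) x _ _ _ HI).
    have H := is_deriveM HV HE; move: H.
    set D := (X in is_derive _ _ _ X -> _) => H.
    rewrite (_ : flat n.+2 x - _ = D); first exact: H.
    rewrite /D /GRing.scale/= /flat x0.
    case: n {HX HV H D} => [|n]; first by rewrite /= !exprS !expr0; field.
    by rewrite /= !exprS; field; rewrite expf_neq0.
  apply: near_eq_is_derive H1.
  near=> z; rewrite /flat ifT//.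
  by near: z; exact: lt_nbhsr.
- subst x; rewrite !flat_le0// mulr0 subr0.
  have H : (fun h : R => h^-1 *: (flat n (h *: 1 + 0) - flat n 0)) @ 0^' --> (0:R).
    apply/cvgrPdist_le => e e0.
    have fa : 0 < (n.+2)`!%:R :> R by rewrite ltr0n fact_gt0.
    near=> h.
    rewrite sub0r normrN addr0 (flat_le0 n (lexx 0)) subr0 /GRing.scale/= mulr1.
    have [h0|h0] := leP h 0; first by rewrite flat_le0// mulr0 normr0 ltW.
    have hi : 0 <= h^-1 by rewrite invr_ge0 ltW.
    rewrite normrM (ger0_norm (flat_ge0 _ _)) (ger0_norm hi).
    have -> : h^-1 * flat n h = flat n.+1 h.
      by rewrite /flat h0 exprS invfM mulrA.
    apply: le_trans (flat_bound _ h0) _.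
    rewrite -ler_pdivlMl//.
    rewrite -(ger0_norm (ltW h0)).
    near: h; apply: dnbhs0_le; by rewrite mulr_gt0 ?invr_gt0.
  apply: DeriveDef; last by apply/cvg_lim.
  by apply/cvg_ex; exists 0.
Unshelve. all: by end_near. Qed.

Lemma smooth_flat n : smooth (flat n).
Proof.
apply/smoothP => k; elim: k n => [|k ih] n; split => //;
  try by move=> x; exact: (@ex_derive _ _ _ _ _ _ _ (is_derive_flat n x)).
rewrite (_ : derive1 _ = fun x => flat n.+2 x + (- n%:R) * flat n.+1 x).
  by apply: diffnD => //; apply: diffnM => //; exact: diffn_cst.
by apply/funext => x; rewrite derive1E (@derive_val _ _ _ _ _ _ _ (is_derive_flat n x)) mulNr.
Qed.
End Smooth.

(** * A smooth step *)

Section Step.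
Context {R : realType}.
Implicit Types (f g v : R -> R) (n k : nat) (x y h a : R).
Local Notation mu := (@lebesgue_measure R).

Lemma flat0_nd x y : x <= y -> flat 0 x <= flat 0 y.
Proof.
move=> xy; have [x0|x0] := leP x 0; first by rewrite flat_le0// flat_ge0.
have y0 : 0 < y by apply: lt_le_trans xy.
by rewrite /flat x0 y0 !expr0 !invr1 !mul1r ler_expR lerN2 lef_pV2.
Qed.

(** The transition takes place in [[1/4, 3/4]], so that [step] is constant outside
    and the derivatives of its rescalings are supported well inside their cells. *)
Definition step x : R :=
  flat 0 (x - 4^-1) / (flat 0 (x - 4^-1) + flat 0 (3 / 4 - x)).

Let den_gt0 x : 0 < flat 0 (x - 4^-1) + flat 0 (3 / 4 - x).
Proof.
have [x2|x2] := leP x (2^-1).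
  by rewrite ltr_wpDl ?flat_ge0// flat_gt0//; lra.
by rewrite ltr_pwDl ?flat_ge0// flat_gt0//; lra.
Qed.

Lemma smooth_step : smooth step.
Proof.
have s1 : smooth (fun x : R => flat 0 (x - 4^-1)).
  have := smooth_affine (k:=1) (b:=- 4^-1) (@smooth_flat R 0).
  by congr smooth; apply/funext => x; rewrite mul1r.
have s2 : smooth (fun x : R => flat 0 (3 / 4 - x)).
  have := smooth_affine (k:=-1) (b:=3 / 4) (@smooth_flat R 0).
  by congr smooth; apply/funext => x; rewrite mulN1r addrC.
apply: smoothM; first exact: s1.
apply: (smoothV (f := fun x => flat 0 (x - 4^-1) + flat 0 (3 / 4 - x))).
  by move=> x; rewrite gt_eqF.
exact: smoothD.
Qed.

Lemma step_lo x : x <= 4^-1 -> step x = 0.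
Proof. by move=> h; rewrite /step flat_le0 ?mul0r//; lra. Qed.

Lemma step_hi x : 3 / 4 <= x -> step x = 1.
Proof.
move=> h; have e : flat 0 (3 / 4 - x) = 0 by rewrite flat_le0//; lra.
by have := den_gt0 x; rewrite /step e addr0 => d; rewrite divff// gt_eqF.
Qed.

Lemma step_ge0 x : 0 <= step x.
Proof. by rewrite /step divr_ge0 ?flat_ge0// ltW. Qed.

Lemma step_le1 x : step x <= 1.
Proof. by rewrite /step ler_pdivrMr// mul1r lerDl flat_ge0. Qed.

Lemma step_nd x y : x <= y -> step x <= step y.
Proof.
move=> xy; rewrite /step ler_pdivrMr// mulrAC ler_pdivlMr//.
have h1 : flat 0 (x - 4^-1) <= flat 0 (y - 4^-1) by apply: flat0_nd; lra.
have h2 : flat 0 (3 / 4 - y) <= flat 0 (3 / 4 - x) by apply: flat0_nd; lra.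
rewrite !mulrDr mulrC lerD2l.
by apply: ler_pM => //; exact: flat_ge0.
Qed.

Lemma derive1_step_ge0 x : 0 <= derive1 step x.
Proof.
rewrite derive1E; apply: limr_ge; first exact: smooth_derivable smooth_step.
near=> h; rewrite /GRing.scale/= mulr1.
have [h0|h0] := leP 0 h.
  by rewrite mulr_ge0 ?invr_ge0// subr_ge0 step_nd// lerDr.
by rewrite mulr_le0// ?invr_le0 ?(ltW h0)// subr_le0 step_nd// gerDr ltW.
Unshelve. all: by end_near. Qed.

Lemma derive1_near_cst v x c : (\forall y \near x, v y = c) -> derive1 v x = 0.
Proof.
move=> h; rewrite derive1E.
have H : is_derive x (1:R) v 0.
  by apply: (near_eq_is_derive _ (is_derive_cst c x (1:R))); near do apply/esym.
exact: derive_val.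
Unshelve. all: by end_near. Qed.

Lemma stepn_out k x : x < 4^-1 \/ 3 / 4 < x -> derive1n k.+1 step x = 0.
Proof.
elim: k x => [|k ih] x [] h.
- rewrite derive1n1; apply: (@derive1_near_cst _ _ 0).
  by near=> y; apply: step_lo; apply/ltW; near: y; exact: lt_nbhsl.
- rewrite derive1n1; apply: (@derive1_near_cst _ _ 1).
  by near=> y; apply: step_hi; apply/ltW; near: y; exact: lt_nbhsr.
- rewrite derive1nS; apply: (@derive1_near_cst _ _ 0).
  by near=> y; apply: ih; left; near: y; exact: lt_nbhsl.
- rewrite derive1nS; apply: (@derive1_near_cst _ _ 0).
  by near=> y; apply: ih; right; near: y; exact: lt_nbhsr.
Unshelve. all: by end_near. Qed.

Lemma smooth_derive1n v n : smooth v -> smooth (derive1n n v).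
Proof. by elim: n => [//|n ih] sv; rewrite derive1nS; apply/smooth_derive1/ih. Qed.

(** The derivatives of positive order vanish outside [[0, 1]], where they are
    continuous. *)
Lemma stepn_bounded k : exists2 B : R, 0 < B & forall x, `|derive1n k step x| <= B.
Proof.
have sk : smooth (derive1n k step) by apply: smooth_derive1n; exact: smooth_step.
have ck : continuous (fun x => `|derive1n k step x|).
  by move=> x; apply: continuous_comp; [exact: smooth_continuous|exact: norm_continuous].
have ck' : {within `[0, 1], continuous (fun x => `|derive1n k step x|)}.
  exact: continuous_subspaceT.
have [c _ hc] := EVT_max ler01 ck'.
exists (`|derive1n k step c| + 1) => [|x]; first by rewrite ltr_wpDl.
have [x01|] := boolP (x \in `[0, 1]).
  by rewrite (le_trans (hc _ x01))// lerDl.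
rewrite in_itv/= => x01.
case: k sk ck ck' c hc => [|k] sk ck ck' c hc.
  rewrite derive1n0 (ger0_norm (step_ge0 _)) (le_trans (step_le1 _))//.
  by rewrite lerDr.
rewrite stepn_out ?normr0 ?addr_ge0//.
by have [?|?] := ltP x 0; [left; lra|right; lra].
Qed.

Lemma smooth_FTC v a b : smooth v -> a <= b ->
  \int[mu]_(x in `]a, b[) derive1 v x = v b - v a.
Proof.
move=> sv; rewrite le_eqVlt => /predU1P[->|ab].
  by rewrite set_itv_ge ?bnd_simp ?ltxx// Rintegral_set0 subrr.
have cv' : {within `[a, b], continuous (derive1 v)}.
  by apply: continuous_subspaceT; apply: smooth_continuous; exact: smooth_derive1.
have iv : mu.-integrable `[a, b] (EFin \o derive1 v).
  by apply: continuous_compact_integrable => //; exact: segment_compact.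
rewrite Rintegral_itv_bndo_bndc; last first.
  apply: (integrableS _ _ _ iv) => //; exact: subset_itv_oo_cc.
rewrite Rintegral_itv_obnd_cbnd; last first.
  apply: (integrableS _ _ _ iv) => //; apply: subset_itvr; by rewrite bnd_simp.
rewrite /Rintegral (@continuous_FTC2 _ _ v)//.
split.
- by move=> x _; exact: smooth_derivable.
- by apply: cvg_at_right_filter; exact: smooth_continuous.
- by apply: cvg_at_left_filter; exact: smooth_continuous.
Qed.

Lemma smooth_Taylor v B x y : smooth v ->
  (forall z, `|derive1n 2 v z| <= B) ->
  `|v y - v x - (y - x) * derive1 v x| <= B * (y - x) ^+ 2.
Proof.
move=> sv hB.
have mvt (w : R -> R) (p q : R) : smooth w -> exists2 z, `|z - p| <= `|q - p| & w q - w p = derive1 w z * (q - p).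
  move=> sw; have [pq|/ltW pq] := leP p q.
    have [||z zpq e] := @MVT_segment R w (derive1 w) p q pq.
    - by move=> z _; exact: smooth_is_derive.
    - by apply: continuous_subspaceT; exact: smooth_continuous.
    move: zpq; rewrite in_itv/= => /andP[pz zq].
    by exists z => //; rewrite !ger0_norm; lra.
  have [||z zpq e] := @MVT_segment R w (derive1 w) q p pq.
  - by move=> z _; exact: smooth_is_derive.
  - by apply: continuous_subspaceT; exact: smooth_continuous.
  move: zpq; rewrite in_itv/= => /andP[qz zp].
  by exists z; [rewrite !ler0_norm; lra|lra].
have [z hz ->] := mvt v x y sv.
have [z' _ e] := mvt (derive1 v) x z (smooth_derive1 sv).
have -> : derive1 v z * (y - x) - (y - x) * derive1 v x =
    derive1n 2 v z' * ((z - x) * (y - x)).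
  by rewrite mulrC -mulrBr e mulrCA mulrA mulrC derive1nS derive1n1; ring.
rewrite normrM; apply: ler_pM => //.
rewrite normrM expr2 -[leRHS]ger0_norm; last by rewrite -expr2 sqr_ge0.
by rewrite normrM ler_wpM2r.
Qed.

End Step.

#[global] Opaque step.

(** * Kernels and test functions *)

Section Kernels.
Context {R : realType}.
Implicit Types (f g v : R -> R) (n k : nat) (x y h a : R) (bc : boundary).
Local Notation mu := (@lebesgue_measure R).

(** The [k]-th derivative of [y |-> step ((y - a) / h)].  For [k = 0] it is a
    smoothed indicator of [y > a]; for [k = 1] a mollifier of mass 1 supported in
    [[a + h/4, a + 3h/4]]; for [k = 2] the derivative of this mollifier. *)
Definition kd k h a y : R := h^-1 ^+ k * derive1n k step (h^-1 * y + - (a / h)).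

Lemma smooth_kd k h a : smooth (kd k h a).
Proof.
apply: smoothM; first exact: smooth_cst.
apply: smooth_affine; apply: smooth_derive1n; exact: smooth_step.
Qed.

Lemma derive1_kd k h a : derive1 (kd k h a) = kd k.+1 h a.
Proof.
apply/funext => y; rewrite /kd derive1Ml; last first.
  by apply: smooth_derivable; apply: smooth_affine; apply: smooth_derive1n;
    exact: smooth_step.
rewrite derive1_affine; last first.
  by apply: smooth_derivable; apply: smooth_derive1n; exact: smooth_step.
by rewrite derive1nS exprSr mulrA.
Qed.

Lemma kd_shift k h a d y : kd k h (a + d) y = kd k h a (y - d).
Proof.
by rewrite /kd (_ : h^-1 * y + - _ = h^-1 * (y - d) + - (a / h)) //; ring.
Qed.

Lemma kd_out k h a y : 0 < h -> y < a + h / 4 \/ a + 3 * h / 4 < y ->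
  kd k.+1 h a y = 0.
Proof.
move=> h0 H; rewrite /kd stepn_out ?mulr0//.
rewrite [h^-1 * y]mulrC -mulrBl; case: H => H; [left|right].
  by rewrite ltr_pdivrMr//; lra.
by rewrite ltr_pdivlMr//; lra.
Qed.

Lemma kd0_lo h a y : 0 < h -> y <= a + h / 4 -> kd 0 h a y = 0.
Proof.
move=> h0 H; rewrite /kd derive1n0 step_lo ?mulr0//.
by rewrite [h^-1 * y]mulrC -mulrBl ler_pdivrMr//; lra.
Qed.

Lemma kd0_hi h a y : 0 < h -> a + 3 * h / 4 <= y -> kd 0 h a y = 1.
Proof.
move=> h0 H; rewrite /kd derive1n0 step_hi ?mulr1 ?expr0//.
by rewrite [h^-1 * y]mulrC -mulrBl ler_pdivlMr//; lra.
Qed.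

Lemma kd0_ge0 h a y : 0 <= kd 0 h a y.
Proof. by rewrite /kd derive1n0 expr0 mul1r step_ge0. Qed.

Lemma kd0_le1 h a y : kd 0 h a y <= 1.
Proof. by rewrite /kd derive1n0 expr0 mul1r step_le1. Qed.

Lemma kd1_ge0 h a y : 0 < h -> 0 <= kd 1 h a y.
Proof.
by move=> h0; rewrite /kd derive1n1 mulr_ge0 ?derive1_step_ge0// expr1 invr_ge0 ltW.
Qed.

Lemma kd_bounded k : exists2 B : R, 0 < B &
  forall h a y, 0 < h -> `|kd k h a y| <= B / h ^+ k.
Proof.
have [B B0 hB] := @stepn_bounded R k; exists B => // h a y h0.
have hk : 0 <= h^-1 ^+ k by rewrite exprn_ge0// invr_ge0 ltW.
by rewrite /kd normrM (ger0_norm hk) mulrC exprVn ler_wpM2r// -exprVn.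
Qed.

(** The 1-periodic function that agrees with [f] on [[0, 1[]. *)
Definition per f (x : R) : R := f (x - (Num.floor x)%:~R).

Let floorI x (m : int) : m%:~R <= x -> x < m%:~R + 1 -> Num.floor x = m.
Proof. by move=> h1 h2; apply: floor_def; rewrite h1 intrD. Qed.

Lemma per1 f x : per f (x + 1) = per f x.
Proof.
rewrite /per floorDrz ?rpred1// floor1; congr f.
by rewrite intrD; ring.
Qed.

Lemma per_id f x : x \in `]0, 1[ -> per f x = f x.
Proof.
rewrite in_itv/= => /andP[x0 x1]; rewrite /per (@floorI x 0) ?subr0//; lra.
Qed.

(** As [f] vanishes near 0 and 1, around each point the periodization is a single
    translate of [f]; hence it is smooth with the expected derivatives. *)
Lemma per_near f x : supported_in 0 1 f ->
  \forall y \near x, per f y = f (y - (Num.floor x)%:~R).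
Proof.
move=> [a' [b' [a0 b1 hf]]].
set n := Num.floor x.
have /andP[nx xn] : (n%:~R <= x) && (x < n%:~R + 1).
  by have := floor_itv x; rewrite intrD.
have out z : (z < a') || (b' < z) -> f z = 0.
  move=> H; apply: hf; rewrite in_itv/= negb_and -!ltNge //.
near=> y.
have y1 : n%:~R - (1 - b') < y by near: y; apply: lt_nbhsr; lra.
have y2 : y < n%:~R + 1 + a' by near: y; apply: lt_nbhsl; lra.
have [yn|yn] := ltP y n%:~R.
  have [b0|b0] := leP b' 0.
    have zf z : f z = 0.
      by apply: out; have [?|?] := ltP z a'; [|apply/orP; right; lra].
    by rewrite /per !zf.
  have -> : per f y = 0.
    rewrite /per (@floorI y (n - 1)) intrB; [|lra|lra].
    by apply: out; apply/orP; right; lra.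
  by rewrite out//; apply/orP; left; lra.
have [yn1|yn1] := ltP y (n%:~R + 1).
  by rewrite /per (@floorI y n).
have [a1|a1] := leP 1 a'.
  have zf z : f z = 0.
    by apply: out; have [?|?] := ltP z a'; [|apply/orP; right; lra].
  by rewrite /per !zf.
have -> : per f y = 0.
  rewrite /per (@floorI y (n + 1)) intrD; [|lra|lra].
  by apply: out; apply/orP; left; lra.
by rewrite out//; apply/orP; right; lra.
Unshelve. all: by end_near. Qed.

Lemma supported_derive1 f : supported_in 0 1 f -> supported_in 0 1 (derive1 f).
Proof.
move=> [a' [b' [a0 b1 hf]]]; exists a', b'; split => // x.
rewrite in_itv/= negb_and -!ltNge => /orP[] H; apply: (@derive1_near_cst _ _ _ 0).
- near=> y; apply: hf; rewrite in_itv/= negb_and -!ltNge; apply/orP; left.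
  by near: y; exact: lt_nbhsl.
- near=> y; apply: hf; rewrite in_itv/= negb_and -!ltNge; apply/orP; right.
  by near: y; exact: lt_nbhsr.
Unshelve. all: by end_near. Qed.

Lemma is_derive_per f x : smooth f -> supported_in 0 1 f ->
  is_derive x (1:R) (per f) (per (derive1 f) x).
Proof.
move=> sf suf; set n := (Num.floor x)%:~R : R.
have H : is_derive x (1:R) (fun y => f (1 * y + - n)) (1 * derive1 f (1 * x + - n)).
  by apply: is_derive_affine; exact: smooth_derivable.
rewrite mul1r mul1r -/(per (derive1 f) x) in H.
apply: near_eq_is_derive H; near=> y; rewrite mul1r; apply/esym.
near: y; exact: per_near.
Unshelve. all: by end_near. Qed.

Lemma derive1_per f : smooth f -> supported_in 0 1 f ->
  derive1 (per f) = per (derive1 f).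
Proof.
move=> sf suf; apply/funext => x; rewrite derive1E.
by have H := is_derive_per x sf suf; exact: derive_val.
Qed.

Lemma smooth_per f : smooth f -> supported_in 0 1 f -> smooth (per f).
Proof.
move=> sf suf; apply/smoothP => n; elim: n f sf suf => [|n ih] f sf suf;
  (split; first by move=> x; have H := is_derive_per x sf suf; exact: ex_derive).
  exact: I.
rewrite derive1_per//; apply: ih; first exact: smooth_derive1.
exact: supported_derive1.
Qed.

(** A smooth function supported inside the cell is a test function between walls,
    and its periodization is one on the circle. *)
Lemma test1_of bc f : smooth f -> supported_in 0 1 f ->
  exists2 phi, test1 bc phi & forall x, Omega x -> phi x = f x /\ derive1 phi x = derive1 f x.
Proof.
move=> sf suf; case: bc; first by exists f.
exists (per f); first by split; [exact: smooth_per|exact: per1].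
by move=> x Ox; rewrite derive1_per// !per_id.
Qed.

(** The second translate is what the circle adds: for [k > 0] and [a] in [[0, 1]]
    the sum agrees on the cell with the periodization of the kernel based at [a].  Between
    walls the centres keep the first translate inside the cell and the second
    outside. *)
Definition ker k h a y : R := kd k h a y + kd k h (a - 1) y.

Definition centers bc h : set R :=
  match bc with Dirichlet => `[0, 1 - h] | Periodic => `[0, 1] end.

Lemma smooth_ker k h a : smooth (ker k h a).
Proof. by apply: smoothD; exact: smooth_kd. Qed.

Lemma derive1_ker k h a : derive1 (ker k h a) = ker k.+1 h a.
Proof.
apply/funext => y; rewrite derive1E deriveD.
- by rewrite -!derive1E !derive1_kd.
- by apply: smooth_derivable; exact: smooth_kd.
- by apply: smooth_derivable; exact: smooth_kd.
Qed.

Lemma ker_test1 bc h a : 0 < h -> h <= 1 -> centers bc h a ->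
  exists2 phi, test1 bc phi &
    forall y, Omega y -> phi y = ker 1 h a y /\ derive1 phi y = ker 2 h a y.
Proof.
move=> h0 h1; case: bc => /=; rewrite in_itv/= => /andP[a0 a1].
  exists (kd 1 h a).
    split; first exact: smooth_kd.
    exists (a + h / 4), (a + 3 * h / 4); split; [lra|lra|].
    by move=> x; rewrite in_itv/= negb_and -!ltNge => /orP H; exact: kd_out.
  move=> y; rewrite /Omega/= in_itv/= => /andP[y0 y1].
  by rewrite derive1_kd /ker !(@kd_out _ h (a - 1)) ?addr0//; right; lra.
have su k : supported_in 0 1 (kd k.+1 h 0).
  exists (h / 4), (3 * h / 4); split; [lra|lra|].
  move=> x; rewrite in_itv/= negb_and -!ltNge => /orP H; apply: kd_out => //.
  by rewrite !add0r.
have E k y : Omega y -> per (kd k.+1 h 0) (1 * y + - a) = ker k.+1 h a y.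
  rewrite /Omega/= in_itv/= => /andP[y0 y1]; rewrite mul1r /ker.
  have Ea b : kd k.+1 h b y = kd k.+1 h 0 (y - b) by rewrite -kd_shift add0r.
  have [ya|ya] := ltP y a.
    rewrite (@kd_out _ h a)//; last by left; lra.
    rewrite add0r Ea /per (@floorI (y + - a) (-1)) intrN; [|lra|lra].
    by rewrite (_ : y + - a - - 1%:~R = y - (a - 1)) //; ring.
  rewrite (@kd_out _ h (a - 1))//; last by right; lra.
  by rewrite addr0 Ea /per (@floorI (y + - a) 0) ?subr0//; lra.
exists (fun y => per (kd 1 h 0) (1 * y + - a)).
  split; first by apply: smooth_affine; apply: smooth_per; [exact: smooth_kd|exact: su].
  by move=> x; rewrite -(per1 _ (1 * x + - a)); congr per; ring.
move=> y Oy; split; first exact: E.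
rewrite derive1_affine; last by apply: smooth_derivable; apply: smooth_per; [exact: smooth_kd|exact: su].
by rewrite derive1_per ?derive1_kd ?mul1r -?E ?mul1r//; exact: smooth_kd.
Qed.

(** The spatial factors of the test functions of the mass equation: between walls
    they need not vanish at the boundary. *)
Definition mass_test bc g : Prop := smooth g /\ periodic_if bc g.

Lemma test1_mass_test bc g : test1 bc g -> mass_test bc g.
Proof. by case: bc => -[]. Qed.

Lemma Ck_prod k g f : smooth g -> smooth f -> Ck k (fun x t => g x * f t).
Proof.
elim: k g f => [|k ih] g f sg sf; (split;
  first by move=> -[x t]; apply: (@continuousM _ _ (fun z : R * R => g z.1) (fun z => f z.2));
    apply: continuous_comp; [exact: cvg_fst| exact: smooth_continuous |exact: cvg_snd|exact: smooth_continuous]).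
  exact: I.
have D1 x t : is_derive x (1:R) (fun x => g x * f t) (derive1 g x * f t).
  have H := @is_deriveM _ _ g (cst (f t)) x 1 _ _ (smooth_is_derive x sg) (is_derive_cst _ _ _).
  by rewrite scaler0 add0r /GRing.scale/= in H; rewrite mulrC; exact: H.
have D2 x t : is_derive t (1:R) (fun t => g x * f t) (g x * derive1 f t).
  have H := @is_deriveM _ _ (cst (g x)) f t 1 _ _ (is_derive_cst _ _ _) (smooth_is_derive t sf).
  by rewrite scaler0 addr0 in H; exact: H.
split.
- by move=> x t; split; [have H := D1 x t|have H := D2 x t]; exact: ex_derive.
- rewrite (_ : dx _ = fun x t => derive1 g x * f t); first exact: (ih _ _ (smooth_derive1 sg) sf).
  by apply/funext => x; apply/funext => t; rewrite /dx derive1E; have H := D1 x t; exact: derive_val.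
- rewrite (_ : dt _ = fun x t => g x * derive1 f t); first exact: (ih _ _ sg (smooth_derive1 sf)).
  by apply/funext => x; apply/funext => t; rewrite /dt derive1E; have H := D2 x t; exact: derive_val.
Qed.

Lemma Psi_prod bc T g f T' : mass_test bc g -> smooth f -> T' < T ->
  (forall t, T' <= t -> f t = 0) -> Psi bc T (fun x t => g x * f t).
Proof.
move=> [sg pg] sf TT hf; split; first by move=> k; exact: Ck_prod.
- by exists T' => // x t /hf ->; rewrite mulr0.
- by move=> t; case: bc pg => //= pg x; rewrite pg.
Qed.

Lemma dt_prod g f x t : smooth f -> dt (fun x t => g x * f t) x t = g x * derive1 f t.
Proof. by move=> sf; rewrite /dt derive1Ml//; exact: smooth_derivable. Qed.

Lemma dx_prod g f x t : smooth g -> dx (fun x t => g x * f t) x t = derive1 g x * f t.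
Proof. by move=> sg; rewrite /dx derive1Mr//; exact: smooth_derivable. Qed.

End Kernels.

#[global] Opaque kd.

(** * Lower integrals of functions of unknown measurability *)

Section LowerIntegral.
Context d (T : measurableType d) (R : realType) (mu : {measure set T -> \bar R}).
Local Open Scope ereal_scope.
Implicit Types (A B D : set T) (f L : T -> \bar R).

Import HBNNSimple.

Lemma ge0_integral_sup D f : (forall x, 0 <= f x) ->
  \int[mu]_(x in D) f x = ereal_sup [set sintegral mu h |
    h in [set h : {nnsfun T >-> R} | forall x, (h x)%:E <= (f \_ D) x]].
Proof. by move=> f0; rewrite ge0_integralE. Qed.

Lemma ge0_le_integral_patch A B f g : (forall x, 0 <= f x) -> (forall x, 0 <= g x) ->
  (forall x, (f \_ A) x <= (g \_ B) x) ->
  \int[mu]_(x in A) f x <= \int[mu]_(x in B) g x.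
Proof.
move=> f0 g0 fg; rewrite !ge0_integral_sup//; apply: ereal_sup_le => _ [h hf <-].
by exists h => // x; exact: le_trans (fg x).
Qed.

Lemma lower_integral_subset A B L : (forall x, 0 <= L x) -> A `<=` B ->
  \int[mu]_(x in A) L x <= \int[mu]_(x in B) L x.
Proof.
move=> L0 AB; apply: ge0_le_integral_patch => // x; rewrite !patchE.
have [xA|xA] := boolP (x \in A); last by case: ifP.
by rewrite ifT// inE; apply: AB; rewrite -inE.
Qed.

(** The integral of a nonnegative function that may not be measurable is the
    supremum over the simple functions below it.  Simple functions below [L] on
    disjoint sets add up to a simple function below [L] on the union, which gives
    one of the two inequalities of additivity. *)
Lemma lower_integral_superadditive A B D L : (forall x, 0 <= L x) ->
  A `<=` D -> B `<=` D -> A `&` B = set0 ->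
  \int[mu]_(x in A) L x + \int[mu]_(x in B) L x <= \int[mu]_(x in D) L x.
Proof.
move=> L0 AD BD AB0.
have key (h1 h2 : {nnsfun T >-> R}) :
    (forall x, (h1 x)%:E <= (L \_ A) x) -> (forall x, (h2 x)%:E <= (L \_ B) x) ->
    sintegral mu h1 + sintegral mu h2 <= \int[mu]_(x in D) L x.
  move=> H1 H2; rewrite -sintegralD ge0_integral_sup//.
  apply: ereal_sup_ubound => /=; exists (add_nnsfun h1 h2) => //= x.
  have := H1 x; have := H2 x; rewrite !patchE EFinD.
  have [xA|xA] := boolP (x \in A); have [xB|xB] := boolP (x \in B).
  - have : (A `&` B) x by split; rewrite -inE.
    by rewrite AB0.
  - move=> h2x h1x; rewrite ifT; last by rewrite inE; apply: AD; rewrite -inE.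
    by rewrite -[leRHS]adde0; apply: leeD.
  - move=> h2x h1x; rewrite ifT; last by rewrite inE; apply: BD; rewrite -inE.
    by rewrite -[leRHS]add0e; apply: leeD.
  - move=> h2x h1x; rewrite (@le_trans _ _ 0)//; first by rewrite -[leRHS]adde0 leeD.
    by case: ifP.
have I0 E : 0 <= \int[mu]_(x in E) L x by apply: integral_ge0.
have s1 (h1 : {nnsfun T >-> R}) : (forall x, (h1 x)%:E <= (L \_ A) x) ->
    sintegral mu h1 + \int[mu]_(x in B) L x <= \int[mu]_(x in D) L x.
  move=> H1.
  have [DI|DI] := eqVneq (\int[mu]_(x in D) L x) +oo; first by rewrite DI leey.
  have h1fin : sintegral mu h1 \is a fin_num.
    rewrite ge0_fin_numE; last exact: sintegral_ge0.
    apply: (@le_lt_trans _ _ (\int[mu]_(x in D) L x)); last by rewrite ltey.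
    have := key h1 nnsfun0 H1; rewrite sintegral0 adde0; apply => x.
    by rewrite patchE; case: ifP.
  rewrite -leeBrDl// [X in X <= _]ge0_integral_sup//; apply: ge_ereal_sup => _ [h2 H2 <-].
  by rewrite leeBrDl//; exact: key.
have [DI|DI] := eqVneq (\int[mu]_(x in D) L x) +oo; first by rewrite DI leey.
have Bfin : \int[mu]_(x in B) L x \is a fin_num.
  rewrite ge0_fin_numE//.
  by apply: (@le_lt_trans _ _ (\int[mu]_(x in D) L x)); [exact: lower_integral_subset|rewrite ltey].
rewrite -leeBrDr// [X in X <= _]ge0_integral_sup//; apply: ge_ereal_sup => _ [h1 H1 <-].
by rewrite leeBrDr//; exact: s1.
Qed.

(** Only the minorant [f] is measurable: it is changed to 0 on the exceptional null
    set, and then lies below [L] everywhere. *)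
Lemma ae_le_lower_integral D f L : measurable D -> (forall x, 0 <= f x) ->
  (forall x, 0 <= L x) -> measurable_fun D f ->
  {ae mu, forall x, D x -> f x <= L x} ->
  \int[mu]_(x in D) f x <= \int[mu]_(x in D) L x.
Proof.
move=> mD f0 L0 mf [N [mN N0 sN]].
rewrite (ge0_negligible_integral mN mD mf _ N0)//.
apply: ge0_le_integral_patch => // x; rewrite !patchE.
have [|] := boolP (x \in D `\` N); last by case: ifP.
rewrite inE => -[Dx Nx]; rewrite ifT ?inE//.
by apply: contrapT => H; apply: Nx; apply: sN => /= /(_ Dx).
Qed.

End LowerIntegral.

(** * Integrals over the period cell *)

Section IntegralBounds.
Context d (T : measurableType d) (R : realType) (mu : {measure set T -> \bar R}).
Implicit Types (D : set T) (f g h : T -> R).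

Lemma ae_le_integrable D f h : measurable D -> measurable_fun D f ->
  mu.-integrable D (EFin \o h) -> {ae mu, forall x, D x -> `|f x| <= h x} ->
  mu.-integrable D (EFin \o f) /\ `|\int[mu]_(x in D) f x| <= \int[mu]_(x in D) h x.
Proof.
move=> mD mf ih fh.
have mEf : measurable_fun D (EFin \o f) by exact/measurable_EFinP.
have [mh hfin] := integrableP _ _ _ ih.
have le1 : (\int[mu]_(x in D) `|(EFin \o f) x| <= \int[mu]_(x in D) `|(EFin \o h) x|)%E.
  apply: ae_ge0_le_integral => //.
  - exact: measurableT_comp.
  - exact: measurableT_comp.
  - move: fh; apply: filterS => x + Dx => /(_ Dx) H /=.
    by rewrite lee_fin (le_trans H) ?ler_norm.
have fi : mu.-integrable D (EFin \o f).
  by apply/integrableP; split=> //; exact: le_lt_trans hfin.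
split=> //; apply: (le_trans (le_normr_Rintegral mD fi)).
rewrite /Rintegral fine_le//.
- apply: integrable_fin_num => //; exact: integrable_norm fi.
- exact: integrable_fin_num.
- have -> : (\int[mu]_(x in D) (h x)%:E = \int[mu]_(x in D) `|(h x)%:E|)%E.
    apply: ae_eq_integral => //; first exact: measurableT_comp.
    move: fh; apply: filterS => x + Dx => /(_ Dx) H.
    by rewrite /= ger0_norm// (le_trans _ H).
  exact: le1.
Qed.

Lemma ae_eq_Rintegral D f g : measurable D -> measurable_fun D f ->
  measurable_fun D g -> {ae mu, forall x, D x -> f x = g x} ->
  \int[mu]_(x in D) f x = \int[mu]_(x in D) g x.
Proof.
move=> mD mf mg fg; congr fine; apply: ae_eq_integral => //; try exact/measurable_EFinP.
by move: fg; apply: filterS => x + Dx => /(_ Dx) ->.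
Qed.

Lemma ae_le_Rintegral D f g : measurable D -> mu.-integrable D (EFin \o f) ->
  mu.-integrable D (EFin \o g) -> {ae mu, forall x, D x -> f x <= g x} ->
  \int[mu]_(x in D) f x <= \int[mu]_(x in D) g x.
Proof.
move=> mD fi gi fg; rewrite -subr_ge0 -RintegralB//.
have mB : measurable_fun D (fun x => g x - f x).
  apply: measurable_funB; apply/measurable_EFinP; exact: (measurable_int mu).
rewrite (@ae_eq_Rintegral D _ (fun x => `|g x - f x|))//.
- by apply: Rintegral_ge0.
- exact: measurableT_comp.
- by move: fg; apply: filterS => x + Dx => /(_ Dx) H; rewrite ger0_norm// subr_ge0.
Qed.

Lemma integrable_bounded_mul D f g (C : R) : measurable D ->
  mu.-integrable D (EFin \o f) -> measurable_fun D g ->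
  (forall x, D x -> `|g x| <= C) ->
  mu.-integrable D (EFin \o (fun x => f x * g x)) /\
  `|\int[mu]_(x in D) (f x * g x)| <= C * \int[mu]_(x in D) `|f x|.
Proof.
move=> mD fi mg gC.
have nfi : mu.-integrable D (EFin \o (fun x => `|f x|)) by exact: integrable_norm.
rewrite -RintegralZl//; apply: ae_le_integrable => //.
- by apply: measurable_funM => //; apply/measurable_EFinP; exact: (measurable_int mu).
- rewrite (_ : EFin \o _ = fun x => (C%:E * (`|f x|%R)%:E)%E)//.
  exact: integrableZl.
- by apply: aeW => x Dx; rewrite normrM mulrC ler_wpM2r// gC.
Qed.

End IntegralBounds.

Section RealLine.
Context {R : realType}.
Local Notation mu := (@lebesgue_measure R).
Implicit Types (f g v : R -> R) (D : set R) (a b c x y : R) (bc : boundary).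

Lemma ae_imp (P Q : R -> Prop) : (forall x, P x -> Q x) ->
  {ae mu, forall x, P x} -> {ae mu, forall x, Q x}.
Proof. by move=> PQ; apply: filterS PQ; exact: (ae_filter_ringOfSetsType mu). Qed.

Lemma ae_and (P Q : R -> Prop) : {ae mu, forall x, P x} -> {ae mu, forall x, Q x} ->
  {ae mu, forall x, P x /\ Q x}.
Proof.
move=> aP aQ; apply: (@filterI _ _ _ [set x | P x] [set x | Q x]) => //.
exact: (ae_filter_ringOfSetsType mu).
Qed.

Lemma integrable_cst_itv a b c : mu.-integrable `]a, b[ (EFin \o (fun=> c)).
Proof.
have fin : (lebesgue_measure (`]a, b[%classic : set R) < +oo)%E.
  by rewrite lebesgue_measure_itv/=; case: ifP => // _; exact: ltry.
by apply: measurable_bounded_integrable => //; exact: bounded_cst.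
Qed.

Lemma measurable_Omega : measurable (@Omega R).
Proof. exact: measurable_itv. Qed.

Lemma Omega_cst c : \int[mu]_(x in Omega) c = c.
Proof.
have H : mu (@Omega R) = 1%:E.
  by rewrite /Omega lebesgue_measure_itv/= lte_fin ltr01 oppr0 adde0.
transitivity (c * fine (mu (@Omega R))); last by rewrite H mulr1.
by rewrite -(@Rintegral_cst _ _ R (@lebesgue_measure R) _ measurable_Omega).
Qed.

Lemma integrable_Omega_cst c : mu.-integrable Omega (EFin \o (fun=> c)).
Proof. exact: integrable_cst_itv. Qed.

Lemma integrable_OmegaB f g : mu.-integrable Omega (EFin \o f) ->
  mu.-integrable Omega (EFin \o g) ->
  mu.-integrable Omega (EFin \o (fun x => f x - g x)).
Proof.
move=> fi gi; have := @integrableB _ _ _ mu Omega measurable_Omega _ _ fi gi.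
by apply: eq_integrable => //; exact: measurable_Omega.
Qed.

Lemma integrable_OmegaD f g : mu.-integrable Omega (EFin \o f) ->
  mu.-integrable Omega (EFin \o g) ->
  mu.-integrable Omega (EFin \o (fun x => f x + g x)).
Proof.
move=> fi gi; have := @integrableD _ _ _ mu Omega measurable_Omega _ _ fi gi.
by apply: eq_integrable => //; exact: measurable_Omega.
Qed.

Lemma integrable_OmegaZl c f : mu.-integrable Omega (EFin \o f) ->
  mu.-integrable Omega (EFin \o (fun x => c * f x)).
Proof.
move=> fi; have := @integrableZl _ _ _ mu Omega measurable_Omega c _ fi.
by apply: eq_integrable => //; exact: measurable_Omega.
Qed.

Lemma OmegaB f g : mu.-integrable Omega (EFin \o f) ->
  mu.-integrable Omega (EFin \o g) ->
  \int[mu]_(x in Omega) (f x - g x) =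
  \int[mu]_(x in Omega) f x - \int[mu]_(x in Omega) g x.
Proof. by apply: RintegralB; exact: measurable_Omega. Qed.

Lemma OmegaD f g : mu.-integrable Omega (EFin \o f) ->
  mu.-integrable Omega (EFin \o g) ->
  \int[mu]_(x in Omega) (f x + g x) =
  \int[mu]_(x in Omega) f x + \int[mu]_(x in Omega) g x.
Proof. by apply: RintegralD; exact: measurable_Omega. Qed.

Lemma OmegaZl c f : mu.-integrable Omega (EFin \o f) ->
  \int[mu]_(x in Omega) (c * f x) = c * \int[mu]_(x in Omega) f x.
Proof. by apply: RintegralZl; exact: measurable_Omega. Qed.

Lemma integrable_Omega_norm f : mu.-integrable Omega (EFin \o f) ->
  mu.-integrable Omega (EFin \o (fun x => `|f x|)).
Proof. exact: integrable_norm. Qed.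

Lemma Omega_measurable f : mu.-integrable Omega (EFin \o f) -> measurable_fun Omega f.
Proof. by move=> fi; apply/measurable_EFinP; exact: (measurable_int mu). Qed.

Lemma Omega_ae_le f h : measurable_fun Omega f ->
  mu.-integrable Omega (EFin \o h) -> {ae mu, forall x, Omega x -> `|f x| <= h x} ->
  mu.-integrable Omega (EFin \o f) /\
  `|\int[mu]_(x in Omega) f x| <= \int[mu]_(x in Omega) h x.
Proof. by move=> mf ih; apply: (@ae_le_integrable _ _ _ mu) => //; exact: measurable_Omega. Qed.

Lemma Omega_ae_le_int f g : mu.-integrable Omega (EFin \o f) ->
  mu.-integrable Omega (EFin \o g) -> {ae mu, forall x, Omega x -> f x <= g x} ->
  \int[mu]_(x in Omega) f x <= \int[mu]_(x in Omega) g x.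
Proof. by apply: ae_le_Rintegral; exact: measurable_Omega. Qed.

Lemma Omega_mul_bounded f g c : mu.-integrable Omega (EFin \o f) ->
  measurable_fun Omega g -> (forall x, Omega x -> `|g x| <= c) ->
  mu.-integrable Omega (EFin \o (fun x => f x * g x)) /\
  `|\int[mu]_(x in Omega) (f x * g x)| <= c * \int[mu]_(x in Omega) `|f x|.
Proof. by move=> *; apply: (@integrable_bounded_mul _ _ _ mu) => //; exact: measurable_Omega. Qed.

Lemma integral_supported_le D f a b c : measurable D -> measurable_fun D f ->
  0 <= c -> a <= b ->
  (forall x, D x -> `|f x| <= c) ->
  (forall x, D x -> x < a \/ b < x -> f x = 0) ->
  mu.-integrable D (EFin \o f) /\ `|\int[mu]_(x in D) f x| <= c * (b - a).
Proof.
move=> mD mf c0 ab fc f0.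
have mi : measurable `[a, b] by exact: measurable_itv.
have mui : mu `[a, b] = (b - a)%:E.
  rewrite lebesgue_measure_itv/= lte_fin; case: ltP => [_|ba]; first by rewrite EFinB.
  by rewrite (_ : b = a) ?subrr//; apply/eqP; rewrite eq_le ba ab.
have ii : mu.-integrable setT (EFin \o (\1_`[a, b] : R -> R)).
  exact: (@integrable_indic_itv R a b true false).
have iD : mu.-integrable D (EFin \o (fun x => c * \1_`[a, b] x)).
  rewrite (_ : EFin \o _ = fun x => (c%:E * (\1_`[a, b] x)%:E)%E)//.
  by apply: integrableZl => //; exact: integrableS ii.
have H : {ae mu, forall x, D x -> `|f x| <= c * \1_`[a, b] x}.
  apply: aeW => x Dx; rewrite indicE; case: (boolP (x \in _)) => xab; rewrite ?mulr1 ?fc//.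
  rewrite f0 ?normr0 ?mulr0//.
  move: xab; rewrite notin_setE/= in_itv/= => /negP; rewrite negb_and -!ltNge.
  by case/orP; [left|right].
have [fi le1] := @ae_le_integrable _ _ _ mu D f _ mD mf iD H; split => //.
apply: (le_trans le1); rewrite RintegralZl//; last exact: integrableS ii.
rewrite ler_wpM2l// /Rintegral integral_indic//.
rewrite -[leRHS]/(fine (b - a)%:E) -mui fine_le//.
- rewrite ge0_fin_numE//; apply: (@le_lt_trans _ _ (mu `[a, b])).
    by apply: le_measure; rewrite ?inE//; exact: measurableI.
  by rewrite mui ltry.
- by rewrite mui.
- by apply: le_measure; rewrite ?inE//; exact: measurableI.
Qed.

Lemma smooth_measurable v D : measurable D -> smooth v -> measurable_fun D v.
Proof.
move=> mD sv; apply: measurable_funTS; apply: continuous_measurable_fun.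
exact: smooth_continuous.
Qed.

Lemma kd_measurable k h a D : measurable D -> measurable_fun D (kd k h a).
Proof. by move=> mD; apply: smooth_measurable => //; exact: smooth_kd. Qed.

End RealLine.

(** * Lebesgue points *)

Section LebesguePoint.
Context {R : realType}.
Local Notation mu := (@lebesgue_measure R).
Implicit Types (f g v : R -> R) (D : set R) (a b c x y : R) (bc : boundary).

Lemma integral_kd1_Omega h x : 0 < h -> 0 <= x -> x + h <= 1 ->
  \int[mu]_(y in Omega) kd 1 h x y = 1.
Proof.
move=> h0 x0 x1; rewrite -derive1_kd /Omega smooth_FTC//; last exact: smooth_kd.
by rewrite kd0_hi ?kd0_lo ?subr0//; lra.
Qed.

Lemma bounded_integrable_Omega f c : measurable_fun Omega f ->
  (forall x, Omega x -> `|f x| <= c) -> mu.-integrable Omega (EFin \o f).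
Proof.
move=> mf fc.
have := @ae_le_integrable _ _ _ mu Omega f (fun=> c) measurable_Omega mf (integrable_Omega_cst c).
by case => //; exact: aeW.
Qed.

Lemma smooth_bounded v : smooth v -> exists2 c, 0 < c & forall x, Omega x -> `|v x| <= c.
Proof.
move=> sv.
have ck' : {within `[0, 1], continuous (fun x => `|v x|)}.
  apply: continuous_subspaceT => x.
  by apply: continuous_comp; [exact: smooth_continuous|exact: norm_continuous].
have [c _ hc] := EVT_max ler01 ck'.
exists (`|v c| + 1) => [|x Ox]; first by rewrite ltr_wpDl.
by rewrite (@le_trans _ _ `|v c|) ?lerDl//; apply: hc; exact: subset_itv_oo_cc Ox.
Qed.

Lemma smooth_integrable_Omega v : smooth v -> mu.-integrable Omega (EFin \o v).
Proof.
move=> sv; have [c _ hc] := smooth_bounded sv.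
apply: bounded_integrable_Omega hc.
by apply: smooth_measurable => //; exact: measurable_Omega.
Qed.

Lemma integrable_kd k h x : mu.-integrable Omega (EFin \o (kd k h x)).
Proof. by apply: smooth_integrable_Omega; exact: smooth_kd. Qed.

Lemma integrable_mul_kd v k h x : mu.-integrable Omega (EFin \o v) ->
  mu.-integrable Omega (EFin \o (fun y => v y * kd k h x y)).
Proof.
move=> iv; have [c _ hc] := smooth_bounded (@smooth_kd R k h x).
have := @integrable_bounded_mul _ _ _ mu Omega v (kd k h x) c measurable_Omega iv.
by case => //; apply: kd_measurable; exact: measurable_Omega.
Qed.

(** The mollifier is bounded by [B / h] and lives in a ball of radius [h], so its
    average of [v] differs from [v x] by at most a constant times the mean
    oscillation of [v] over that ball. *)
Lemma lebesgue_pt_kd v x : mu.-integrable Omega (EFin \o v) ->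
  lebesgue_pt (v \_ Omega) x -> Omega x -> forall e : R, 0 < e ->
  exists2 d, 0 < d & forall h, 0 < h < d ->
    `|\int[mu]_(y in Omega) (v y * kd 1 h x y) - v x| <= e.
Proof.
move=> iv lx Ox e e0.
have /andP[x0 x1] : (0 < x) && (x < 1) by move: Ox; rewrite /Omega/= in_itv.
have [B B0 hB] := @kd_bounded R 1.
set w := v \_ Omega in lx.
have mw : measurable_fun setT w.
  by apply/(measurable_restrictT v measurable_Omega)/measurable_EFinP; exact: (measurable_int mu).
pose c := e / (2 * B).
have c0 : 0 < c by rewrite divr_gt0// mulr_gt0.
have /lx : nbhs (0%E : \bar R) [set z | (z < c%:E)%E].
  by apply: open_nbhs_nbhs; split; [exact: open_ereal_lt_ereal|rewrite /= lte_fin].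
case=> d /= d0 hd.
exists (Num.min d (1 - x)); first by rewrite lt_min d0 subr_gt0.
move=> h /andP[h0]; rewrite lt_min => /andP[hd' h1].
have {}hd : (davg w x h < c%:E)%E.
  by apply: hd => //=; rewrite sub0r normrN gtr0_norm.
have mb : measurable (ball x h) by exact: measurable_ball.
have wx : w x = v x by rewrite /w patchE mem_set.
have {}hd : (\int[mu]_(y in ball x h) `|(w y - w x)%:E| <= (2 * h * c)%:E)%E.
  move: hd; rewrite /davg /iavg (lebesgue_measure_ball _ (ltW h0)).
  have h20 : 0 < h *+ 2 by rewrite pmulrn_lgt0.
  rewrite inver gt_eqF// => /ltW; rewrite lee_pdivrMl// => H.
  by rewrite (le_trans H)// -EFinM mulr2n lee_fin; lra.
have ik : mu.-integrable Omega (EFin \o (fun y => (v y - v x) * kd 1 h x y)).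
  apply: (@integrable_mul_kd (fun y => v y - v x)).
  by apply: integrable_OmegaB => //; exact: integrable_Omega_cst.
have -> : \int[mu]_(y in Omega) (v y * kd 1 h x y) - v x =
    \int[mu]_(y in Omega) ((v y - v x) * kd 1 h x y).
  rewrite -[in LHS](mulr1 (v x)) -(@integral_kd1_Omega h x)//; try lra.
  rewrite -OmegaZl; last exact: integrable_kd.
  rewrite -OmegaB; first by apply: eq_Rintegral => y _; rewrite mulrBl.
    exact: integrable_mul_kd.
  apply: (@integrable_mul_kd (fun=> v x)); exact: integrable_Omega_cst.
rewrite -lee_fin EFin_normr_Rintegral//; last exact: measurable_Omega.
have mi : measurable_fun Omega (fun y => ((v y - v x) * kd 1 h x y)%:E).
  exact: (measurable_int mu).
apply: (le_trans (le_abse_integral mu measurable_Omega mi)).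
apply: (@le_trans _ _ (\int[mu]_(y in ball x h) ((B / h)%:E * `|(w y - w x)%:E|))%E).
  apply: ge0_le_integral_patch => //.
    by move=> y; rewrite mule_ge0// lee_fin divr_ge0// ltW.
  move=> y; rewrite !patchE.
  have [|] := boolP (y \in Omega); rewrite ?inE => Oy; last first.
    by case: ifP => // _; rewrite mule_ge0// lee_fin divr_ge0// ltW.
  have [yb|yb] := pselect (ball x h (y : R)).
    rewrite (mem_set yb) -EFinM lee_fin wx /w patchE mem_set// normrM mulrC ler_wpM2r//.
    by have := hB h x y h0; rewrite expr1.
  rewrite memNset// kd_out//; first by rewrite mulr0 /= normr0.
  move: yb; rewrite /ball/= => /negP; rewrite -leNgt.
  by rewrite ler_normr => /orP[] H; [left|right]; lra.
rewrite ge0_integralZl//; last first.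
- by rewrite lee_fin divr_ge0// ltW.
- apply/measurable_EFinP; apply: measurableT_comp => //.
  by apply: measurable_funB => //; exact: measurable_funTS.
apply: (@le_trans _ _ ((B / h)%:E * (2 * h * c)%:E)%E).
  by rewrite lee_wpmul2l// lee_fin divr_ge0// ltW.
rewrite -EFinM lee_fin le_eqVlt; apply/orP; left; apply/eqP.
have B0' : B != 0 by rewrite gt_eqF.
have h0' : h != 0 by rewrite gt_eqF.
by rewrite /c; field; rewrite B0' h0'.
Qed.

End LebesguePoint.

(** * The Lipschitz bound given by a weak derivative *)

Section WeakLipschitz.
Context {R : realType}.
Local Notation mu := (@lebesgue_measure R).
Implicit Types (f g v : R -> R) (a b c x y L : R) (bc : boundary).

Lemma L1loc_measurable bc g : L1loc bc g -> measurable_fun Omega g.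
Proof. by case: bc => [[]|/Omega_measurable]. Qed.

Lemma Omega_step_le (h x c : R) : 0 < h -> 0 <= c -> 0 <= x -> x <= 1 ->
  \int[mu]_(z in Omega) (c * kd 0 h x z) <= c * (1 - x).
Proof.
move=> h0 c0 x0 x1; apply: (le_trans (ler_norm _)).
apply: (integral_supported_le measurable_Omega _ c0 x1 _ _).2.
- by apply: measurable_funM => //; apply: kd_measurable; exact: measurable_Omega.
- move=> z _; rewrite normrM (ger0_norm c0) ler_piMr// ger0_norm ?kd0_le1//.
  exact: kd0_ge0.
- move=> z; rewrite /Omega/= in_itv/= => /andP[z0 z1] [zx|]; last by lra.
  by rewrite kd0_lo ?mulr0//; lra.
Qed.

Lemma Omega_costep_le (h x c : R) : 0 < h -> 0 <= c -> 0 <= x ->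
  \int[mu]_(z in Omega) (c * (1 - kd 0 h x z)) <= c * (x + h).
Proof.
move=> h0 c0 x0; apply: (le_trans (ler_norm _)).
have xh : 0 <= x + h by lra.
rewrite -[x + h]subr0.
apply: (integral_supported_le measurable_Omega _ c0 xh _ _).2.
- apply: measurable_funM => //; apply: measurable_funB => //.
  by apply: kd_measurable; exact: measurable_Omega.
- move=> z _; rewrite normrM (ger0_norm c0) ler_piMr// ger0_norm.
    by rewrite gerBl kd0_ge0.
  by rewrite subr_ge0 kd0_le1.
- move=> z; rewrite /Omega/= in_itv/= => /andP[z0 z1] [|zx]; first by lra.
  by rewrite kd0_hi ?subrr ?mulr0//; lra.
Qed.

Lemma Omega_weak_le g f (L : R) : measurable_fun Omega g -> smooth f ->
  {ae mu, forall x, Omega x -> `|g x| <= L} -> 0 <= L ->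
  `|\int[mu]_(z in Omega) (g z * f z)| <= \int[mu]_(z in Omega) (L * `|f z|).
Proof.
move=> mg sf gL L0.
have mf : measurable_fun Omega f by apply: smooth_measurable => //; exact: measurable_Omega.
have fi := smooth_integrable_Omega sf.
apply: (Omega_ae_le _ _ _).2.
- exact: measurable_funM.
- by apply: integrable_OmegaZl; exact: integrable_Omega_norm.
- by move: gL; apply: ae_imp => x + Ox => /(_ Ox) H; rewrite normrM ler_wpM2r.
Qed.

Let arith_three (i j p q L c h e : R) : `|i - j| <= L * (c + h) ->
  `|i - p| <= e / 3 -> `|j - q| <= e / 3 -> L * h <= e / 3 -> `|p - q| <= L * c + e.
Proof.
rewrite mulrDr => H1 H2 H3 H4.
have -> : p - q = (i - j) + (j - q) - (i - p) by ring.
by rewrite (le_trans (ler_normB _ _))// (le_trans (lerD (ler_normD _ _) (lexx _)))//; lra.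
Qed.

(** Testing with [f h], a smoothed indicator of [[x, y]], compares mollified values
    of [v] at [x] and [y] with the integral of [g] between them; [h -> 0] at
    Lebesgue points gives the first bound.  On the circle [1 - f h] is a test
    function as well and goes around the other way. *)
Lemma weak_deriv_Lipschitz_lt bc v g L x y :
  mu.-integrable Omega (EFin \o v) -> weak_deriv bc v g ->
  {ae mu, forall x, Omega x -> `|g x| <= L} -> 0 <= L ->
  lebesgue_pt (v \_ Omega) x -> lebesgue_pt (v \_ Omega) y ->
  Omega x -> Omega y -> x < y ->
  `|v x - v y| <= L * (y - x) /\ (bc = Periodic -> `|v x - v y| <= L * (1 - (y - x))).
Proof.
move=> iv [_ /L1loc_measurable mg wd] gL L0 lx ly Ox Oy xy.
have /andP[x0 x1] : (0 < x) && (x < 1) by move: Ox; rewrite /Omega/= in_itv.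
have /andP[y0 y1] : (0 < y) && (y < 1) by move: Oy; rewrite /Omega/= in_itv.
pose f (h z : R) := kd 0 h x z - kd 0 h y z.
have sf h : smooth (f h) by apply: smoothB; exact: smooth_kd.
have df h : derive1 (f h) = fun z => kd 1 h x z - kd 1 h y z.
  apply/funext => z; rewrite derive1E deriveB.
  - by rewrite -!derive1E !derive1_kd.
  - by apply: smooth_derivable; exact: smooth_kd.
  - by apply: smooth_derivable; exact: smooth_kd.
have suf h : 0 < h -> h < 1 - y -> supported_in 0 1 (f h).
  move=> h0 h1; exists (x : R), (y + h); split; [lra|lra|].
  move=> z; rewrite in_itv/= negb_and -!ltNge /f => /orP[] H.
    by rewrite !kd0_lo ?subrr//; lra.
  by rewrite !kd0_hi ?subrr//; lra.
pose A (h : R) := \int[mu]_(z in Omega) (v z * kd 1 h x z) - \int[mu]_(z in Omega) (v z * kd 1 h y z).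
have Af h : A h = \int[mu]_(z in Omega) (v z * derive1 (f h) z).
  rewrite /A -OmegaB; [|exact: integrable_mul_kd|exact: integrable_mul_kd].
  by apply: eq_Rintegral => z _; rewrite df mulrBr.
have ikd c k h a : mu.-integrable Omega (EFin \o (fun z => c * kd k h a z)).
  by apply: integrable_OmegaZl; exact: integrable_kd.
have A1 h : 0 < h -> h < 1 - y -> `|A h| <= L * (y - x + h).
  move=> h0 h1; have [phi tphi ephi] := test1_of bc (sf h) (suf _ h0 h1).
  have := wd _ tphi.
  rewrite (_ : Rintegral _ _ _ = A h); last first.
    by rewrite Af; apply: eq_Rintegral => z /set_mem /ephi[_ ->].
  move=> ->; rewrite normrN.
  rewrite (_ : Rintegral _ _ _ = \int[mu]_(z in Omega) (g z * f h z)); last first.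
    by apply: eq_Rintegral => z /set_mem /ephi[-> _].
  apply: (le_trans (Omega_weak_le mg (sf h) gL L0)).
  apply: (le_trans (ler_norm _)).
  have xyh : x <= y + h by lra.
  rewrite (_ : y - x + h = y + h - x); last by ring.
  apply: (integral_supported_le measurable_Omega _ L0 xyh _ _).2.
  - apply: measurable_funM => //; apply: measurableT_comp => //.
    by apply: smooth_measurable => //; exact: measurable_Omega.
  - move=> z _; rewrite normrM (ger0_norm L0) normr_id ler_piMr// /f.
    have := kd0_ge0 h x z; have := kd0_le1 h x z.
    have := kd0_ge0 h y z; have := kd0_le1 h y z => *.
    by rewrite ler_norml; apply/andP; split; lra.
  - move=> z _ [H|H]; rewrite /f.
      by rewrite !kd0_lo ?subrr ?normr0 ?mulr0//; lra.
    by rewrite !kd0_hi ?subrr ?normr0 ?mulr0//; lra.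
have A2 h : bc = Periodic -> 0 < h -> h < 1 - y -> `|A h| <= L * (1 - (y - x) + h).
  move=> bcP h0 h1; have [phi tphi ephi] := test1_of bc (sf h) (suf _ h0 h1).
  have sphi : smooth phi by have [] := test1_mass_test tphi.
  have tphi' : test1 bc (fun z => 1 - phi z).
    rewrite bcP; split; first exact: (smoothB (@smooth_cst R 1) sphi).
    by move: tphi; rewrite bcP => -[_ pp] z; rewrite pp.
  have := wd _ tphi'.
  rewrite (_ : Rintegral _ _ _ = - A h); last first.
    rewrite Af -mulN1r -OmegaZl; last first.
      have [c _ hc] := smooth_bounded (smooth_derive1 (sf h)).
      exact: (Omega_mul_bounded iv (smooth_measurable measurable_Omega (smooth_derive1 (sf h))) hc).1.
    apply: eq_Rintegral => z /set_mem /ephi[_ <-].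
    rewrite derive1E deriveB; [|exact: derivable_cst|exact: smooth_derivable].
    by rewrite derive_cst sub0r -derive1E; ring.
  move=> /(congr1 Num.norm); rewrite !normrN => ->.
  rewrite (_ : Rintegral _ _ _ = \int[mu]_(z in Omega) (g z * (1 - f h z))); last first.
    by apply: eq_Rintegral => z /set_mem /ephi[-> _].
  have sf1 : smooth (fun z => 1 - f h z) by exact: (smoothB (@smooth_cst R 1) (sf h)).
  apply: (le_trans (Omega_weak_le mg sf1 gL L0)).
  have -> : \int[mu]_(z in Omega) (L * `|1 - f h z|) =
    \int[mu]_(z in Omega) (L * (1 - kd 0 h x z)) + \int[mu]_(z in Omega) (L * kd 0 h y z).
    rewrite -OmegaD//; last first.
      by apply: integrable_OmegaZl; apply: integrable_OmegaB; [exact: integrable_Omega_cst|exact: integrable_kd].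
    apply: eq_Rintegral => z _; rewrite -mulrDr; congr (_ * _).
    rewrite ger0_norm /f; first by ring.
    have := kd0_le1 h x z; have := kd0_ge0 h y z; lra.
  have := @Omega_costep_le h x L h0 L0 (ltW x0).
  have := @Omega_step_le h y L h0 L0 (ltW y0) (ltW y1).
  by rewrite !mulrDr !mulrN; lra.
have lim c : (forall h, 0 < h -> h < 1 - y -> `|A h| <= L * (c + h)) -> `|v x - v y| <= L * c.
  move=> HA; apply/ler_addgt0Pr => e e0.
  have e30 : 0 < e / 3 by rewrite divr_gt0.
  have [dx dx0 hx] := lebesgue_pt_kd iv lx Ox e30.
  have [dy dy0 hy] := lebesgue_pt_kd iv ly Oy e30.
  pose m := Num.min (Num.min dx dy) (Num.min (1 - y) (e / 3 / (L + 1))).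
  have L1 : 0 < L + 1 by lra.
  have m0 : 0 < m by rewrite !lt_min dx0 dy0 subr_gt0 y1 divr_gt0.
  pose h := m / 2.
  have h0 : 0 < h by rewrite divr_gt0.
  have hm : h < m by rewrite /h; lra.
  have := hm; rewrite /m !lt_min => /andP[/andP[h1 h2] /andP[h3 h4]].
  have hh1 : 0 < h < dx by rewrite h0.
  have hh2 : 0 < h < dy by rewrite h0.
  have Lh : L * h <= e / 3.
    have : h * (L + 1) < e / 3 by rewrite -ltr_pdivlMr.
    by rewrite mulrDr mulr1 mulrC => /ltW; apply: le_trans; rewrite lerDl ltW.
  exact: arith_three (HA _ h0 h3) (hx _ hh1) (hy _ hh2) Lh.
split; first by apply: lim => h h0 h1; exact: A1.
by move=> bcP; apply: lim => h h0 h1; exact: A2.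
Qed.

Lemma weak_deriv_Lipschitz bc v g L x y :
  mu.-integrable Omega (EFin \o v) -> weak_deriv bc v g ->
  {ae mu, forall x, Omega x -> `|g x| <= L} -> 0 <= L ->
  lebesgue_pt (v \_ Omega) x -> lebesgue_pt (v \_ Omega) y ->
  Omega x -> Omega y ->
  `|v x - v y| <= L * `|x - y| /\ (bc = Periodic -> `|v x - v y| <= L * (1 - `|x - y|)).
Proof.
move=> iv wd gL L0 lx ly Ox Oy; have [xy|yx|<-] := ltgtP x y.
- rewrite distrC [`|x - y|]distrC [`|y - x|]gtr0_norm ?subr_gt0// distrC.
  exact: weak_deriv_Lipschitz_lt iv wd gL L0 lx ly Ox Oy xy.
- rewrite distrC [`|x - y|]gtr0_norm ?subr_gt0//.
  exact: weak_deriv_Lipschitz_lt iv wd gL L0 ly lx Oy Ox yx.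
- by rewrite !subrr normr0 mulr0 subr0 mulr1.
Qed.

End WeakLipschitz.

(** * Increments in time from a weak equation *)

Section TimeIncrement.
Context {R : realType}.
Local Notation mu := (@lebesgue_measure R).
Implicit Types (f g v F J : R -> R) (a b c x y T h t : R).

Lemma integral_kd1_itv T h t : 0 < h -> 0 <= t -> t + h <= T ->
  \int[mu]_(y in `]0, T[) kd 1 h t y = 1.
Proof.
move=> h0 t0 t1; rewrite -derive1_kd smooth_FTC//; [|exact: smooth_kd|lra].
by rewrite kd0_hi ?kd0_lo ?subr0//; lra.
Qed.

Lemma itv_mul_kd T k h t f : mu.-integrable `]0, T[ (EFin \o f) -> 0 < h ->
  mu.-integrable `]0, T[ (EFin \o (fun y => f y * kd k h t y)).
Proof.
move=> fi h0; have [B _ hB] := @kd_bounded R k.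
apply: (@integrable_bounded_mul _ _ _ mu `]0, T[ f (kd k h t) (B / h ^+ k) _ fi _ _).1 => //.
- exact: kd_measurable.
- by move=> y _; exact: hB.
Qed.

(** At a point of continuity one-sided mollifiers recover the value. *)
Lemma continuous_kd T F t : mu.-integrable `]0, T[ (EFin \o F) ->
  0 < t < T -> {for t, continuous F} -> forall e : R, 0 < e ->
  exists2 d, 0 < d & forall h, 0 < h < d ->
    `|\int[mu]_(y in `]0, T[) (F y * kd 1 h t y) - F t| <= e.
Proof.
move=> iF /andP[t0 tT] cF e e0.
move/cvgrPdist_lt: cF => /(_ e e0) /=.
case=> d /= d0 hd; exists (Num.min d (T - t)); first by rewrite lt_min d0 subr_gt0.
move=> h /andP[h0]; rewrite lt_min => /andP[hd' hT].
have mI : measurable (`]0, T[%classic : set R) by [].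
have ic c : mu.-integrable `]0, T[ (EFin \o (fun=> c)) by exact: integrable_cst_itv.
have iFk := itv_mul_kd 1 t iF h0.
have ick c := itv_mul_kd 1 t (ic c) h0.
have -> : \int[mu]_(y in `]0, T[) (F y * kd 1 h t y) - F t =
    \int[mu]_(y in `]0, T[) ((F y - F t) * kd 1 h t y).
  rewrite -[in LHS](mulr1 (F t)) -(@integral_kd1_itv T h t)//; [|lra|lra].
  rewrite -RintegralZl//; last first.
    by have := ick 1; apply: eq_integrable => // y _ /=; rewrite mul1r.
  by rewrite -RintegralB//; apply: eq_Rintegral => y _; rewrite mulrBl.
rewrite -[leRHS]mulr1 -(@integral_kd1_itv T h t)//; [|lra|lra].
rewrite -RintegralZl//; last first.
  by have := ick 1; apply: eq_integrable => // y _ /=; rewrite mul1r.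
apply: (@ae_le_integrable _ _ _ mu `]0, T[ _ _ mI _ (ick e) _).2.
  apply: measurable_funM; last exact: kd_measurable.
  apply: measurable_funB => //; apply/measurable_EFinP; exact: (measurable_int mu).
apply: aeW => y _; rewrite normrM (ger0_norm (kd1_ge0 _ _ h0)).
have [yt|yt] := ltP `|t - y| d.
  by rewrite ler_wpM2r ?kd1_ge0// distrC ltW//; apply: hd.
rewrite kd_out ?mulr0//.
by move: yt; rewrite ler_normr => /orP[] H; [left|right]; lra.
Qed.

(** The weak form of [F' = J] in time is tested with smoothed indicators of
    [[t1, t2]].  Their derivatives concentrate at [t1] and [t2], where [F] is
    continuous, while the functions themselves are bounded by 1 and converge
    pointwise to the indicator of [`]t1, t2]]. *)
Lemma weak_increment T F J t1 t2 :
  mu.-integrable `]0, T[ (EFin \o F) -> mu.-integrable `]0, T[ (EFin \o J) ->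
  0 < t1 -> t1 < t2 -> t2 < T ->
  {for t1, continuous F} -> {for t2, continuous F} ->
  (forall f, smooth f -> (forall t, t <= t1 -> f t = 0) ->
    (exists2 T', T' < T & forall t, T' <= t -> f t = 0) ->
    \int[mu]_(t in `]0, T[) (F t * derive1 f t) + \int[mu]_(t in `]0, T[) (J t * f t) = 0) ->
  F t2 - F t1 = \int[mu]_(t in `]t1, t2]) J t.
Proof.
move=> iF iJ t10 t12 t2T c1 c2 H.
pose h (n : nat) : R := (T - t2) / 2 * n.+1%:R^-1.
have c0 : 0 < (T - t2) / 2 by rewrite divr_gt0// subr_gt0.
have h0 n : 0 < h n by rewrite mulr_gt0// invr_gt0.
have hT n : h n < T - t2.
  apply: (@le_lt_trans _ _ ((T - t2) / 2)); last by lra.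
  by rewrite ler_piMr ?(ltW c0)// invf_le1// ler1n.
have hlim e : 0 < e -> \forall n \near \oo, h n < e.
  move=> e0; near=> n; rewrite /h -ltr_pdivlMl// mulrC.
  near: n; apply: near_infty_natSinv_lt (PosNum _); exact: divr_gt0.
pose f n (t : R) := kd 0 (h n) t1 t - kd 0 (h n) t2 t.
have sf n : smooth (f n) by apply: smoothB; exact: smooth_kd.
have df n : derive1 (f n) = fun z => kd 1 (h n) t1 z - kd 1 (h n) t2 z.
  apply/funext => z; rewrite derive1E deriveB.
  - by rewrite -!derive1E !derive1_kd.
  - by apply: smooth_derivable; exact: smooth_kd.
  - by apply: smooth_derivable; exact: smooth_kd.
pose A n := \int[mu]_(t in `]0, T[) (F t * kd 1 (h n) t1 t).
pose B n := \int[mu]_(t in `]0, T[) (F t * kd 1 (h n) t2 t).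
pose C n := \int[mu]_(t in `]0, T[) (J t * f n t).
have ABC n : C n = B n - A n.
  have := H (f n) (sf n).
  rewrite (_ : \int[mu]_(t in `]0, T[) (F t * derive1 (f n) t) = A n - B n); last first.
    rewrite /A /B -RintegralB//; [|exact: itv_mul_kd|exact: itv_mul_kd].
    by apply: eq_Rintegral => t _; rewrite df mulrBr.
  move=> H'; suff : A n - B n + C n = 0 by lra.
  apply: H'.
    by move=> t tt; rewrite /f !kd0_lo ?subrr//; have := h0 n; lra.
  exists (t2 + h n); first by have := hT n; lra.
  by move=> t tt; rewrite /f !kd0_hi ?subrr//; have := h0 n; lra.
have kcvg t : 0 < t < T -> {for t, continuous F} ->
    (fun n => \int[mu]_(y in `]0, T[) (F y * kd 1 (h n) t y)) @ \oo --> F t.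
  move=> tT ct; apply/cvgrPdist_le => e e0.
  have [d d0 hd] := continuous_kd iF tT ct e0.
  near=> n; rewrite distrC; apply: hd; rewrite h0/=.
  by near: n; exact: hlim.
have Acvg : A @ \oo --> F t1 by apply: kcvg => //; rewrite t10 (lt_trans t12).
have Bcvg : B @ \oo --> F t2 by apply: kcvg => //; rewrite t2T (lt_trans t10).
have mI : measurable (`]0, T[%classic : set R) by [].
have mJ : measurable_fun `]0, T[ J.
  by apply/measurable_EFinP; exact: (measurable_int mu).
have f1 n t : `|f n t| <= 1.
  have := kd0_ge0 (h n) t1 t; have := kd0_le1 (h n) t1 t.
  have := kd0_ge0 (h n) t2 t; have := kd0_le1 (h n) t2 t => *.
  by rewrite /f ler_norml; apply/andP; split; lra.
have [] := @dominated_convergence _ _ _ mu `]0, T[ mI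
  (fun n t => (J t * f n t)%:E) (fun t => (J t * \1_`]t1, t2] t)%:E)
  (fun t => `|J t|%:E).
- move=> n; apply/measurable_EFinP; apply: measurable_funM => //.
  by apply: smooth_measurable.
- apply/measurable_EFinP; apply: measurable_funM => //.
- apply: aeW => t _; apply/cvg_EFin; first by near=> n.
  apply: cvg_near_cst => /=; rewrite indicE.
  case: (boolP (t \in _)) => tt.
    move: tt; rewrite inE/= in_itv/= => /andP[tt1 tt2].
    near=> n; rewrite /f kd0_hi ?kd0_lo//.
    - by rewrite subr0.
    - by have := h0 n; lra.
    - have : h n < t - t1 by near: n; apply: hlim; rewrite subr_gt0.
      by have := h0 n; lra.
  move: tt; rewrite notin_setE/= in_itv/= => /negP; rewrite negb_and -!leNgt -!ltNge => /orP[tt|tt].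
    by near=> n; rewrite /f !kd0_lo ?subrr//; have := h0 n; lra.
  near=> n.
  have : h n < t - t2 by near: n; apply: hlim; rewrite subr_gt0.
  by move=> ?; rewrite /f !kd0_hi ?subrr//; have := h0 n; lra.
- exact: integrable_norm.
- apply: aeW => t n _; rewrite /= lee_fin normrM ler_piMr//; exact: f1.
move=> i1 _ Ccvg.
have {}Ccvg : C @ \oo --> \int[mu]_(t in `]t1, t2]) J t.
  have -> : \int[mu]_(t in `]t1, t2]) J t = \int[mu]_(t in `]0, T[) (J t * \1_`]t1, t2] t).
    have S : (`]t1, t2]%classic : set R) `<=` (`]0, T[%classic : set R).
      by move=> t /=; rewrite !in_itv/= => /andP[? ?]; apply/andP; split; lra.
    rewrite -[in LHS](setIidr S) Rintegral_mkcondr; apply: eq_Rintegral => t _.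
    by rewrite patchE indicE; case: ifP; rewrite ?mulr1 ?mulr0.
  have fin1 : (\int[mu]_(t in `]0%R, T[) (J t * \1_`]t1, t2] t)%:E)%E \is a fin_num.
    exact: integrable_fin_num.
  move: Ccvg; rewrite -(fineK fin1) => /fine_cvgP[_]; exact.
have CE : C = B \- A by apply/funext.
have CBA : C @ \oo --> F t2 - F t1 by rewrite CE; exact: cvgB.
exact: (cvg_unique _ CBA Ccvg).
Unshelve. all: by end_near. Qed.

End TimeIncrement.

(** * The momentum flux against a kernel at a fixed time *)

Section FixedTime.
Context {R : realType}.
Local Notation mu := (@lebesgue_measure R).
Implicit Types (f g v r : R -> R) (a b c x y z h L : R) (bc : boundary) (k : nat).

(** The set outside which [ker k.+1 h a] vanishes. *)
Definition ksupp h a : set R := [set y |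
  a + h / 4 <= y <= a + 3 * h / 4 \/ a - 1 + h / 4 <= y <= a - 1 + 3 * h / 4].

Lemma centers01 bc h a : 0 < h -> centers bc h a -> 0 <= a <= 1.
Proof. by case: bc => /=; rewrite in_itv/= => h0 /andP[a0 a1]; apply/andP; split; lra. Qed.

Lemma ker_out k h a y : 0 < h -> ~ ksupp h a y -> ker k.+1 h a y = 0.
Proof.
move=> h0 /not_orP[/negP n1 /negP n2]; rewrite /ker !kd_out ?addr0//.
  by move: n2; rewrite negb_and -!ltNge => /orP.
by move: n1; rewrite negb_and -!ltNge => /orP.
Qed.

Lemma ksupp_Dirichlet h a y : 0 < h -> centers Dirichlet h a -> Omega y ->
  ksupp h a y -> a + h / 4 <= y <= a + 3 * h / 4.
Proof.
rewrite /Omega/= !in_itv/= => h0 /andP[a0 a1] /andP[y0 y1] [//|/andP[? ?]].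
by exfalso; lra.
Qed.

Lemma ker1_ge0 h a y : 0 < h -> 0 <= ker 1 h a y.
Proof. by move=> h0; rewrite addr_ge0// kd1_ge0. Qed.

Lemma integrable_ker k h a : mu.-integrable Omega (EFin \o ker k h a).
Proof. by apply: smooth_integrable_Omega; exact: smooth_ker. Qed.

Lemma ker_measurable k h a : measurable_fun Omega (ker k h a).
Proof. by apply: smooth_measurable; [exact: measurable_Omega|exact: smooth_ker]. Qed.

Lemma integral_ker1 h a : 0 < h -> h <= 1 -> 0 <= a <= 1 ->
  \int[mu]_(y in Omega) ker 1 h a y = 1.
Proof.
move=> h0 h1 /andP[a0 a1]; rewrite -derive1_ker /Omega smooth_FTC//; last exact: smooth_ker.
have sh : kd 0 h (a - 1) 0 = kd 0 h a 1 by rewrite kd_shift; congr kd; ring.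
transitivity ((kd 0 h a 1 + 1) - (0 + kd 0 h a 1)); last by ring.
congr ((_ + _) - (_ + _)); [by apply: kd0_hi; lra|by apply: kd0_lo; lra|exact: sh].
Qed.

Lemma integral_ker2 h a : 0 < h -> h <= 1 -> 0 <= a <= 1 ->
  \int[mu]_(y in Omega) ker 2 h a y = 0.
Proof.
move=> h0 h1 /andP[a0 a1]; rewrite -derive1_ker /Omega smooth_FTC//; last exact: smooth_ker.
have o1 : kd 1 h (a - 1) 1 = 0 by apply: (@kd_out _ 0 h _ _ h0); right; lra.
have o2 : kd 1 h a 0 = 0 by apply: (@kd_out _ 0 h _ _ h0); left; lra.
have sh : kd 1 h (a - 1) 0 = kd 1 h a 1 by rewrite kd_shift; congr kd; ring.
by rewrite /ker o1 o2 sh addr0 add0r subrr.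
Qed.

Lemma ker_bounded k : exists2 B : R, 0 < B &
  forall h a y, 0 < h -> `|ker k h a y| <= B / h ^+ k.
Proof.
have [B B0 hB] := @kd_bounded R k; exists (2 * B); first by rewrite mulr_gt0.
move=> h a y h0; rewrite /ker (le_trans (ler_normD _ _))//.
rewrite (le_trans (lerD (hB h a y h0) (hB h (a - 1) y h0)))//.
by rewrite -mulrDl ler_wpM2r ?invr_ge0 ?exprn_ge0 ?(ltW h0)//; lra.
Qed.

Lemma integral_norm_ker2 : exists2 B : R, 0 < B & forall h a, 0 < h ->
  \int[mu]_(y in Omega) `|ker 2 h a y| <= B / h.
Proof.
have [B B0 hB] := @kd_bounded R 2; exists (2 * B); first by rewrite mulr_gt0.
move=> h a h0.
have P b : \int[mu]_(y in Omega) `|kd 2 h b y| <= B / h.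
  apply: (le_trans (ler_norm _)).
  have c0 : 0 <= B / h ^+ 2 by rewrite divr_ge0 ?exprn_ge0// ltW.
  have bh : b <= b + h by lra.
  rewrite (_ : B / h = B / h ^+ 2 * (b + h - b)); last first.
    have h0' : h != 0 by rewrite gt_eqF.
    by field.
  apply: (integral_supported_le measurable_Omega _ c0 bh _ _).2.
  - by apply: measurableT_comp => //; apply: kd_measurable; exact: measurable_Omega.
  - by move=> y _; rewrite normr_id hB.
  - by move=> y _ H; rewrite kd_out ?normr0//; case: H => H; [left|right]; lra.
have in2 b : mu.-integrable Omega (EFin \o (fun y => `|kd 2 h b y|)).
  by apply: integrable_Omega_norm; exact: integrable_kd.
apply: (@le_trans _ _ (\int[mu]_(y in Omega) (`|kd 2 h a y| + `|kd 2 h (a - 1) y|))).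
  apply: Omega_ae_le_int.
  - by apply: integrable_Omega_norm; exact: integrable_ker.
  - exact: integrable_OmegaD.
  - by apply: aeW => y _; exact: ler_normD.
rewrite (OmegaD (in2 a) (in2 (a - 1))) (le_trans (lerD (P a) (P (a - 1))))//.
by rewrite -mulrDl ler_wpM2r ?invr_ge0 ?(ltW h0)//; lra.
Qed.

Section Flux.
Variables (bc : boundary) (v g : R -> R) (L h a : R).
Hypothesis iv : mu.-integrable Omega (EFin \o v).
Hypothesis wd : weak_deriv bc v g.
Hypothesis gL : {ae mu, forall x, Omega x -> `|g x| <= L}.
Hypothesis L0 : 0 <= L.
Hypothesis h0 : 0 < h.
Hypothesis h1 : h <= 1.
Hypothesis ca : centers bc h a.

(** Two points of the support are at distance at most [h], on the circle possibly
    across the endpoint of the cell. *)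
Lemma Lipschitz_ksupp y z : lebesgue_pt (v \_ Omega) y -> lebesgue_pt (v \_ Omega) z ->
  Omega y -> Omega z -> ksupp h a y -> ksupp h a z -> `|v y - v z| <= h * L.
Proof.
move=> ly lz Oy Oz Sy Sz.
have [H1 H2] := weak_deriv_Lipschitz iv wd gL L0 ly lz Oy Oz.
have [yz|yz] := leP `|y - z| h.
  by rewrite (le_trans H1)// mulrC ler_wpM2r.
case: bc ca H2 => [ca'|_ H2].
  have /andP[? ?] := ksupp_Dirichlet h0 ca' Oy Sy.
  have /andP[? ?] := ksupp_Dirichlet h0 ca' Oz Sz.
  by move: yz; rewrite ltNge ler_norml => /negP[]; apply/andP; split; lra.
rewrite (le_trans (H2 erefl))// mulrC ler_wpM2r// lerBlDr -lerBlDl.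
move: yz; rewrite ltr_normr ler_normr => /orP[yz|yz]; apply/orP; [left|right];
  by case: Sy => /andP[? ?]; case: Sz => /andP[? ?]; lra.
Qed.

Definition kavg := \int[mu]_(y in Omega) (v y * ker 1 h a y).

Lemma integrable_mul_ker f k : mu.-integrable Omega (EFin \o f) ->
  mu.-integrable Omega (EFin \o (fun y => f y * ker k h a y)).
Proof.
move=> fi; have [B _ hB] := @ker_bounded k.
apply: (Omega_mul_bounded fi _ _).1; first exact: ker_measurable.
by move=> y _; exact: hB.
Qed.

(** [kavg] is an average of the values of [v] on the support of the kernel. *)
Lemma near_kavg_on (N : set R) :
  (forall y z, lebesgue_pt (v \_ Omega) y -> lebesgue_pt (v \_ Omega) z ->
    Omega y -> Omega z -> N y -> ksupp h a z -> `|v y - v z| <= h * L) ->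
  {ae mu, forall y, Omega y -> N y -> `|v y - kavg| <= h * L}.
Proof.
move=> osc.
have lp : {ae mu, forall x, lebesgue_pt (v \_ Omega) x}.
  apply: lebesgue_differentiation; apply: integrable_locally_restrict => //.
  exact: measurable_Omega.
have a01 := centers01 h0 ca.
have k1 := integral_ker1 h0 h1 a01.
have hL0 : 0 <= h * L by rewrite mulr_ge0// ltW.
apply: ae_imp (lp) => y ly Oy Ny.
have -> : v y - kavg = \int[mu]_(z in Omega) ((v y - v z) * ker 1 h a z).
  rewrite /kavg -{1}(mulr1 (v y)) -k1 -OmegaZl; last exact: integrable_ker.
  rewrite -OmegaB; [|by apply: integrable_OmegaZl; exact: integrable_ker|exact: integrable_mul_ker].
  by apply: eq_Rintegral => z _; rewrite mulrBl.
rewrite -[leRHS]mulr1 -k1 -OmegaZl; last exact: integrable_ker.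
apply: (Omega_ae_le _ _ _).2.
- apply: measurable_funM; last exact: ker_measurable.
  by apply: measurable_funB => //; exact: Omega_measurable.
- by apply: integrable_OmegaZl; exact: integrable_ker.
apply: ae_imp lp => z lz Oz.
rewrite normrM (ger0_norm (ker1_ge0 _ _ h0)).
have [Sz|Sz] := pselect (ksupp h a z); last by rewrite ker_out// !mulr0.
by rewrite ler_wpM2r ?ker1_ge0// osc.
Qed.

Lemma near_kavg : {ae mu, forall y, Omega y -> ksupp h a y -> `|v y - kavg| <= h * L}.
Proof. exact: near_kavg_on Lipschitz_ksupp. Qed.

(** Integration by parts moves the derivative from the kernel to [v], and the
    kernel has mass 1. *)
Lemma weak_ker2_le : `|\int[mu]_(y in Omega) (v y * ker 2 h a y)| <= L.
Proof.
have a01 := centers01 h0 ca.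
have [phi tphi ephi] := ker_test1 h0 h1 ca.
have [_ /L1loc_measurable mg wd'] := wd.
rewrite (_ : Rintegral _ _ _ = \int[mu]_(y in Omega) (v y * derive1 phi y)); last first.
  by apply: eq_Rintegral => y /set_mem /ephi[_ ->].
rewrite wd'// normrN.
rewrite (_ : Rintegral _ _ _ = \int[mu]_(y in Omega) (g y * ker 1 h a y)); last first.
  by apply: eq_Rintegral => y /set_mem /ephi[-> _].
have H := @Omega_weak_le _ g (ker 1 h a) L mg (@smooth_ker _ 1 h a) gL L0.
apply: (le_trans H).
rewrite OmegaZl; last by apply: integrable_Omega_norm; exact: integrable_ker.
rewrite (_ : Rintegral _ _ _ = 1) ?mulr1// -(integral_ker1 h0 h1 a01).
by apply: eq_Rintegral => y _; rewrite ger0_norm// ker1_ge0.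
Qed.

Variables (r : R -> R) (q w B M : R).
Hypothesis mr : measurable_fun Omega r.
Hypothesis rM : forall y, Omega y -> `|r y| <= M.
Hypothesis w0 : 0 <= w.
Hypothesis q0 : 0 <= q.
Hypothesis rq : forall y, Omega y -> ksupp h a y -> `|r y - q| <= w.
Hypothesis hB : \int[mu]_(y in Omega) `|ker 2 h a y| <= B / h.

Let ik := integrable_ker 2 h a.
Let ikn := integrable_Omega_norm ik.

(** The derivative of the kernel has integral 0, so a constant may be subtracted
    from [r]. *)
Lemma weight_ker2_le : `|\int[mu]_(y in Omega) (r y * ker 2 h a y)| <= w * (B / h).
Proof.
have a01 := centers01 h0 ca.
have ir : mu.-integrable Omega (EFin \o r) by exact: bounded_integrable_Omega rM.
rewrite (_ : Rintegral _ _ _ = \int[mu]_(y in Omega) ((r y - q) * ker 2 h a y)); last first.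
  rewrite -[LHS]subr0 -(mulr0 q) -(integral_ker2 h0 h1 a01) -OmegaZl//.
  rewrite -OmegaB; [|exact: integrable_mul_ker|exact: integrable_OmegaZl].
  by apply: eq_Rintegral => y _; rewrite mulrBl.
apply: (@le_trans _ _ (\int[mu]_(y in Omega) (w * `|ker 2 h a y|))).
  apply: (Omega_ae_le _ _ _).2.
  - by apply: measurable_funM; [exact: measurable_funB|exact: ker_measurable].
  - exact: integrable_OmegaZl.
  - apply: aeW => y Oy; rewrite normrM.
    have [Sy|Sy] := pselect (ksupp h a y); last by rewrite ker_out// normr0 !mulr0.
    by rewrite ler_wpM2r// rq.
by rewrite OmegaZl// ler_wpM2l.
Qed.

(** Write [r v = kavg r + q (v - kavg) + (r - q) (v - kavg)], with [kavg] the average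
    of [v].  Against the derivative of the kernel, the middle term is at most [q L]
    by integration by parts, and the last one [w * h L * (B / h)]: the factor [h]
    gained by the Lipschitz bound is lost to the kernel, but the oscillation [w] of
    [r] stays small. *)
Lemma flux_split :
  `|\int[mu]_(y in Omega) (r y * v y * ker 2 h a y)
    - kavg * \int[mu]_(y in Omega) (r y * ker 2 h a y)| <= (q + B * w) * L.
Proof.
have a01 := centers01 h0 ca.
have ir : mu.-integrable Omega (EFin \o r) by exact: bounded_integrable_Omega rM.
have irv : mu.-integrable Omega (EFin \o (fun y => r y * v y)).
  have := (Omega_mul_bounded iv mr rM).1.
  by apply: eq_integrable; [exact: measurable_Omega|move=> y _ /=; rewrite mulrC].
have irq : mu.-integrable Omega (EFin \o (fun y => (r y - q) * (v y - kavg))).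
  have rqM y : Omega y -> `|r y - q| <= M + q.
    by move=> Oy; rewrite (le_trans (ler_normB _ _))// (ger0_norm q0) lerD2r rM.
  have ivk := integrable_OmegaB iv (integrable_Omega_cst kavg).
  have mrq : measurable_fun Omega (fun y => r y - q) by exact: measurable_funB.
  have := (Omega_mul_bounded ivk mrq rqM).1.
  by apply: eq_integrable; [exact: measurable_Omega|move=> y _ /=; rewrite mulrC].
pose A := \int[mu]_(y in Omega) ((r y - q) * (v y - kavg) * ker 2 h a y).
pose V := \int[mu]_(y in Omega) (v y * ker 2 h a y).
have E : \int[mu]_(y in Omega) (r y * v y * ker 2 h a y)
    - kavg * \int[mu]_(y in Omega) (r y * ker 2 h a y) = A + q * V.
  have E2 : A = \int[mu]_(y in Omega) (r y * v y * ker 2 h a y)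
    - kavg * \int[mu]_(y in Omega) (r y * ker 2 h a y)
    - (q * V - q * kavg * \int[mu]_(y in Omega) ker 2 h a y).
    have Z1 := OmegaZl kavg (integrable_mul_ker 2 ir).
    have Z2 := OmegaZl q (integrable_mul_ker 2 iv).
    have Z3 := OmegaZl (q * kavg) ik.
    have i1 : mu.-integrable Omega (EFin \o (fun y => r y * v y * ker 2 h a y)).
      exact: (integrable_mul_ker 2 irv).
    have i2 : mu.-integrable Omega (EFin \o (fun y => kavg * (r y * ker 2 h a y))).
      by apply: integrable_OmegaZl; exact: integrable_mul_ker.
    have i3 : mu.-integrable Omega (EFin \o (fun y => q * (v y * ker 2 h a y))).
      by apply: integrable_OmegaZl; exact: integrable_mul_ker.
    have i4 : mu.-integrable Omega (EFin \o (fun y => q * kavg * ker 2 h a y)).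
      exact: integrable_OmegaZl.
    have H := etrans (OmegaB (integrable_OmegaB i1 i2) (integrable_OmegaB i3 i4))
      (f_equal2 (fun p s => p - s) (OmegaB i1 i2) (OmegaB i3 i4)).
    have H' := f_equal2 (fun p s => p - s) (f_equal (fun p => _ - p) Z1)
      (f_equal2 (fun p s => p - s) Z2 Z3).
    apply: (etrans _ (etrans H (H' _))).
    by apply: eq_Rintegral => y _; ring.
  rewrite integral_ker2// mulr0 subr0 in E2.
  by rewrite E2; ring.
rewrite E (le_trans (ler_normD _ _))// mulrDl addrC lerD//.
  by rewrite normrM (ger0_norm q0) ler_wpM2l// weak_ker2_le.
have whL0 : 0 <= w * (h * L) by rewrite !mulr_ge0// ltW.
apply: (@le_trans _ _ (\int[mu]_(y in Omega) (w * (h * L) * `|ker 2 h a y|))).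
  apply: (Omega_ae_le _ _ _).2.
  - by apply: measurable_funM; [exact: Omega_measurable|exact: ker_measurable].
  - exact: integrable_OmegaZl.
  - apply: ae_imp near_kavg => y H Oy; rewrite normrM.
    have [Sy|Sy] := pselect (ksupp h a y); last by rewrite ker_out// normr0 !mulr0.
    by rewrite ler_wpM2r// normrM ler_pM// ?rq// H.
rewrite OmegaZl// (le_trans (ler_wpM2l whL0 hB))//.
rewrite (_ : _ * (B / h) = B * w * L)//.
have h0' : h != 0 by rewrite gt_eqF.
by field.
Qed.

End Flux.
End FixedTime.

(** * Functions of space and time *)

Section Plane.
Context {R : realType}.
Local Notation mu := (@lebesgue_measure R).

Lemma uniformly_continuous_on (K : set (R * R)) (f : R * R -> R) (w : R) :
  compact K -> {within K, continuous f} -> 0 < w ->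
  exists2 d : R, 0 < d & forall p q, K p -> K q -> ball p d q -> `|f p - f q| < w.
Proof.
move=> /compact_near_coveringP/near_covering_withinP cK /subspace_continuousP cf w0.
have := cK _ (0:R)^'+ (fun d p => forall q, K q -> ball p d q -> `|f p - f q| < w) _.
case.
  move=> x Kx.
  have w20 : 0 < w / 2 by rewrite divr_gt0.
  have /cvgrPdist_lt /(_ _ w20) := cf x Kx.
  rewrite /= near_withinE => /nbhs_ballP[r /= r0 hr].
  have r20 : 0 < r / 2 by rewrite divr_gt0.
  exists (ball x (r / 2), [set d | 0 < d < r / 2]) => /=.
    split; first exact: nbhsx_ballx.
    near=> d; apply/andP; split; first by near: d; exact: nbhs_right_gt.
    by near: d; exact: nbhs_right_lt.
  move=> [p d] /= [xp /andP[d0 dr]] Kp q Kq pq.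
  have bp : ball x r p by apply: le_ball xp; rewrite ler_pdivrMr//; lra.
  have bq : ball x r q.
    have := ball_triangle xp (le_ball (ltW dr) pq); apply: le_ball; lra.
  have h1 := hr p bp Kp; have h2 := hr q bq Kq.
  have -> : f p - f q = (f x - f q) - (f x - f p) by ring.
  by rewrite (le_lt_trans (ler_normB _ _))//; lra.
move=> d /= d0 hd; exists (d / 2) => [|p q Kp Kq]; first by rewrite divr_gt0.
apply: (hd (d / 2)) => //=; last by rewrite divr_gt0.
by rewrite sub0r normrN gtr0_norm ?divr_gt0//; lra.
Unshelve. all: by end_near. Qed.

Lemma measurable_slice (D1 D2 : set R) (f : R * R -> R) t :
  measurable D1 -> measurable D2 -> D2 t ->
  measurable_fun (D1 `*` D2) f -> measurable_fun D1 (fun x => f (x, t)).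
Proof.
move=> m1 m2 Dt mf.
have mD : measurable (D1 `*` D2) by exact: measurableX.
have mF : measurable_fun setT (f \_ (D1 `*` D2)) by exact/(measurable_restrictT f mD).
have mF1 : measurable_fun D1 (fun x => (f \_ (D1 `*` D2)) (x, t)).
  by apply: measurable_funTS; exact: (measurableT_comp mF (pair2_measurable t)).
apply: eq_measurable_fun mF1 => x; rewrite inE => Dx.
by rewrite patchE mem_set.
Qed.

(** The real integral is the difference of the integrals of the two parts, each
    measurable in the parameter by the theorem of Tonelli. *)
Lemma measurable_space_integral (D1 D2 : set R) (f : R * R -> R) :
  measurable D1 -> measurable D2 -> measurable_fun (D1 `*` D2) f ->
  measurable_fun D2 (fun t => \int[mu]_(x in D1) f (x, t)).
Proof.
move=> m1 m2 mf.
have mD : measurable (D1 `*` D2) by exact: measurableX.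
pose F := f \_ (D1 `*` D2).
have mF : measurable_fun setT F by exact/(measurable_restrictT f mD).
have mEF : measurable_fun setT (EFin \o F) by exact/measurable_EFinP.
pose G t := (\int[mu]_x ((EFin \o F)^\+%E (x, t)) - \int[mu]_x ((EFin \o F)^\-%E (x, t)))%E.
have mG : measurable_fun setT G.
  apply: emeasurable_funB.
    exact: (@measurable_fun_fubini_tonelli_G _ _ _ _ R mu _ (measurable_funepos mEF)).
  exact: (@measurable_fun_fubini_tonelli_G _ _ _ _ R mu _ (measurable_funeneg mEF)).
have mfG : measurable_fun D2 (fun t => fine (G t)).
  by apply: measurable_funTS; exact: (measurableT_comp _ mG).
apply: eq_measurable_fun mfG => t; rewrite inE => Dt.
rewrite /Rintegral; congr fine.
rewrite /G integral_mkcond [RHS]integralE.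
have E x : ((fun x => (f (x, t))%:E) \_ D1) x = (EFin \o F) (x, t).
  rewrite /F /= !patchE; case: (boolP (x \in D1)) => xD.
    by rewrite mem_set//; split => //; exact: set_mem.
  by rewrite memNset// => -[/= D1x _]; move: xD; rewrite mem_set.
by congr (_ - _)%E; apply: eq_integral => x _; rewrite ?funeposE ?funenegE E.
Qed.

End Plane.

(** * Solutions away from vacuum *)

Section Slab.
Context {R : realType}.
Local Notation mu := (@lebesgue_measure R).
Implicit Types (bc : boundary) (rho u : R -> R -> R) (s e t x y a h w : R) (g : R -> R).

(** On the circle two periods are kept, so that a support that crosses the endpoint
    of the unit cell is seen as a short interval. *)
Definition cell bc : set R :=
  match bc with Dirichlet => `[0, 1] | Periodic => `[0, 2] end.

(** What the argument uses of a solution on a time interval [[s, e]] that does not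
    meet vacuum.  The mass equation appears as an identity for the increments of
    the moments of [rho], tested up to the walls. *)
Record slab bc rho u s e : Prop := Slab {
  slab_lt : s < e;
  slab_cont : {within cell bc `*` `[s, e], continuous (fun z : R * R => rho z.1 z.2)};
  slab_pos : forall x t, cell bc x -> s <= t <= e -> 0 < rho x t;
  slab_per : bc = Periodic -> forall x t, rho (x + 1) t = rho x t;
  slab_meas : measurable_fun (Omega `*` `]s, e]) (fun z : R * R => rho z.1 z.2);
  slab_umeas : measurable_fun (Omega `*` `]s, e]) (fun z : R * R => u z.1 z.2);
  slab_L1 : exists2 K : R, 0 <= K & {ae mu, forall t, s < t <= e ->
    mu.-integrable Omega (EFin \o u^~ t) /\ \int[mu]_(x in Omega) `|u x t| <= K};
  slab_weak : forall g, mass_test bc g -> forall t1 t2, s <= t1 -> t1 < t2 -> t2 <= e ->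
    \int[mu]_(x in Omega) (rho x t2 * g x) - \int[mu]_(x in Omega) (rho x t1 * g x)
    = \int[mu]_(t in `]t1, t2]) \int[mu]_(x in Omega) (rho x t * u x t * derive1 g x)
}.

Lemma cell_Omega bc x : Omega x -> cell bc x.
Proof. by rewrite /Omega/= in_itv/=; case: bc; rewrite /= in_itv/= => /andP[? ?]; apply/andP; split; lra. Qed.

Lemma cell01 bc x : 0 <= x <= 1 -> cell bc x.
Proof. by case: bc; rewrite /= in_itv/= => /andP[? ?]; apply/andP; split; lra. Qed.

Lemma cell_bounds bc rho a b : a <= b ->
  {within cell bc `*` `[a, b], continuous (fun z : R * R => rho z.1 z.2)} ->
  exists p q, [/\ cell bc p.1, a <= p.2 <= b, cell bc q.1, a <= q.2 <= b &
    forall x t, cell bc x -> a <= t <= b -> rho p.1 p.2 <= rho x t <= rho q.1 q.2].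
Proof.
move=> ab cont.
pose K := cell bc `*` `[a, b]%classic.
have cK : compact K.
  by apply: compact_setX; [case: bc @K {cont}; exact: segment_compact|exact: segment_compact].
have KP x t : cell bc x -> a <= t <= b -> K (x, t).
  by move=> cx st; split => //=; rewrite in_itv.
have K0 : K !=set0.
  exists (0, a); apply: KP; last by rewrite lexx.
  by apply: cell01; rewrite lexx ler01.
have [p /set_mem [/= p1 p2] hp] := compact_EVT_min K0 cK cont.
have [q /set_mem [/= q1 q2] hq] := compact_EVT_max K0 cK cont.
exists p, q; split => //; try by move: p2 q2; rewrite !in_itv.
by move=> x t cx st; rewrite (hp (x, t)) ?(hq (x, t))//; apply/mem_set/KP.
Qed.

Section Consequences.
Variables (bc : boundary) (rho u : R -> R -> R) (s e : R).
Hypothesis S : slab bc rho u s e.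

Let mO : measurable (@Omega R) := measurable_Omega.
Let se : s < e := slab_lt S.

Let K := cell bc `*` `[s, e]%classic.

Let cK : compact K.
Proof. by apply: compact_setX; [case: bc; exact: segment_compact|exact: segment_compact]. Qed.

Let KP x t : cell bc x -> s <= t <= e -> K (x, t).
Proof. by move=> cx st; split => //=; rewrite in_itv. Qed.

Lemma slab_bounds : exists m M : R, [/\ 0 < m, 0 < M &
  forall x t, cell bc x -> s <= t <= e -> m <= rho x t <= M].
Proof.
have [p [q [p1 p2 q1 q2 H]]] := cell_bounds (ltW se) (slab_cont S).
by exists (rho p.1 p.2), (rho q.1 q.2); split => //; exact: (slab_pos S).
Qed.

Lemma slab_uniform w : 0 < w -> exists2 d : R, 0 < d &
  forall x y t t', cell bc x -> cell bc y -> s <= t <= e -> s <= t' <= e ->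
    `|x - y| < d -> `|t - t'| < d -> `|rho x t - rho y t'| < w.
Proof.
move=> w0; have [d d0 hd] := uniformly_continuous_on cK (slab_cont S) w0.
exists d => // x y t t' cx cy st st' xy tt.
apply: (hd (x, t) (y, t')); [exact: KP|exact: KP|].
by split; rewrite /= /ball/=.
Qed.

Lemma slab_slice_measurable t : s <= t <= e -> measurable_fun Omega (rho^~ t).
Proof.
move=> st; suff H : measurable_fun (`[0, 1]%classic : set R) (rho^~ t).
  by apply: measurable_funS H => //; exact: subset_itv_oo_cc.
apply: subspace_continuous_measurable_fun => //.
apply/subspace_continuousP => x; rewrite /= in_itv/= => x01.
apply/cvgrPdist_lt => w w0; have [d d0 hd] := slab_uniform w0.
rewrite near_withinE; near=> y => /=; rewrite in_itv/= => y01.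
apply: hd; [exact: cell01|exact: cell01|exact: st|exact: st| |by rewrite subrr normr0].
near: y; exact: nbhsx_ballx.
Unshelve. all: by end_near. Qed.

(** Uniform continuity in space, read on the support of a kernel.  When the support
    wraps around the circle, [y] is replaced by [y + 1]. *)
Lemma slab_osc w : 0 < w -> exists2 d : R, 0 < d & forall h a y t,
  0 < h -> h < d -> h <= 1 -> centers bc h a -> Omega y -> ksupp h a y -> s <= t <= e ->
  `|rho y t - rho a t| <= w.
Proof.
move=> w0; have [d d0 hd] := slab_uniform w0; exists d => // h a y t h0 hd' h1 ca Oy Sy st.
have /andP[a0 a1] := centers01 h0 ca.
have tt : `|t - t| < d by rewrite subrr normr0.
have cy := cell_Omega bc Oy.
have caa : cell bc a by apply: cell01; rewrite a0.
case: Sy => /andP[y1 y2].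
  apply/ltW/hd => //.
  by rewrite ltr_norml; apply/andP; split; lra.
case bcE : bc; move: (bcE).
  move=> bcD; exfalso; move: ca; rewrite bcE /= in_itv/= => /andP[_ ca].
  by move: Oy; rewrite /Omega/= in_itv/= => /andP[? ?]; lra.
move=> bcP; rewrite -(slab_per S bcP y t); apply/ltW/hd => //.
  move: Oy; rewrite bcP /Omega/= !in_itv/= => /andP[? ?]; apply/andP; split; lra.
by rewrite ltr_norml; apply/andP; split; lra.
Qed.

Definition flux g t := \int[mu]_(x in Omega) (rho x t * u x t * derive1 g x).

Lemma flux_measurable g : smooth g -> measurable_fun `]s, e] (flux g).
Proof.
move=> sg.
have mD : measurable ((Omega : set R) `*` (`]s, e]%classic : set R)) by exact: measurableX.
apply: (@measurable_space_integral _ Omega `]s, e]%classic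
  (fun z => rho z.1 z.2 * u z.1 z.2 * derive1 g z.1)) => //.
apply: measurable_funM; first by apply: measurable_funM; [exact: slab_meas S|exact: slab_umeas S].
apply: measurable_funTS.
apply: (@measurableT_comp _ _ _ _ _ _ (derive1 g)) => //.
exact: (smooth_measurable _ (smooth_derive1 sg)).
Qed.

Lemma slab_ru_integrable t : s <= t <= e -> mu.-integrable Omega (EFin \o u^~ t) ->
  mu.-integrable Omega (EFin \o (fun x => rho x t * u x t)).
Proof.
move=> st iu; have [m [M [m0 M0 hM]]] := slab_bounds.
have rM x : Omega x -> `|rho x t| <= M.
  move=> Ox; have /andP[h1 h2] := hM _ _ (cell_Omega bc Ox) st.
  by rewrite ger0_norm// (le_trans (ltW m0)).
have := (Omega_mul_bounded iu (slab_slice_measurable st) rM).1.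
by apply: eq_integrable => // x _ /=; rewrite mulrC.
Qed.

Lemma flux_bounded g : smooth g -> exists2 C : R, 0 <= C &
  {ae mu, forall t, s < t <= e -> `|flux g t| <= C}.
Proof.
move=> sg; have [m [M [m0 M0 hM]]] := slab_bounds.
have [c c0 hc] := smooth_bounded (smooth_derive1 sg).
have [K0 K00 hK] := slab_L1 S.
exists (c * (M * K0)); first by rewrite !mulr_ge0// ltW.
apply: ae_imp hK => t H st; have [iu uK] := H st.
have st' : s <= t <= e by move: st => /andP[/ltW -> ->].
have iru := slab_ru_integrable st' iu.
have mg : measurable_fun Omega (derive1 g).
  exact: (smooth_measurable mO (smooth_derive1 sg)).
apply: (le_trans (Omega_mul_bounded iru mg hc).2).
rewrite ler_wpM2l ?(ltW c0)//.
apply: (@le_trans _ _ (\int[mu]_(x in Omega) (M * `|u x t|))).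
  apply: Omega_ae_le_int.
  - exact: integrable_Omega_norm.
  - by apply: integrable_OmegaZl; exact: integrable_Omega_norm.
  - apply: aeW => x Ox; rewrite normrM ler_wpM2r//.
    have /andP[h1 h2] := hM _ _ (cell_Omega bc Ox) st'.
    by rewrite ger0_norm// (le_trans (ltW m0)).
by rewrite OmegaZl ?ler_wpM2l ?(ltW M0)//; exact: integrable_Omega_norm.
Qed.

Lemma flux_integrable g t1 t2 : smooth g -> s <= t1 -> t1 < t2 -> t2 <= e ->
  mu.-integrable `]t1, t2] (EFin \o flux g).
Proof.
move=> sg st1 t12 t2e; have [C C0 hC] := flux_bounded sg.
have sub : (`]t1, t2]%classic : set R) `<=` (`]s, e]%classic : set R).
  by move=> t /=; rewrite !in_itv/= => /andP[? ?]; apply/andP; split; lra.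
apply: (@ae_le_integrable _ _ _ mu `]t1, t2] (flux g) (fun=> C) _ _ _ _).1 => //.
- by apply: measurable_funS (flux_measurable sg).
- have fin : (lebesgue_measure (`]t1, t2]%classic : set R) < +oo)%E.
    by rewrite lebesgue_measure_itv/=; case: ifP => // _; exact: ltry.
  by apply: measurable_bounded_integrable => //; exact: bounded_cst.
- by apply: ae_imp hC => t H /sub; rewrite /= in_itv/=; exact: H.
Qed.

End Consequences.
End Slab.

(** * Kernel averages of the density and their minimum *)

Section Averages.
Context {R : realType}.
Local Notation mu := (@lebesgue_measure R).
Implicit Types (bc : boundary) (rho u : R -> R -> R) (s e t x y a b c d h w : R) (g r : R -> R).

Lemma ker_Taylor : exists2 C : R, 0 < C & forall h a d y, 0 < h ->
  `|ker 1 h (a + d) y - ker 1 h a y + d * ker 2 h a y| <= C / h ^+ 3 * d ^+ 2.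
Proof.
have [C C0 hC] := @ker_bounded R 3; exists C => // h a d y h0.
have E : ker 1 h (a + d) y = ker 1 h a (y - d).
  by rewrite /ker -!kd_shift (_ : a + d - 1 = a - 1 + d) //; ring.
have B z : `|derive1n 2 (ker 1 h a) z| <= C / h ^+ 3.
  by rewrite derive1nS derive1n1 !derive1_ker; exact: hC.
have := smooth_Taylor y (y - d) (@smooth_ker R 1 h a) B.
by rewrite E derive1_ker (_ : y - d - y = - d) ?sqrrN ?mulNr ?opprK//; ring.
Qed.

(** A centre can be moved in both directions except at the two extreme centres
    next to the walls; on the circle, beyond the ends of [[0, 1]] it wraps. *)
Lemma ker_near_center bc h a : 0 < h -> h <= 1 -> centers bc h a ->
  (bc = Dirichlet -> a <> 0 /\ a <> 1 - h) ->
  exists2 d0, 0 < d0 & forall d, `|d| < d0 ->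
    exists2 b, centers bc h b & forall y, Omega y -> ker 1 h (a + d) y = ker 1 h b y.
Proof.
case: bc => h0 h1 /=; rewrite in_itv/= => /andP[a0 a1] aD.
  have [/eqP n0 /eqP n1] := aD erefl.
  have p0 : 0 < a by rewrite lt_neqAle eq_sym n0.
  have p1 : a < 1 - h by rewrite lt_neqAle n1.
  exists (Num.min a (1 - h - a)); first by rewrite lt_min p0 subr_gt0.
  move=> d; rewrite lt_min !ltr_norml => /andP[/andP[? ?] /andP[? ?]].
  by exists (a + d) => //; rewrite in_itv/=; apply/andP; split; lra.
exists (h / 4) => [|d]; first by rewrite divr_gt0.
rewrite ltr_norml => /andP[d0 d1].
have [ad0|ad0] := ltP (a + d) 0.
  exists (a + d + 1); first by rewrite in_itv/=; apply/andP; split; lra.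
  move=> y; rewrite /Omega/= in_itv/= => /andP[y0 y1].
  have E : a + d + 1 - 1 = a + d by ring.
  rewrite /ker E.
  transitivity (kd 1 h (a + d) y + 0).
    by congr (_ + _); apply: (@kd_out _ 0 h _ _ h0); right; lra.
  transitivity (0 + kd 1 h (a + d) y); first by rewrite addr0 add0r.
  by congr (_ + _); apply/esym; apply: (@kd_out _ 0 h _ _ h0); left; lra.
have [ad1|ad1] := ltP 1 (a + d).
  exists (a + d - 1); first by rewrite in_itv/=; apply/andP; split; lra.
  move=> y; rewrite /Omega/= in_itv/= => /andP[y0 y1].
  rewrite /ker.
  transitivity (0 + kd 1 h (a + d - 1) y).
    by congr (_ + _); apply: (@kd_out _ 0 h _ _ h0); left; lra.
  transitivity (kd 1 h (a + d - 1) y + 0); first by rewrite addr0 add0r.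
  by congr (_ + _); apply/esym; apply: (@kd_out _ 0 h _ _ h0); right; lra.
by exists (a + d) => //; rewrite in_itv/= ad0.
Qed.

Lemma kavg_le r h a c : mu.-integrable Omega (EFin \o r) -> 0 < h -> h <= 1 -> 0 <= a <= 1 ->
  (forall y, Omega y -> ksupp h a y -> r y <= c) -> kavg r h a <= c.
Proof.
move=> ir h0 h1 a01 rc.
rewrite -[leRHS]mulr1 -(integral_ker1 h0 h1 a01) -OmegaZl; last exact: integrable_ker.
apply: Omega_ae_le_int; first exact: integrable_mul_ker.
  by apply: integrable_OmegaZl; exact: integrable_ker.
apply: aeW => y Oy.
have [Sy|Sy] := pselect (ksupp h a y); last by rewrite (ker_out 0 h0 Sy) !mulr0.
by rewrite ler_wpM2r ?ker1_ge0// rc.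
Qed.

Lemma kavg_ge r h a c : mu.-integrable Omega (EFin \o r) -> 0 < h -> h <= 1 -> 0 <= a <= 1 ->
  (forall y, Omega y -> ksupp h a y -> c <= r y) -> c <= kavg r h a.
Proof.
move=> ir h0 h1 a01 rc.
rewrite -[leLHS]mulr1 -(integral_ker1 h0 h1 a01) -OmegaZl; last exact: integrable_ker.
apply: Omega_ae_le_int; last 1 first.
- apply: aeW => y Oy.
  have [Sy|Sy] := pselect (ksupp h a y); last by rewrite (ker_out 0 h0 Sy) !mulr0.
  by rewrite ler_wpM2r ?ker1_ge0// rc.
- by apply: integrable_OmegaZl; exact: integrable_ker.
- exact: integrable_mul_ker.
Qed.

(** Minus the derivative of [a |-> kavg r h a]. *)
Definition kslope r h a := \int[mu]_(y in Omega) (r y * ker 2 h a y).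

Lemma kavg_Taylor : exists2 C : R, 0 < C & forall r (M : R) h a d, 0 < h ->
  measurable_fun Omega r -> (forall y, Omega y -> `|r y| <= M) ->
  `|kavg r h (a + d) - kavg r h a + d * kslope r h a| <= M * (C / h ^+ 3 * d ^+ 2).
Proof.
have [C C0 hC] := ker_Taylor; exists C => // r M h a d h0 mr rM.
have ir : mu.-integrable Omega (EFin \o r) by exact: bounded_integrable_Omega rM.
have i1 := @integrable_mul_ker _ h (a + d) h0 r 1 ir.
have i2 := @integrable_mul_ker _ h a h0 r 1 ir.
have i3 := integrable_OmegaZl d (@integrable_mul_ker _ h a h0 r 2 ir).
rewrite /kavg /kslope -(OmegaZl d (@integrable_mul_ker _ h a h0 r 2 ir)).
rewrite -(OmegaB i1 i2) -(OmegaD (integrable_OmegaB i1 i2) i3).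
set c := M * _; rewrite -[leRHS](Omega_cst c).
have m k b : measurable_fun Omega (fun y => r y * ker k h b y).
  by apply: measurable_funM => //; exact: ker_measurable.
apply: (Omega_ae_le _ _ _).2.
- apply: measurable_funD; first exact: measurable_funB.
  by apply: measurable_funM => //.
- exact: integrable_Omega_cst.
apply: aeW => y Oy.
have gen (p k1 k2 k3 : R) : p * k1 - p * k2 + d * (p * k3) = p * (k1 - k2 + d * k3) by ring.
by rewrite gen normrM /c ler_pM// ?rM// hC.
Qed.

Lemma kavg_continuous r (M : R) h : 0 < h ->
  measurable_fun Omega r -> (forall y, Omega y -> `|r y| <= M) ->
  continuous (kavg r h).
Proof.
move=> h0 mr rM a.
have [C C0 hC] := kavg_Taylor.
have M0 : 0 <= M.
  by apply: le_trans (rM (2^-1) _) => //; rewrite /Omega/= in_itv/=; apply/andP; split; lra.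
set D := `|kslope r h a|; set c := M * (C / h ^+ 3).
have D0 : 0 <= D by exact: normr_ge0.
have c0 : 0 <= c by rewrite mulr_ge0// divr_ge0 ?exprn_ge0// ltW.
apply/cvgrPdist_le => w w0; near=> b.
pose d := b - a; have -> : b = a + d by rewrite /d; ring.
have d1 : `|d| <= 1.
  by rewrite /d distrC; near: b; apply: (@cvgr_dist_le _ _ _ _ (nbhs_filter a) id).
have d2 : `|d| <= w / (D + c + 1).
  rewrite /d distrC; near: b; apply: (@cvgr_dist_le _ _ _ _ (nbhs_filter a) id) => //.
  by rewrite divr_gt0//; lra.
have Dc : 0 < D + c + 1 by lra.
rewrite ler_pdivlMr// in d2.
have H := hC r M h a d h0 mr rM.
have gen (X Y Z : R) : X - Y = Z - (Y - X + Z) by ring.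
rewrite (gen _ _ (d * kslope r h a)) (le_trans (ler_normB _ _))// (le_trans (lerD (lexx _) H))// normrM -/D.
rewrite mulrA -/c (le_trans _ d2)// !mulrDr mulr1.
have dd : c * d ^+ 2 <= `|d| * c.
  rewrite mulrC ler_wpM2r// -[d ^+ 2]ger0_norm ?sqr_ge0// normrX expr2.
  by rewrite ler_piMr.
have d0 : 0 <= `|d| by [].
by rewrite -addrA lerD2l (le_trans dd)// lerDl.
Unshelve. all: by end_near. Qed.

(** At a minimizing centre that can be moved both ways the derivative vanishes; the
    quadratic remainder of the expansion makes this quantitative. *)
Lemma kslope_critical bc r (M : R) h a : 0 < h -> h <= 1 -> centers bc h a ->
  measurable_fun Omega r -> (forall y, Omega y -> `|r y| <= M) ->
  (forall b, centers bc h b -> kavg r h a <= kavg r h b) ->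
  (bc = Dirichlet -> a <> 0 /\ a <> 1 - h) ->
  kslope r h a = 0.
Proof.
move=> h0 h1 ca mr rM amin aD.
have [d0 d00 hd] := ker_near_center h0 h1 ca aD.
have [C C0 hC] := kavg_Taylor.
have M0 : 0 <= M.
  by apply: le_trans (rM (2^-1) _) => //; rewrite /Omega/= in_itv/=; apply/andP; split; lra.
set c := M * (C / h ^+ 3).
have c0 : 0 <= c by rewrite mulr_ge0// divr_ge0 ?exprn_ge0// ltW.
have key d : `|d| < d0 -> d * kslope r h a <= c * d ^+ 2.
  move=> /hd[b cb hb].
  have -> : c * d ^+ 2 = M * (C / h ^+ 3 * d ^+ 2) by rewrite /c [RHS]mulrA.
  have gen (X Y Z W : R) : Y <= X -> `|X - Y + Z| <= W -> Z <= W.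
    by move=> XY; rewrite ler_norml => /andP[_ H]; lra.
  apply: gen (hC r M h a d h0 mr rM).
  apply: (le_trans (amin b cb)).
  suff E : kavg r h b = kavg r h (a + d) by rewrite E.
  by apply: eq_Rintegral => y /set_mem Oy; rewrite hb.
set D := kslope r h a in key *.
apply/eqP/contraT => Dn0.
have nD : 0 < `|D| by rewrite normr_gt0.
pose d := Num.min (d0 / 2) (`|D| / (2 * (c + 1))).
have c1 : 0 < 2 * (c + 1) by lra.
have dpos : 0 < d by rewrite lt_min !divr_gt0.
have dd0 : d < d0 by rewrite gt_min; apply/orP; left; lra.
have dD : d * (2 * (c + 1)) <= `|D|.
  by rewrite -ler_pdivlMr// /d ge_min lexx orbT.
have : d * `|D| <= c * d ^+ 2.
  have [D0|D0] := leP 0 D.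
    by rewrite ger0_norm//; apply: key; rewrite gtr0_norm.
  rewrite ltr0_norm// mulrN -mulNr -(sqrrN d); apply: key.
  by rewrite normrN gtr0_norm.
rewrite expr2 mulrCA ler_pM2l// => H.
have : c * d < `|D|.
  apply: lt_le_trans dD; rewrite mulrC ltr_pM2l//; lra.
by rewrite ltNge H.
Qed.

End Averages.

(** * The least average over one time step *)

Section DxLinf.
Context {R : realType}.
Local Notation mu := (@lebesgue_measure R).
Implicit Types (bc : boundary) (c L : R) (g v : R -> R).

Lemma LpN_infty_ae g L : LpN Omega +oo g = L%:E ->
  {ae mu, forall x, Omega x -> `|g x| <= L}.
Proof.
have mT : (0 < mu [set: R])%E.
  apply: (@lt_le_trans _ _ (mu (@Omega R))).
    by rewrite /Omega lebesgue_measure_itv/= lte_fin ltr01 oppr0 adde0.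
  by apply: le_measure; rewrite ?inE//; exact: measurable_Omega.
rewrite /LpN unlock ifT//.
move=> H; have := @ess_sup_ge _ _ R mu (abse \o (EFin \o (g \_ Omega))).
rewrite H; apply: ae_imp => x /= + Ox; rewrite patchE mem_set// lee_fin.
Qed.

(** The form in which lower bounds on the norm are used: every weak derivative and
    every bound for it is a competitor. *)
Lemma dxLinfN_ge bc v c :
  (forall g L, weak_deriv bc v g -> 0 <= L ->
     {ae mu, forall x, Omega x -> `|g x| <= L} -> c <= L) ->
  (c%:E <= dxLinfN bc v)%E.
Proof.
move=> H; apply: le_ereal_inf_tmp => _ [g wg <-].
have N0 : (0 <= LpN Omega +oo g)%E by exact: Lnorm_ge0.
case E : (LpN Omega +oo g) N0 => [L| |]// L0; last by rewrite leey.
by rewrite lee_fin; apply: (H g) => //; exact: LpN_infty_ae.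
Qed.

Lemma dxLinfN_ge0 bc v : (0 <= dxLinfN bc v)%E.
Proof. exact: dxLinfN_ge. Qed.
End DxLinf.

Section TimeStep.
Context {R : realType}.

Let arith1 (q w e k : R) : q - w - e <= k -> q <= k + e + w.
Proof. lra. Qed.

Let arith2 (y r y1 w e : R) : `|y - r| <= w -> `|y - y1| <= e -> r - w - e <= y1.
Proof. by rewrite !ler_norml => /andP[H1 _] /andP[_ H2]; lra. Qed.

Let arith3 (J X Y E B A : R) : J - X <= Y -> X <= E + B -> Y + B <= A -> J <= E + A.
Proof. lra. Qed.

Let arith4 (q w e k b c : R) : q <= k + e + w ->
  q + b * w + c * b * w <= k + e + w + (1 + c) * b * w.
Proof. by rewrite !mulrDl mul1r; lra. Qed.

Local Notation mu := (@lebesgue_measure R).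
Variables (bc : boundary) (rho u : R -> R -> R) (s e h w B1 B2 C3 K0 : R).
Hypothesis S : slab bc rho u s e.
Hypothesis h0 : 0 < h.
Hypothesis h1 : h <= 1.
Hypothesis w0 : 0 < w.
Hypothesis osc : forall a y t, centers bc h a -> Omega y -> ksupp h a y -> s <= t <= e ->
  `|rho y t - rho a t| <= w.
Hypothesis B10 : 0 < B1.
Hypothesis B20 : 0 < B2.
Hypothesis C30 : 0 <= C3.
Hypothesis hB1 : forall a y, `|ker 1 h a y| <= B1 / h.
Hypothesis hB2 : forall a, \int[mu]_(y in Omega) `|ker 2 h a y| <= B2 / h.
Hypothesis K00 : 0 <= K0.
Hypothesis hK : {ae mu, forall t, s < t <= e ->
    mu.-integrable Omega (EFin \o u^~ t) /\ \int[mu]_(x in Omega) `|u x t| <= K0}.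
Hypothesis trace : bc = Dirichlet -> {ae mu, forall t, s < t <= e ->
  forall g L, weak_deriv bc (u^~ t) g -> 0 <= L ->
    {ae mu, forall x, Omega x -> `|g x| <= L} ->
  forall a, a = 0 \/ a = 1 - h -> `|kavg (u^~ t) h a| <= C3 * (h * L)}.

(** The mass equation, tested with the kernel itself. *)
Lemma kavg_increment a t1 t2 : centers bc h a -> s <= t1 -> t1 < t2 -> t2 <= e ->
  kavg (rho^~ t2) h a - kavg (rho^~ t1) h a =
  \int[mu]_(t in `]t1, t2]) kslope (fun x => rho x t * u x t) h a.
Proof.
move=> ca st1 t12 t2e; have [phi tphi ephi] := ker_test1 h0 h1 ca.
have := slab_weak S (test1_mass_test tphi) st1 t12 t2e.
have E t : \int[mu]_(x in Omega) (rho x t * phi x) = kavg (rho^~ t) h a.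
  by apply: eq_Rintegral => x /set_mem /ephi[-> _].
rewrite !E => ->; apply: eq_Rintegral => t _; apply: eq_Rintegral => x /set_mem /ephi[_ ->].
by [].
Qed.

Lemma kslope_flux_integrable a t1 t2 : centers bc h a -> s <= t1 -> t1 < t2 -> t2 <= e ->
  mu.-integrable `]t1, t2] (EFin \o (fun t => kslope (fun x => rho x t * u x t) h a)).
Proof.
move=> ca st1 t12 t2e; have [phi tphi ephi] := ker_test1 h0 h1 ca.
have [sphi _] := test1_mass_test tphi.
have := flux_integrable S sphi st1 t12 t2e.
congr (_.-integrable _ (EFin \o _)); apply/funext => t.
by apply: eq_Rintegral => x /set_mem /ephi[_ ->].
Qed.

Variables (t1 t2 eps a : R).
Hypothesis st1 : s <= t1.
Hypothesis t12 : t1 < t2.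
Hypothesis t2e : t2 <= e.
Hypothesis eps0 : 0 <= eps.
Hypothesis heps : forall y t, Omega y -> t1 <= t <= t2 -> `|rho y t - rho y t1| <= eps.
Hypothesis ca : centers bc h a.
Hypothesis amin : forall b, centers bc h b -> kavg (rho^~ t1) h a <= kavg (rho^~ t1) h b.

(** The coefficient of the norm of [u_x]: the least average at time [t1], the
    variation [eps] of [rho] in time, its oscillation [w] on a support, and the
    error terms proportional to [w]. *)
Let alpha := kavg (rho^~ t1) h a + eps + w + (1 + C3) * B2 * w.
Let KK := K0 * (B1 / h) * (B2 / h).

(** The flux through the minimizing kernel splits into [kavg u * kslope rho] and a
    term bounded by the density times the norm of [u_x].  In the first one,
    [kslope] is 0 at time [t1] by criticality and hence small until [t2]; at a
    centre next to a wall criticality fails, but there [kavg u] itself is of order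
    [h] times the norm of [u_x]. *)
Lemma flux_le : {ae mu, forall t, t1 < t <= t2 ->
  forall g L, weak_deriv bc (u^~ t) g -> 0 <= L ->
    {ae mu, forall x, Omega x -> `|g x| <= L} ->
  kslope (fun x => rho x t * u x t) h a <= eps * KK + alpha * L}.
Proof.
have [m [M [m0 M0 hM]]] := slab_bounds S.
have a01 := centers01 h0 ca.
have tr : {ae mu, forall t, s < t <= e -> bc = Dirichlet ->
  forall g L, weak_deriv bc (u^~ t) g -> 0 <= L ->
    {ae mu, forall x, Omega x -> `|g x| <= L} ->
  forall a, a = 0 \/ a = 1 - h -> `|kavg (u^~ t) h a| <= C3 * (h * L)}.
  have [D|nD] := pselect (bc = Dirichlet); last by apply: aeW.
  by apply: ae_imp (trace D) => t H st _; exact: H.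
apply: ae_imp (ae_and hK tr) => t [HK HT] /andP[t1t tt2] g L wg L0 gL.
have st : s < t <= e by rewrite (le_lt_trans st1 t1t) (le_trans tt2 t2e).
have st' : s <= t <= e by case/andP: st => /ltW -> ->.
have st1' : s <= t1 <= e by rewrite st1 (le_trans (ltW t12) t2e).
have tt : t1 <= t <= t2 by rewrite (ltW t1t).
have [iu uK] := HK st.
have {}HT D := HT st D _ _ wg L0 gL a.
have rM t' : s <= t' <= e -> forall y, Omega y -> `|rho y t'| <= M.
  move=> st0 y Oy; have /andP[p1 p2] := hM _ _ (cell_Omega bc Oy) st0.
  by rewrite ger0_norm// (le_trans (ltW m0)).
have mr := slab_slice_measurable S st'.
have mr1 := slab_slice_measurable S st1'.
have ir1 : mu.-integrable Omega (EFin \o rho^~ t1).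
  exact: bounded_integrable_Omega mr1 (rM _ st1').
have ir : mu.-integrable Omega (EFin \o rho^~ t).
  exact: bounded_integrable_Omega mr (rM _ st').
have q0 : 0 <= rho a t.
  have /andP[p1 _] := hM _ _ (cell01 bc a01) st'.
  by rewrite (le_trans (ltW m0)).
have rq y : Omega y -> ksupp h a y -> `|rho y t - rho a t| <= w.
  by move=> Oy Sy; exact: osc.
have F1 := flux_split iu wg gL L0 h0 h1 ca mr (rM _ st') (ltW w0) q0 rq (hB2 a).
have F2 := @weight_ker2_le _ bc h a h0 h1 ca (rho^~ t) (rho a t) w B2 M mr (rM _ st') (ltW w0) rq (hB2 a).
have qle : rho a t <= kavg (rho^~ t1) h a + eps + w.
  apply: arith1; apply: kavg_ge => // y Oy Sy.
  exact: arith2 (rq y Oy Sy) (heps Oy tt).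
have cD : kavg (u^~ t) h a * kslope (rho^~ t) h a <= eps * KK + C3 * B2 * w * L.
  have [[D aD]|nD] := pselect (bc = Dirichlet /\ (a = 0 \/ a = 1 - h)).
    apply: (le_trans (ler_norm _)); rewrite normrM.
    have H1 := HT D aD.
    apply: (@le_trans _ _ (C3 * (h * L) * (w * (B2 / h)))); first by apply: ler_pM.
    rewrite (_ : C3 * (h * L) * (w * (B2 / h)) = C3 * B2 * w * L); last first.
      have h0' : h != 0 by rewrite gt_eqF.
      by field.
    rewrite lerDr mulr_ge0// !mulr_ge0// ?invr_ge0 ltW//.
  have crit : kslope (rho^~ t1) h a = 0.
    apply: (kslope_critical h0 h1 ca mr1 (rM _ st1') amin) => D.
    by split=> E; apply: nD; split=> //; [left|right].
  have H3 : `|kslope (rho^~ t) h a| <= eps * (B2 / h).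
    have H := @weight_ker2_le _ bc h a h0 h1 ca (fun y => rho y t - rho y t1) 0 eps B2 (M + M).
    have E : kslope (rho^~ t) h a = kslope (fun y => rho y t - rho y t1) h a.
      rewrite -[LHS]subr0 -crit /kslope -OmegaB; [|exact: integrable_mul_ker|exact: integrable_mul_ker].
      by apply: eq_Rintegral => y _; rewrite mulrBl.
    rewrite E; apply: H => //.
    - exact: measurable_funB.
    - by move=> y Oy; rewrite (le_trans (ler_normB _ _))// lerD// rM.
    - by move=> y Oy _; rewrite subr0; exact: heps.
  have H4 : `|kavg (u^~ t) h a| <= K0 * (B1 / h).
    have mk := @ker_measurable R 1 h a.
    have bk y : Omega y -> `|ker 1 h a y| <= B1 / h by move=> _; exact: hB1.
    apply: (le_trans (Omega_mul_bounded iu mk bk).2).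
    by rewrite mulrC ler_wpM2r// divr_ge0// ltW.
  apply: (le_trans (ler_norm _)); rewrite normrM.
  apply: (@le_trans _ _ (K0 * (B1 / h) * (eps * (B2 / h)))); first by apply: ler_pM.
  rewrite (_ : _ * (eps * _) = eps * KK); last by rewrite /KK; ring.
  by rewrite lerDl !mulr_ge0// ltW.
move: F1; rewrite ler_norml => /andP[_ F1].
apply: arith3 F1 cD _.
by rewrite -mulrDl ler_wpM2r// /alpha; exact: arith4.
Qed.

Lemma alpha_gt0 : 0 < alpha.
Proof.
have [m [M [m0 M0 hM]]] := slab_bounds S.
have a01 := centers01 h0 ca.
have st1' : s <= t1 <= e by rewrite st1 (le_trans (ltW t12) t2e).
have mr1 := slab_slice_measurable S st1'.
have ir1 : mu.-integrable Omega (EFin \o rho^~ t1).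
  apply: (@bounded_integrable_Omega _ _ M) => // y Oy.
  have /andP[p1 p2] := hM _ _ (cell_Omega bc Oy) st1'.
  by rewrite ger0_norm// (le_trans (ltW m0)).
have : 0 <= kavg (rho^~ t1) h a.
  apply: kavg_ge => // y Oy _; have /andP[p1 _] := hM _ _ (cell_Omega bc Oy) st1'.
  by rewrite (le_trans (ltW m0)).
have B2w : 0 < (1 + C3) * B2 * w by rewrite !mulr_gt0// ltr_pwDl.
by move=> k0; rewrite /alpha ltr_wpDl//; apply: addr_ge0 (ltW w0); exact: addr_ge0.
Qed.

(** Integrating the bound on the flux over the step.  As the norm of [u_x] may not be
    measurable in time, the measurable function [j] that it dominates almost
    everywhere stands in for it. *)
Lemma min_step : (\int[mu]_(t in `]t1, t2]) dxLinfN bc (u^~ t) < +oo)%E ->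
  kavg (rho^~ t2) h a <= kavg (rho^~ t1) h a + eps * KK * (t2 - t1)
    + alpha * fine (\int[mu]_(t in `]t1, t2]) dxLinfN bc (u^~ t))%E.
Proof.
move=> fin; have al0 := alpha_gt0.
pose J t := kslope (fun x => rho x t * u x t) h a.
have iJ : mu.-integrable `]t1, t2] (EFin \o J) by exact: kslope_flux_integrable.
pose j t := Num.max 0 (alpha^-1 * (J t - eps * KK)).
have mI : measurable (`]t1, t2]%classic : set R) by [].
have icst c : mu.-integrable `]t1, t2] (EFin \o (fun=> c : R)).
  have fin1 : (lebesgue_measure (`]t1, t2]%classic : set R) < +oo)%E.
    by rewrite lebesgue_measure_itv/=; case: ifP => // _; exact: ltry.
  by apply: measurable_bounded_integrable => //; exact: bounded_cst.
have mJ : measurable_fun `]t1, t2] J.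
  by apply/measurable_EFinP; exact: (measurable_int mu).
have mj : measurable_fun `]t1, t2] j.
  apply: measurable_maxr => //; apply: measurable_funM => //.
  exact: measurable_funB.
have j0 t : 0 <= j t by rewrite le_max lexx.
have jle : {ae mu, forall t, t \in `]t1, t2] -> ((j t)%:E <= dxLinfN bc (u^~ t))%E}.
  apply: ae_imp flux_le => t H; rewrite in_itv/= => tt.
  apply: dxLinfN_ge => g L wg L0 gL; rewrite /j ge_max L0/=.
  by rewrite ler_pdivrMl// lerBlDl; exact: H gL.
have Ij : (\int[mu]_(t in `]t1, t2]) (j t)%:E <= \int[mu]_(t in `]t1, t2]) dxLinfN bc (u^~ t))%E.
  apply: ae_le_lower_integral => //.
  - by move=> t; exact: dxLinfN_ge0.
  - exact/measurable_EFinP.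
have ij : mu.-integrable `]t1, t2] (EFin \o j).
  apply/integrableP; split; first exact/measurable_EFinP.
  apply: le_lt_trans fin; apply: le_trans Ij.
  by under eq_integral => t _ do rewrite /= ger0_norm//.
have Ijr : \int[mu]_(t in `]t1, t2]) j t <= fine (\int[mu]_(t in `]t1, t2]) dxLinfN bc (u^~ t))%E.
  apply: fine_le => //; first exact: integrable_fin_num.
  rewrite ge0_fin_numE//; apply: integral_ge0 => t _; exact: dxLinfN_ge0.
have iaj : mu.-integrable `]t1, t2] (EFin \o (fun t => alpha * j t)).
  rewrite (_ : EFin \o _ = fun t => (alpha%:E * (j t)%:E)%E)//.
  exact: integrableZl.
have ib : mu.-integrable `]t1, t2] (EFin \o (fun t => eps * KK + alpha * j t)).
  have := @integrableD _ _ _ mu _ mI _ _ (icst (eps * KK)) iaj.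
  by apply: eq_integrable.
have := kavg_increment ca st1 t12 t2e.
move/eqP; rewrite subr_eq => /eqP ->; rewrite addrC -addrA lerD2l.
apply: (@le_trans _ _ (\int[mu]_(t in `]t1, t2]) (eps * KK + alpha * j t))).
  apply: le_Rintegral => // t _; rewrite -lerBlDl -ler_pdivrMl//.
  by rewrite /j le_max lexx orbT.
have muI : mu (`]t1, t2]%classic : set R) = (t2 - t1)%:E.
  by rewrite lebesgue_measure_itv/= lte_fin t12 EFinB.
rewrite RintegralD//; apply: lerD.
  rewrite Rintegral_cst// le_eqVlt; apply/orP; left; apply/eqP; congr (_ * _).
  exact: (congr1 fine muI).
by rewrite RintegralZl// ler_wpM2l// ltW.
Qed.

End TimeStep.

(** * Almost everywhere bounds from bounds on integrals *)

Section AeFromIntegrals.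
Context {R : realType}.
Local Notation mu := (@lebesgue_measure R).
Implicit Types (f : R -> R) (s e t : R).

Lemma ae_neq e : {ae mu, forall t, t <> e}.
Proof.
exists [set e]; split; [exact: measurable_set1|exact: lebesgue_measure_set1|].
by move=> t /= /contrapT ->.
Qed.

(** The primitive of [f] is nondecreasing and has derivative [f] almost
    everywhere. *)
Lemma ae_ge0_of_integrals f s e : mu.-integrable `]s, e] (EFin \o f) ->
  (forall t1 t2, s <= t1 -> t1 < t2 -> t2 <= e -> 0 <= \int[mu]_(t in `]t1, t2]) f t) ->
  {ae mu, forall t, s < t <= e -> 0 <= f t}.
Proof.
move=> fi H.
have mI : measurable (`]s, e]%classic : set R) by [].
pose g := f \_ `]s, e].
have gi : mu.-integrable setT (EFin \o g).
  have := fi; rewrite integrable_mkcond//.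
  by rewrite /g restrict_EFin.
have gi' y : mu.-integrable `]-oo, y] (EFin \o g) by exact: integrableS gi.
have gl : locally_integrable [set: R] g by exact: integrable_locally_restrict.
have FT := FTC1Ny gi' gl.
pose F x := \int[mu]_(t in `]-oo, x]) g t.
have Fnd t1 t2 : s <= t1 -> t1 <= t2 -> t2 <= e -> F t1 <= F t2.
  move=> st1; rewrite le_eqVlt => /predU1P[->//|t12] t2e.
  rewrite -subr_ge0 /F (@Rintegral_itvB R g -oo%O (BRight t2) t1) ?bnd_simp ?(ltW t12)//.
  have := H _ _ st1 t12 t2e; congr (0 <= _); apply: eq_Rintegral.
  move=> t; rewrite inE/= in_itv/= => /andP[tt1 tt2].
  by rewrite /g patchE mem_set//= in_itv/= (le_lt_trans st1 tt1) (le_trans tt2 t2e).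
apply: ae_imp (ae_and FT (ae_neq e)) => t; move: (t : R) => {}t [[dF F'] te] /andP[st tle].
have te' : t < e by rewrite lt_neqAle tle andbT; apply/eqP.
have -> : f t = g t by rewrite /g patchE mem_set//= in_itv/= st.
rewrite -F' derive1E; apply: limr_ge; first exact: dF.
near=> h; rewrite /GRing.scale/= mulr1.
have h1 : `|h| < t - s.
  by near: h; apply: dnbhs0_lt; rewrite subr_gt0.
have h2 : `|h| < e - t.
  by near: h; apply: dnbhs0_lt; rewrite subr_gt0.
move: h1 h2; rewrite !ltr_norml => /andP[h1 h1'] /andP[h2 h2'].
have [h0|h0] := leP 0 h.
  by rewrite mulr_ge0 ?invr_ge0// subr_ge0; apply: Fnd; lra.
by rewrite mulr_le0// ?invr_le0 ?(ltW h0)// subr_le0; apply: Fnd; lra.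
Unshelve. all: by end_near. Qed.

Lemma ae_norm_le_of_integrals f (D : R -> \bar R) s e :
  mu.-integrable `]s, e] (EFin \o f) -> (forall t, (0 <= D t)%E) ->
  measurable_fun `]s, e] D -> (\int[mu]_(t in `]s, e]) D t < +oo)%E ->
  (forall t1 t2, s <= t1 -> t1 < t2 -> t2 <= e ->
     `|\int[mu]_(t in `]t1, t2]) f t| <= fine (\int[mu]_(t in `]t1, t2]) D t)%E) ->
  {ae mu, forall t, s < t <= e -> (`|f t|%:E <= D t)%E}.
Proof.
move=> fi D0 mD Dfin H.
have mI : measurable (`]s, e]%classic : set R) by [].
have iD : mu.-integrable `]s, e] D.
  apply/integrableP; split=> //; apply: le_lt_trans Dfin.
  by under eq_integral => t _ do rewrite gee0_abs//.
have aefin := @integrable_ae _ _ _ mu _ mI _ iD.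
pose d t := fine (D t).
have id : mu.-integrable `]s, e] (EFin \o d).
  apply/integrableP; split.
    by apply/measurable_EFinP; apply: measurableT_comp => //.
  apply: le_lt_trans Dfin; apply: ge0_le_integral => //.
  - by apply: measurableT_comp => //; apply/measurable_EFinP; apply: measurableT_comp.
  - move=> t _; rewrite /= ger0_norm ?fine_ge0// /d.
    by case: (D t) (D0 t) => [r| |]//= _; rewrite leey.
have sub t1 t2 : s <= t1 -> t2 <= e -> (`]t1, t2]%classic : set R) `<=` (`]s, e]%classic : set R).
  move=> st1 t2e t /=; rewrite !in_itv/= => /andP[h1 h2].
  by rewrite (le_lt_trans st1 h1) (le_trans h2 t2e).
have iE t1 t2 : s <= t1 -> t1 < t2 -> t2 <= e ->
    \int[mu]_(t in `]t1, t2]) d t = fine (\int[mu]_(t in `]t1, t2]) D t)%E.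
  move=> st1 t12 t2e; congr fine; apply: ae_eq_integral => //.
  - apply/measurable_EFinP; apply: measurableT_comp => //.
    by apply: measurable_funS mD => //; exact: sub.
  - by apply: measurable_funS mD => //; exact: sub.
  - apply: ae_imp aefin => t Ht tt; rewrite /= /d fineK//; apply: Ht.
    exact: (sub t1 t2).
have fi' t1 t2 : s <= t1 -> t2 <= e -> mu.-integrable `]t1, t2] (EFin \o f).
  by move=> st1 t2e; apply: integrableS fi => //; exact: sub.
have id' t1 t2 : s <= t1 -> t2 <= e -> mu.-integrable `]t1, t2] (EFin \o d).
  by move=> st1 t2e; apply: integrableS id => //; exact: sub.
have P1 : {ae mu, forall t, s < t <= e -> 0 <= d t - f t}.
  apply: ae_ge0_of_integrals.
    by have := @integrableB _ _ _ mu _ mI _ _ id fi; apply: eq_integrable.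
  move=> t1 t2 st1 t12 t2e; rewrite RintegralB ?id' ?fi'// subr_ge0 iE//.
  exact: le_trans (ler_norm _) (H _ _ st1 t12 t2e).
have P2 : {ae mu, forall t, s < t <= e -> 0 <= d t + f t}.
  apply: ae_ge0_of_integrals.
    by have := @integrableD _ _ _ mu _ mI _ _ id fi; apply: eq_integrable.
  move=> t1 t2 st1 t12 t2e; rewrite RintegralD ?id' ?fi'// iE// -lerBlDr sub0r.
  by apply: le_trans (H _ _ st1 t12 t2e); rewrite -normrN; exact: ler_norm.
apply: ae_imp (ae_and P1 P2) => t [p1 p2] st.
have h1 := p1 st; have h2 := p2 st.
have fd : `|f t| <= d t by rewrite ler_norml -subr_ge0 opprK addrC h2 -subr_ge0.
move: fd; rewrite /d; case: (D t) (D0 t) => [r| |]//= _ _; exact: leey.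
Qed.

End AeFromIntegrals.

(** * The velocity at a wall *)

Section Trace.
Context {R : realType}.
Local Notation mu := (@lebesgue_measure R).

Let arith_osc (p q r w : R) : r - w <= p -> p <= r + w -> r - w <= q -> q <= r + w ->
  `|p - q| <= 2 * w.
Proof. by move=> *; rewrite ler_norml; apply/andP; split; lra. Qed.

Let arith_diff (x y p q c w b : R) : `|x - c * p| <= b -> `|y - c * q| <= b ->
  `|p - q| <= 2 * w -> `|x - y| <= 2 * w * `|c| + 2 * b.
Proof.
move=> h1 h2 h3; have -> : x - y = (x - c * p) - (y - c * q) + c * (p - q) by ring.
rewrite (le_trans (ler_normD _ _))// addrC lerD//.
  by rewrite normrM mulrC ler_wpM2r.
by rewrite (le_trans (ler_normB _ _))// (le_trans (lerD h1 h2))//; lra.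
Qed.

(** The momentum [j] is near [c p], with [c] a velocity and [p >= m] a density; if
    moreover [j] is small compared to [c], then [c] is of the size of the error [b]. *)
Let arith_final (j c p m w b : R) : 0 < m -> 4 * w <= m -> m <= p -> `|j - c * p| <= b ->
  `|j| <= 2 * w * `|c| + 2 * b -> `|c| <= 6 / m * b.
Proof.
move=> m0 wm mp h1 h2.
have : `|c| * p <= 2 * w * `|c| + 3 * b.
  have p0 : 0 <= p by rewrite (le_trans (ltW m0)).
  rewrite -{1}(ger0_norm p0) -normrM.
  have -> : c * p = j - (j - c * p) by ring.
  by rewrite (le_trans (ler_normB _ _))// (le_trans (lerD h2 h1))//; lra.
have c0 : 0 <= `|c| by [].
have : 4 * w * `|c| <= m * `|c| by rewrite ler_wpM2r.
have : `|c| * m <= `|c| * p by rewrite ler_wpM2l.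
rewrite [6 / m * b]mulrAC ler_pdivlMr// => h3 h4 h5.
by lra.
Qed.

(** Unlike the support of the kernel, [[a, a + h]] reaches the wall. *)
Lemma near_kavg_Dirichlet v g (L : R) h a : mu.-integrable Omega (EFin \o v) ->
  weak_deriv Dirichlet v g -> {ae mu, forall x, Omega x -> `|g x| <= L} -> 0 <= L ->
  0 < h -> h <= 1 -> centers Dirichlet h a ->
  {ae mu, forall y, Omega y -> a <= y <= a + h -> `|v y - kavg v h a| <= h * L}.
Proof.
move=> iv wd gL L0 h0 h1 ca.
apply: (@near_kavg_on _ Dirichlet v L h a iv L0 h0 h1 ca [set y | a <= y <= a + h]).
move=> y z ly lz Oy Oz /= /andP[ay yah] Sz.
have [H1 _] := weak_deriv_Lipschitz iv wd gL L0 ly lz Oy Oz.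
rewrite (le_trans H1)// mulrC ler_wpM2r//.
have /andP[z1 z2] := ksupp_Dirichlet h0 ca Oz Sz.
by rewrite ler_norml; apply/andP; split; lra.
Qed.

(** The wall is at 1 if [side] holds and at 0 otherwise. *)
Variable side : bool.
Definition wall_center (h : R) : R := if side then 1 - h else 0.
(** The antiderivative of the kernel next to the wall which vanishes away from the
    wall.  It does not vanish at the wall: it is a test function of the mass
    equation only, and this is where the boundary condition enters.  The second
    translate in [ker 0] is 1 on the whole cell, which explains the constant 2. *)
Definition wall_primitive (h y : R) : R :=
  ker 0 h (wall_center h) y - (if side then 1 else 2).

Lemma wall_centers h : 0 < h -> h <= 1 -> centers Dirichlet h (wall_center h).
Proof.
move=> h0 h1; rewrite /wall_center /= in_itv/=; case: side; apply/andP; split; lra.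
Qed.

Lemma smooth_wall_primitive h : smooth (wall_primitive h).
Proof. by apply: smoothB; [exact: smooth_ker|exact: smooth_cst]. Qed.

Lemma derive1_wall_primitive h : derive1 (wall_primitive h) = ker 1 h (wall_center h).
Proof.
apply/funext => y; rewrite derive1E deriveB; [|exact: smooth_derivable (@smooth_ker R _ _ _)|exact: derivable_cst].
by rewrite derive_cst subr0 -derive1E derive1_ker.
Qed.

Lemma wall_primitive_le1 h y : 0 < h -> h <= 1 -> Omega y -> `|wall_primitive h y| <= 1.
Proof.
move=> h0 h1; rewrite /Omega/= in_itv/= => /andP[y0 y1].
have E : kd 0 h (wall_center h - 1) y = 1.
  by apply: kd0_hi => //; rewrite /wall_center; case: side; lra.
rewrite /wall_primitive /ker E.
have := kd0_ge0 h (wall_center h) y; have := kd0_le1 h (wall_center h) y.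
move: (kd 0 h (wall_center h) y) => k k1 k0.
by rewrite ler_norml; case: side; apply/andP; split; lra.
Qed.

Lemma wall_primitive_out h y : 0 < h -> h <= 1 -> Omega y ->
  y < wall_center h \/ wall_center h + h < y -> wall_primitive h y = 0.
Proof.
move=> h0 h1; rewrite /Omega/= in_itv/= => /andP[y0 y1].
have E : kd 0 h (wall_center h - 1) y = 1.
  by apply: kd0_hi => //; rewrite /wall_center; case: side; lra.
rewrite /wall_primitive /ker E /wall_center; case: side => H.
  by rewrite kd0_lo ?add0r ?subrr//; case: H => H; lra.
have -> : kd 0 h 0 y = 1 by apply: kd0_hi => //; case: H => H; lra.
by ring.
Qed.

Variables (rho u : R -> R -> R) (s e h w m M B1 K0 : R).
Hypothesis S : slab Dirichlet rho u s e.
Hypothesis fin : (\int[mu]_(t in `]s, e]) dxLinfN Dirichlet (u^~ t) < +oo)%E.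
Hypothesis h0 : 0 < h.
Hypothesis h1 : h <= 1.
Hypothesis m0 : 0 < m.
Hypothesis hM : forall x t, cell Dirichlet x -> s <= t <= e -> m <= rho x t <= M.
Hypothesis w0 : 0 <= w.
Hypothesis wm : 4 * w <= m.
Hypothesis osc : forall y t, Omega y -> wall_center h <= y <= wall_center h + h ->
  s <= t <= e -> `|rho y t - rho (wall_center h) t| <= w.
Hypothesis hB1 : forall a y, `|ker 1 h a y| <= B1 / h.
Hypothesis B10 : 0 < B1.
Hypothesis K00 : 0 <= K0.
Hypothesis hK : {ae mu, forall t, s < t <= e ->
    mu.-integrable Omega (EFin \o u^~ t) /\ \int[mu]_(x in Omega) `|u x t| <= K0}.

Let se : s < e := slab_lt S.
Let mO : measurable (@Omega R) := measurable_Omega.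
Let M0 : 0 < M.
Proof.
have ss : s <= s <= e by rewrite lexx ltW.
have c0 : cell Dirichlet (0 : R) by rewrite /= in_itv/= lexx ler01.
by have /andP[h2 h3] := hM c0 ss; rewrite (lt_le_trans m0)// (le_trans h2).
Qed.

Let rM t y : s <= t <= e -> Omega y -> `|rho y t| <= M.
Proof.
move=> st Oy; have /andP[p1 p2] := hM (cell_Omega Dirichlet Oy) st.
by rewrite ger0_norm// (le_trans (ltW m0)).
Qed.

Definition wall_flux (h' t : R) :=
  kavg (fun x => rho x t * u x t) h' (wall_center h').

Lemma wall_flux_integrable h' t1 t2 : s <= t1 -> t1 < t2 -> t2 <= e ->
  mu.-integrable `]t1, t2] (EFin \o wall_flux h').
Proof.
move=> st1 t12 t2e.
have := flux_integrable S (@smooth_wall_primitive h') st1 t12 t2e.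
congr (_.-integrable _ (EFin \o _)); apply/funext => t.
by apply: eq_Rintegral => x _; rewrite derive1_wall_primitive.
Qed.

(** Tested with [wall_primitive], the mass equation equates the momentum next to the
    wall with the change of mass in a layer of width [h']. *)
Lemma wall_flux_small h' t1 t2 : 0 < h' -> h' <= 1 -> s <= t1 -> t1 < t2 -> t2 <= e ->
  `|\int[mu]_(t in `]t1, t2]) wall_flux h' t| <= 2 * (M * h').
Proof.
move=> h'0 h'1 st1 t12 t2e.
have ad : mass_test Dirichlet (wall_primitive h') by split; [exact: smooth_wall_primitive|].
have -> : \int[mu]_(t in `]t1, t2]) wall_flux h' t = \int[mu]_(t in `]t1, t2])
    \int[mu]_(x in Omega) (rho x t * u x t * derive1 (wall_primitive h') x).
  by apply: eq_Rintegral => t _; apply: eq_Rintegral => x _; rewrite derive1_wall_primitive.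
rewrite -(slab_weak S ad st1 t12 t2e).
have mass t : s <= t <= e -> `|\int[mu]_(x in Omega) (rho x t * wall_primitive h' x)| <= M * h'.
  move=> st.
  have -> : M * h' = M * (wall_center h' + h' - wall_center h') by ring.
  have ch : wall_center h' <= wall_center h' + h' by lra.
  apply: (integral_supported_le measurable_Omega _ (ltW M0) ch _ _).2.
  - apply: measurable_funM; first exact: slab_slice_measurable S _ st.
    by apply: smooth_measurable => //; exact: smooth_wall_primitive.
  - move=> y Oy; rewrite normrM -[leRHS]mulr1 ler_pM//; first exact: rM.
    exact: wall_primitive_le1.
  - by move=> y Oy H; rewrite wall_primitive_out// mulr0.
have st1' : s <= t1 <= e by rewrite st1 (le_trans (ltW t12)).
have st2' : s <= t2 <= e by rewrite t2e (le_trans st1 (ltW t12)).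
rewrite (le_trans (ler_normB _ _))// (le_trans (lerD (mass _ st2') (mass _ st1')))//.
by lra.
Qed.

(** Layers inside the given one, shrinking to the wall. *)
Let hn (n : nat) : R := h / n.+2%:R.
Let hn0 n : 0 < hn n. Proof. by rewrite divr_gt0. Qed.
Let hnh n : hn n <= h.
Proof. by rewrite ler_pdivrMr// ler_peMr ?(ltW h0)// ler1n. Qed.
Let hn1 n : hn n <= 1. Proof. exact: le_trans (hnh n) h1. Qed.

Let inner h' y : 0 < h' -> h' <= h -> Omega y -> ksupp h' (wall_center h') y ->
  wall_center h <= y <= wall_center h + h.
Proof.
move=> h'0 h'h Oy Sy.
have := ksupp_Dirichlet h'0 (wall_centers h'0 (le_trans h'h h1)) Oy Sy.
rewrite /wall_center; case: side => /andP[? ?]; apply/andP; split; lra.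
Qed.

(** In the layer of width [h] the velocity varies by at most [h L], so momentum
    averages are a fixed velocity times density averages, even over a narrower
    layer. *)
Lemma wall_flux_near t g (L : R) h' : s < t <= e -> mu.-integrable Omega (EFin \o u^~ t) ->
  weak_deriv Dirichlet (u^~ t) g -> 0 <= L ->
  {ae mu, forall x, Omega x -> `|g x| <= L} -> 0 < h' -> h' <= h ->
  `|wall_flux h' t - kavg (u^~ t) h (wall_center h) * kavg (rho^~ t) h' (wall_center h')|
    <= M * (h * L).
Proof.
move=> st iu wg L0 gL h'0 h'h.
have st' : s <= t <= e by case/andP: st => /ltW -> ->.
have h'1 := le_trans h'h h1.
have ca := wall_centers h0 h1.
have a01' := centers01 h'0 (wall_centers h'0 h'1).
set c := kavg (u^~ t) _ _; set a' := wall_center h'.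
have mr := slab_slice_measurable S st'.
have ir : mu.-integrable Omega (EFin \o rho^~ t).
  by apply: (@bounded_integrable_Omega _ _ M) => // y; exact: rM.
have iru := slab_ru_integrable S st' iu.
have i1 := @integrable_mul_ker _ h' a' h'0 _ 1 iru.
have i2 := integrable_OmegaZl c (@integrable_mul_ker _ h' a' h'0 _ 1 ir).
rewrite /wall_flux /kavg -(OmegaZl c (@integrable_mul_ker _ h' a' h'0 _ 1 ir)) -(OmegaB i1 i2).
rewrite -[leRHS]mulr1 -(integral_ker1 h'0 h'1 a01') -OmegaZl; last exact: integrable_ker.
apply: (Omega_ae_le _ _ _).2.
- by apply: Omega_measurable; exact: integrable_OmegaB.
- by apply: integrable_OmegaZl; exact: integrable_ker.
apply: ae_imp (near_kavg_Dirichlet iu wg gL L0 h0 h1 ca) => y; move: (y : R) => {}y H Oy.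
have gen (r v k : R) : r * v * k - c * (r * k) = r * (v - c) * k by ring.
rewrite gen normrM (ger0_norm (ker1_ge0 _ _ h'0)).
have [Sy|Sy] := pselect (ksupp h' a' y); last by rewrite (ker_out 0 h'0 Sy) !mulr0.
rewrite ler_wpM2r ?ker1_ge0// normrM; apply: ler_pM => //; first exact: rM.
exact: H Oy (inner h'0 h'h Oy Sy).
Qed.

Lemma wall_density t h' : s <= t <= e -> 0 < h' -> h' <= h ->
  [/\ rho (wall_center h) t - w <= kavg (rho^~ t) h' (wall_center h'),
      kavg (rho^~ t) h' (wall_center h') <= rho (wall_center h) t + w &
      m <= kavg (rho^~ t) h' (wall_center h')].
Proof.
move=> st h'0 h'h; have h'1 := le_trans h'h h1.
have a01' := centers01 h'0 (wall_centers h'0 h'1).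
have mr := slab_slice_measurable S st.
have ir : mu.-integrable Omega (EFin \o rho^~ t).
  by apply: (@bounded_integrable_Omega _ _ M) => // y; exact: rM.
split.
- apply: kavg_ge => // y Oy Sy.
  have := osc Oy (inner h'0 h'h Oy Sy) st; rewrite ler_norml => /andP[H _].
  by rewrite lerBrDr addrC in H.
- apply: kavg_le => // y Oy Sy.
  have := osc Oy (inner h'0 h'h Oy Sy) st; rewrite ler_norml => /andP[_ H].
  by rewrite -lerBlDl.
- by apply: kavg_ge => // y Oy _; have /andP[] := hM (cell_Omega Dirichlet Oy) st.
Qed.

(** The change of the momentum from the layer of width [h] to the narrower ones.  A
    supremum over a countable family keeps [D] measurable. *)
Let D t := esups (fun n => `|wall_flux h t - wall_flux (hn n) t|%:E) 0%N.

Let D_ge n t : (`|wall_flux h t - wall_flux (hn n) t|%:E <= D t)%E.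
Proof. by apply: ereal_sup_ubound; exists n. Qed.

Let D0 t : (0 <= D t)%E.
Proof. by apply: le_trans (D_ge 0 t); rewrite lee_fin. Qed.

Let D_le t g (L : R) : s < t <= e -> mu.-integrable Omega (EFin \o u^~ t) ->
  weak_deriv Dirichlet (u^~ t) g -> 0 <= L ->
  {ae mu, forall x, Omega x -> `|g x| <= L} ->
  (D t <= (2 * w * `|kavg (u^~ t) h (wall_center h)| + 2 * (M * (h * L)))%:E)%E.
Proof.
move=> st iu wg L0 gL; apply: ge_ereal_sup => _ [n _ <-]; rewrite lee_fin.
have st' : s <= t <= e by case/andP: st => /ltW -> ->.
have [p1 p2 _] := wall_density st' h0 (lexx h).
have [q1 q2 _] := wall_density st' (hn0 n) (hnh n).
apply: (arith_diff (wall_flux_near st iu wg L0 gL h0 (lexx h))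
  (wall_flux_near st iu wg L0 gL (hn0 n) (hnh n))).
exact: arith_osc p1 p2 q1 q2.
Qed.

Let mI : measurable (`]s, e]%classic : set R). Proof. by []. Qed.

Let mj h' : measurable_fun `]s, e] (wall_flux h').
Proof.
apply/measurable_EFinP; apply: (measurable_int mu).
exact: (@wall_flux_integrable h' s e (lexx s) se (lexx e)).
Qed.

Let mD : measurable_fun `]s, e] D.
Proof.
apply: (measurable_fun_esups (f := fun n t => `|wall_flux h t - wall_flux (hn n) t|%:E)) => n.
apply/measurable_EFinP; apply: measurableT_comp => //; exact: measurable_funB.
Qed.

(** Each [D t] is bounded through the norm of [u_x] up to a constant, so it is
    integrable in time. *)
Let D_integral : (\int[mu]_(t in `]s, e]) D t < +oo)%E.
Proof.
pose C0 := 2 * w * (K0 * (B1 / h)); pose C1 := 2 * (M * h).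
have C00 : 0 <= C0 by rewrite !mulr_ge0// ?invr_ge0 ltW.
have C10 : 0 < C1 by rewrite !mulr_gt0.
pose f t := maxe 0%E ((C1^-1)%:E * (D t - C0%:E))%E.
have f0 t : (0 <= f t)%E by rewrite /f le_max lexx.
have mf : measurable_fun `]s, e] f.
  apply: measurable_maxe => //; apply: measurable_funeM.
  exact: emeasurable_funB.
have fL : {ae mu, forall t, t \in `]s, e] -> (f t <= dxLinfN Dirichlet (u^~ t))%E}.
  apply: ae_imp hK => t; move: (t : R) => {}t H; rewrite in_itv/= => st.
  have [iu uK] := H st.
  rewrite /f ge_max dxLinfN_ge0/=.
  (* Without a bounded weak derivative the norm is infinite and bounds anything. *)
  have [[g [L [wg L0 gL]]]|no] := pselect (exists g L, [/\ weak_deriv Dirichlet (u^~ t) g,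
      0 <= L & {ae mu, forall x, Omega x -> `|g x| <= L}]); last first.
    rewrite (_ : dxLinfN _ _ = +oo%E) ?leey//; apply: eq_infty => r.
    by apply: dxLinfN_ge => g L wg L0 gL; exfalso; apply: no; exists g, L.
  have cK : `|kavg (u^~ t) h (wall_center h)| <= K0 * (B1 / h).
    have mk := @ker_measurable R 1 h (wall_center h).
    have bk y : Omega y -> `|ker 1 h (wall_center h) y| <= B1 / h by move=> _; exact: hB1.
    apply: (le_trans (Omega_mul_bounded iu mk bk).2).
    by rewrite mulrC ler_wpM2r// divr_ge0// ltW.
  have Dfin := D_le st iu wg L0 gL.
  case E : (D t) (D0 t) Dfin => [d| |]// _ _.
  rewrite -EFinB -EFinM; apply: dxLinfN_ge => g' L' wg' L0' gL'.
  have := D_le st iu wg' L0' gL'; rewrite E lee_fin => H'.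
  rewrite ler_pdivrMl// lerBlDl (le_trans H')// lerD//.
    by rewrite /C0 ler_wpM2l ?mulr_ge0.
  by rewrite /C1 !mulrA.
have If : (\int[mu]_(t in `]s, e]) f t < +oo)%E.
  apply: le_lt_trans fin; apply: ae_le_lower_integral => //.
  by move=> t; exact: dxLinfN_ge0.
apply: (@le_lt_trans _ _ (\int[mu]_(t in `]s, e]) (C0%:E + C1%:E * f t))%E).
  apply: ge0_le_integral => //.
  - apply: emeasurable_funD => //; exact: measurable_funeM.
  - move=> t _; rewrite /f.
    case: (D t) (D0 t) => [d| |]// _.
      rewrite -EFinB -EFinM -EFin_max -EFinM -EFinD lee_fin.
      rewrite -lerBlDl -ler_pdivrMl// le_max lexx orbT//.
    by rewrite addye// gt0_muley ?lte_fin ?invr_gt0// max_r ?leey// gt0_muley ?lte_fin// addey.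
rewrite ge0_integralD//; last 2 first.
- by move=> t _; rewrite mule_ge0// lee_fin ltW.
- exact: measurable_funeM.
rewrite ge0_integralZl//; last by rewrite lee_fin ltW.
apply: lte_add_pinfty; last by rewrite lte_mul_pinfty// lee_fin ltW.
rewrite integral_cst//=.
have -> : mu (`]s, e]%classic : set R) = (e - s)%:E.
  by rewrite lebesgue_measure_itv/= lte_fin se EFinB.
by rewrite -EFinM ltry.
Qed.

(** The time integral of the momentum in the narrower layers tends to 0, hence that
    of the layer of width [h] is bounded by that of the difference [D]. *)
Let flux_le_D t1 t2 : s <= t1 -> t1 < t2 -> t2 <= e ->
  `|\int[mu]_(t in `]t1, t2]) wall_flux h t| <= fine (\int[mu]_(t in `]t1, t2]) D t)%E.
Proof.
move=> st1 t12 t2e.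
have sub : (`]t1, t2]%classic : set R) `<=` (`]s, e]%classic : set R).
  move=> t /=; rewrite !in_itv/= => /andP[p1 p2].
  by rewrite (le_lt_trans st1 p1) (le_trans p2 t2e).
have mI' : measurable (`]t1, t2]%classic : set R) by [].
have mD' : measurable_fun `]t1, t2] D by apply: measurable_funS mD.
have Dfin : (\int[mu]_(t in `]t1, t2]) D t < +oo)%E.
  by apply: le_lt_trans D_integral; apply: ge0_subset_integral.
apply/ler_addgt0Pr => r r0.
have [n hr] : exists n, 2 * (M * hn n) <= r.
  have c0 : 0 < 2 * (M * h) by rewrite !mulr_gt0.
  have := @near_infty_natSinv_lt R (PosNum (divr_gt0 r0 c0)).
  case=> n _ /(_ n (leqnn n)) /= H; exists n.
  rewrite /hn !mulrA.
  have : n.+2%:R^-1 <= n.+1%:R^-1 :> R by rewrite lef_pV2 ?posrE// ler_nat.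
  move=> /le_lt_trans /(_ H); rewrite ltr_pdivlMr// mulrC mulrA.
  exact: ltW.
have in1 := @wall_flux_integrable h t1 t2 st1 t12 t2e.
have in2 := @wall_flux_integrable (hn n) t1 t2 st1 t12 t2e.
have idiff : mu.-integrable `]t1, t2] (EFin \o (fun t => wall_flux h t - wall_flux (hn n) t)).
  by have := @integrableB _ _ _ mu _ mI' _ _ in1 in2; apply: eq_integrable.
have -> : \int[mu]_(t in `]t1, t2]) wall_flux h t =
  \int[mu]_(t in `]t1, t2]) (wall_flux h t - wall_flux (hn n) t)
  + \int[mu]_(t in `]t1, t2]) wall_flux (hn n) t.
  have EB := @RintegralB _ _ _ mu _ _ _ mI' in1 in2.
  by apply/eqP; rewrite -subr_eq; apply/eqP/esym; exact: EB.
apply: (le_trans (ler_normD _ _)); apply: lerD; last first.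
  exact: le_trans (wall_flux_small (hn0 n) (hn1 n) st1 t12 t2e) hr.
apply: (le_trans (le_normr_Rintegral _ idiff)) => //.
rewrite /Rintegral fine_le//.
- by apply: integrable_fin_num => //; exact: integrable_norm idiff.
- by rewrite ge0_fin_numE//; apply: integral_ge0.
- apply: ge0_le_integral => //.
  + by apply/measurable_EFinP; apply: measurableT_comp => //; apply/measurable_EFinP; exact: (measurable_int mu).
Qed.

(** The momentum at the wall vanishes only after integration in time; localizing in
    time bounds [|wall_flux h t|] by [D t] almost everywhere.  Since the density
    is nearly constant in the layer, [D] is small compared to the velocity up to an
    error [M h L], and the velocity itself must be of that order. *)
Lemma wall_velocity : {ae mu, forall t, s < t <= e ->
  forall g L, weak_deriv Dirichlet (u^~ t) g -> 0 <= L ->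
    {ae mu, forall x, Omega x -> `|g x| <= L} ->
  `|kavg (u^~ t) h (wall_center h)| <= 6 * M / m * (h * L)}.
Proof.
have ij := @wall_flux_integrable h s e (lexx s) se (lexx e).
have := ae_norm_le_of_integrals ij D0 mD D_integral flux_le_D.
move=> /(ae_and hK); apply: ae_imp => t; move: (t : R) => {}t [HK HD] st g L wg L0 gL.
have [iu uK] := HK st.
have st' : s <= t <= e by case/andP: st => /ltW -> ->.
have [_ _ pm] := wall_density st' h0 (lexx h).
have := le_trans (HD st) (D_le st iu wg L0 gL); rewrite lee_fin => Hj.
have := arith_final m0 wm pm (wall_flux_near st iu wg L0 gL h0 (lexx h)) Hj.
by rewrite !mulrA; congr (_ <= _); rewrite [6 / m * M]mulrAC.
Qed.

End Trace.

(** * The backward bound on the density *)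

Section Backward.
Context {R : realType}.
Local Notation mu := (@lebesgue_measure R).

Let arith_shift (x y k b q : R) : x <= y + b + q -> x + k <= y + k + b + q.
Proof. lra. Qed.

Let arith_wall (x k : R) : 1 - k < x -> x <= 1 -> `|1 - k - x| <= k.
Proof. by move=> *; rewrite ler_norml; apply/andP; split; lra. Qed.

Let arith_sum (x w d q b : R) : d <= w -> q <= w ->
  x + 2 * w + (d + w + b * w) + q <= x + (2 + (1 + 1 + b) + 1) * w.
Proof. by rewrite !mulrDl !mul1r; lra. Qed.

(** One step of the discrete Gronwall inequality, with [1 + l <= exp l]. *)
Let gronwall_step (p p' b l L L' X : R) : 0 <= X -> 0 <= b -> 0 <= l ->
  p' <= p + b + p * l -> p <= expR L * X -> 0 <= p -> 0 <= L -> L + l <= L' ->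
  p' <= expR L' * (X + b).
Proof.
move=> X0 b0 l0 h1 h2 p0 L0 h3.
have e1 : 1 + l <= expR l by exact: expR_ge1Dx.
have e2 : 1 <= expR L by rewrite -[1]expR0 ler_expR.
have e3 : expR L * expR l <= expR L' by rewrite -expRD ler_expR.
have Y0 : 0 <= X + b by exact: addr_ge0.
have q0 : 0 <= p + b by exact: addr_ge0.
apply: (@le_trans _ _ ((p + b) * (1 + l))).
  by rewrite mulrDr mulr1 (le_trans h1)// lerD2l ler_wpM2r// lerDl.
have h4 : p + b <= expR L * (X + b).
  by rewrite mulrDr lerD// ler_peMl.
apply: (@le_trans _ _ (expR L * (X + b) * expR l)).
  by apply: ler_pM => //; rewrite addr_ge0.
by rewrite mulrAC ler_wpM2r.
Qed.

Section Fixed.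
Variables (bc : boundary) (rho u : R -> R -> R) (s e : R).
Hypothesis S : slab bc rho u s e.
Hypothesis fin : (\int[mu]_(t in `]s, e]) dxLinfN bc (u^~ t) < +oo)%E.

Let se : s < e := slab_lt S.

Let lam t1 t2 := fine (\int[mu]_(t in `]t1, t2]) dxLinfN bc (u^~ t))%E.

Let sub t1 t2 : s <= t1 -> t2 <= e -> (`]t1, t2]%classic : set R) `<=` (`]s, e]%classic : set R).
Proof.
move=> st1 t2e t /=; rewrite !in_itv/= => /andP[p1 p2].
by rewrite (le_lt_trans st1 p1) (le_trans p2 t2e).
Qed.

Let fin_sub t1 t2 : s <= t1 -> t2 <= e ->
  (\int[mu]_(t in `]t1, t2]) dxLinfN bc (u^~ t) < +oo)%E.
Proof.
move=> st1 t2e; apply: le_lt_trans fin; apply: lower_integral_subset; last exact: sub.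
by move=> t; exact: dxLinfN_ge0.
Qed.

Let lam_ge0 t1 t2 : 0 <= lam t1 t2.
Proof. by apply: fine_ge0; apply: integral_ge0 => t _; exact: dxLinfN_ge0. Qed.

(** The growth factors multiply along the steps because the lower integral is
    superadditive. *)
Let lam_add t1 t2 : s <= t1 -> t1 <= t2 -> t2 <= e -> lam s t1 + lam t1 t2 <= lam s t2.
Proof.
move=> st1 t12 t2e.
have f1 : (\int[mu]_(t in `]s, t1]) dxLinfN bc (u^~ t))%E \is a fin_num.
  rewrite ge0_fin_numE; first by apply: fin_sub => //; exact: le_trans t2e.
  by apply: integral_ge0 => t _; exact: dxLinfN_ge0.
have f2 : (\int[mu]_(t in `]t1, t2]) dxLinfN bc (u^~ t))%E \is a fin_num.
  rewrite ge0_fin_numE; first exact: fin_sub.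
  by apply: integral_ge0 => t _; exact: dxLinfN_ge0.
have f3 : (\int[mu]_(t in `]s, t2]) dxLinfN bc (u^~ t))%E \is a fin_num.
  rewrite ge0_fin_numE; first exact: fin_sub.
  by apply: integral_ge0 => t _; exact: dxLinfN_ge0.
rewrite /lam -fineD//; apply: fine_le; [by rewrite fin_numD f1 f2|exact: f3|].
apply: lower_integral_superadditive.
- by move=> t; exact: dxLinfN_ge0.
- by move=> t /=; rewrite !in_itv/= => /andP[-> h]; exact: le_trans t12.
- by move=> t /=; rewrite !in_itv/= => /andP[h ->]; rewrite (le_lt_trans st1 h).
- apply/seteqP; split => // t /= []; rewrite !in_itv/= => /andP[_ h] /andP[h' _].
  by move: h; rewrite leNgt h'.
Qed.

Variables (m M K0 B1 B2 : R).
Hypothesis m0 : 0 < m.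
Hypothesis M0 : 0 < M.
Hypothesis hM : forall x t, cell bc x -> s <= t <= e -> m <= rho x t <= M.
Hypothesis K00 : 0 <= K0.
Hypothesis hK : {ae mu, forall t, s < t <= e ->
    mu.-integrable Omega (EFin \o u^~ t) /\ \int[mu]_(x in Omega) `|u x t| <= K0}.
Hypothesis B10 : 0 < B1.
Hypothesis B20 : 0 < B2.
Hypothesis hB1 : forall h a y, 0 < h -> `|ker 1 h a y| <= B1 / h.
Hypothesis hB2 : forall h a, 0 < h -> \int[mu]_(y in Omega) `|ker 2 h a y| <= B2 / h.

Let C3 := 6 * M / m.
Let C30 : 0 <= C3.
Proof. by rewrite !mulr_ge0// ?invr_ge0 ltW. Qed.

Variables (h w : R).
Hypothesis h0 : 0 < h.
Hypothesis h1 : h <= 1.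
Hypothesis w0 : 0 < w.
Hypothesis wm : 4 * w <= m.
Hypothesis osc : forall a y t, centers bc h a -> Omega y -> ksupp h a y -> s <= t <= e ->
  `|rho y t - rho a t| <= w.
Hypothesis osc' : forall x y t, 0 <= x <= 1 -> 0 <= y <= 1 -> `|x - y| <= h -> s <= t <= e ->
  `|rho x t - rho y t| <= w.

Let trace : bc = Dirichlet -> {ae mu, forall t, s < t <= e ->
  forall g L, weak_deriv bc (u^~ t) g -> 0 <= L ->
    {ae mu, forall x, Omega x -> `|g x| <= L} ->
  forall a, a = 0 \/ a = 1 - h -> `|kavg (u^~ t) h a| <= C3 * (h * L)}.
Proof.
move=> D; move: S fin hM osc; rewrite D => SD finD hMD oscD.
have W side : {ae mu, forall t, s < t <= e ->
  forall g L, weak_deriv Dirichlet (u^~ t) g -> 0 <= L ->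
    {ae mu, forall x, Omega x -> `|g x| <= L} ->
  `|kavg (u^~ t) h (wall_center side h)| <= 6 * M / m * (h * L)}.
  apply: (@wall_velocity _ side rho u s e h w m M B1 K0) => //.
  - exact: ltW.
  - move=> y t Oy /andP[y1 y2] st; apply: osc' => //.
    + by move: Oy; rewrite /Omega/= in_itv/= => /andP[? ?]; apply/andP; split; exact: ltW.
    + exact: (centers01 h0 (wall_centers side h0 h1)).
    + by rewrite ler_norml; apply/andP; split; lra.
  - by move=> a y; exact: hB1.
apply: ae_imp (ae_and (W false) (W true)) => t [W0 W1] st g L wg L0 gL a [->|->].
  exact: W0 wg L0 gL.
exact: W1 wg L0 gL.
Qed.

Let slice_integrable t : s <= t <= e -> mu.-integrable Omega (EFin \o rho^~ t).
Proof.
move=> st; apply: (@bounded_integrable_Omega _ _ M); first exact: slab_slice_measurable S _ st.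
move=> y Oy; have /andP[p1 p2] := hM (cell_Omega bc Oy) st.
by rewrite ger0_norm// (le_trans (ltW m0)).
Qed.

Let minimizer t : s <= t <= e -> exists a, centers bc h a /\
  forall b, centers bc h b -> kavg (rho^~ t) h a <= kavg (rho^~ t) h b.
Proof.
move=> st.
have rM y : Omega y -> `|rho y t| <= M.
  move=> Oy; have /andP[p1 p2] := hM (cell_Omega bc Oy) st.
  by rewrite ger0_norm// (le_trans (ltW m0)).
have cont := kavg_continuous h0 (slab_slice_measurable S st) rM.
have ne : centers bc h !=set0.
  by exists 0; case: bc; rewrite /= in_itv/= lexx ?ler01// subr_ge0.
have cc : compact (centers bc h) by case: bc; exact: segment_compact.
have [a /set_mem ca amin] := compact_EVT_min ne cc (continuous_subspaceT cont).
exists a; split; first exact: ca.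
by move=> b cb; apply: amin; exact: mem_set.
Qed.

(** Gronwall over a uniform partition whose step is so small that [rho] varies by
    at most [eps] in time.  The least average at the final time is at least [c], and the
    one at the initial time is at most the average near [x0], that is
    [rho x0 s] up to the oscillation. *)
Lemma min_density_backward x0 c (eps : R) : 0 < eps -> 0 <= x0 <= 1 ->
  (forall x, 0 <= x <= 1 -> c <= rho x e) ->
  c <= expR (lam s e) * (rho x0 s + 2 * w + (eps + w + (1 + C3) * B2 * w)
    + eps * (K0 * (B1 / h) * (B2 / h)) * (e - s)).
Proof.
move=> eps0 x01 hc.
set KK := K0 * _ * _; set cst := eps + w + _.
have KK0 : 0 <= KK by rewrite !mulr_ge0// ?invr_ge0 ltW.
have cst0 : 0 <= cst.
  by rewrite addr_ge0 ?addr_ge0 ?mulr_ge0 ?addr_ge0// ltW.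
have [d d0 hd] := slab_uniform S eps0.
have es0 : 0 < e - s by rewrite subr_gt0.
have [n hn] : exists n, (e - s) / n.+1%:R < d.
  have := @near_infty_natSinv_lt R (PosNum (divr_gt0 d0 es0)).
  case=> n _ /(_ n (leqnn n)) /= H; exists n.
  by move: H; rewrite ltr_pdivlMr// mulrC.
pose dl := (e - s) / n.+1%:R.
have dl0 : 0 < dl by rewrite divr_gt0.
pose t_ (i : nat) := s + dl * i%:R.
have tN : t_ n.+1 = e by rewrite /t_ /dl divfK// addrC subrK.
have t0 : t_ 0%N = s by rewrite /t_ mulr0 addr0.
have tS i : t_ i.+1 = t_ i + dl by rewrite /t_ -addrA -[X in _ * X]natr1 mulrDr mulr1.
have st i : s <= t_ i by rewrite lerDl mulr_ge0// ltW.
have te i : (i <= n.+1)%N -> t_ i <= e.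
  by move=> ilen; rewrite -tN lerD2l ler_wpM2l ?ler_nat// ltW.
have ste i : (i <= n.+1)%N -> s <= t_ i <= e by move=> ilen; rewrite st te.
(* The minimizing centre changes from step to step: the bound on one step uses
   the minimizer at its start as a competitor at its end. *)
pose P (i : nat) (a : R) := (i <= n.+1)%N -> centers bc h a /\
  forall b, centers bc h b -> kavg (rho^~ (t_ i)) h a <= kavg (rho^~ (t_ i)) h b.
have [a_ ha] : {a_ : nat -> R & forall i, P i (a_ i)}.
  apply: (@choice _ _ P) => i.
  have [ilen|ilen] := boolP (i <= n.+1)%N; last by exists 0 => ilen'; move: ilen; rewrite ilen'.
  by have [a ca] := minimizer (ste i ilen); exists a.
pose mn i := kavg (rho^~ (t_ i)) h (a_ i).
have mn0 i : (i <= n.+1)%N -> 0 <= mn i.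
  move=> ilen; have [ca _] := ha i ilen.
  apply: kavg_ge => //; [exact: slice_integrable (ste i ilen)|exact: (centers01 h0 ca)|].
  move=> y Oy _; have /andP[p1 _] := hM (cell_Omega bc Oy) (ste i ilen).
  by rewrite (le_trans (ltW m0)).
have step i : (i < n.+1)%N ->
    mn i.+1 <= mn i + eps * KK * dl + (mn i + cst) * lam (t_ i) (t_ i.+1).
  move=> ilt; have [ca amin] := ha i (ltnW ilt); have [_ amin'] := ha i.+1 ilt.
  apply: (le_trans (amin' _ ca)).
  have lt12 : t_ i < t_ i.+1 by rewrite tS ltrDl.
  have heps y t : Omega y -> t_ i <= t <= t_ i.+1 -> `|rho y t - rho y (t_ i)| <= eps.
    move=> Oy /andP[p1 p2]; apply/ltW/hd; [exact: cell_Omega|exact: cell_Omega| | | |].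
    - by rewrite (le_trans (st i) p1) (le_trans p2 (te _ ilt)).
    - exact: ste (ltnW ilt).
    - by rewrite subrr normr0.
    - apply: le_lt_trans hn; rewrite ger0_norm ?subr_ge0//.
      by rewrite lerBlDl -tS.
  have := @min_step _ bc rho u s e h w B1 B2 C3 K0 S h0 h1 w0 osc B10 B20 C30
    (fun a y => hB1 a y h0) (fun a => hB2 a h0) K00 hK trace (t_ i) (t_ i.+1) eps (a_ i)
    (st i) lt12 (te _ ilt) (ltW eps0) heps ca amin (fin_sub (st i) (te _ ilt)).
  by rewrite (_ : t_ i.+1 - t_ i = dl) ?tS ?(addrC (t_ i)) ?addrK// /mn /cst !addrA.
pose p i := mn i + cst.
have p0 i : (i <= n.+1)%N -> 0 <= p i by move=> ilen; rewrite addr_ge0// mn0.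
have claim i : (i <= n.+1)%N -> p i <= expR (lam s (t_ i)) * (p 0%N + eps * KK * dl * i%:R).
  elim: i => [|i ih] ilen.
    rewrite mulr0 addr0 t0 ler_peMl ?p0//.
    by rewrite -[leLHS]expR0 ler_expR.
  have b0 : 0 <= eps * KK * dl := mulr_ge0 (mulr_ge0 (ltW eps0) KK0) (ltW dl0).
  have Ei : p 0%N + eps * KK * dl * i.+1%:R = p 0%N + eps * KK * dl * i%:R + eps * KK * dl.
    by rewrite -(natr1 i) mulrDr mulr1 addrA.
  rewrite Ei.
  apply: (@gronwall_step (p i) _ _ (lam (t_ i) (t_ i.+1)) (lam s (t_ i))) => //.
  - by rewrite addr_ge0 ?p0// mulr_ge0.
  - have := step i ilen; rewrite /p => H.
    exact: arith_shift H.
  - exact: ih (ltnW ilen).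
  - exact: p0 (ltnW ilen).
  - by apply: lam_add => //; [rewrite tS lerDl ltW|exact: te].
have last := claim n.+1 (leqnn _).
have [cN _] := ha n.+1 (leqnn _).
have cle : c <= p n.+1.
  rewrite /p; apply: (@le_trans _ _ (mn n.+1)); last by rewrite lerDl.
  apply: kavg_ge => //; [exact: slice_integrable (ste _ (leqnn _))|exact: (centers01 h0 cN)|].
  move=> y Oy _; rewrite tN; apply: hc.
  by move: Oy; rewrite /Omega/= in_itv/= => /andP[? ?]; apply/andP; split; exact: ltW.
apply: (le_trans cle); apply: (le_trans last).
have -> : lam s (t_ n.+1) = lam s e by rewrite tN.
rewrite ler_wpM2l ?expR_ge0//; apply: lerD; last first.
  by rewrite -mulrA (_ : dl * n.+1%:R = e - s)// /dl divfK.
rewrite /p lerD2r.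
have [_ amin] := ha 0%N (leq0n _).
have ss : s <= s <= e by rewrite lexx ltW.
have [b cb bx] : exists2 b, centers bc h b & `|b - x0| <= h.
  move: x01 => /andP[x00 x01]; case: bc => /=.
    have [xh|xh] := leP x0 (1 - h).
      by exists x0; [rewrite in_itv/= x00|rewrite subrr normr0 ltW].
    exists (1 - h); first by rewrite in_itv/= lexx subr_ge0 h1.
    exact: arith_wall xh x01.
  by exists x0; [rewrite in_itv/= x00|rewrite subrr normr0 ltW].
apply: (le_trans (amin b cb)); rewrite t0.
have b01 := centers01 h0 cb.
apply: kavg_le => //; first exact: slice_integrable.
move=> y Oy Sy.
have := osc cb Oy Sy ss; have := osc' b01 x01 bx ss.
rewrite !ler_norml => /andP[_ H1] /andP[_ H2].
rewrite -lerBlDl; apply: (@le_trans _ _ ((rho y s - rho b s) + (rho b s - rho x0 s))).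
  by rewrite addrA subrK.
by rewrite (le_trans (lerD H2 H1))// mulrDl mul1r.
Qed.

End Fixed.

(** The errors in the preceding bound are a constant times the oscillation [w], the
    width [h] being chosen after [w], and the time step [eps] after [h]. *)
Theorem slab_backward_bound bc (rho u : R -> R -> R) (s e x0 c : R) :
  slab bc rho u s e -> (\int[mu]_(t in `]s, e]) dxLinfN bc (u^~ t) < +oo)%E ->
  0 <= x0 <= 1 -> (forall x, 0 <= x <= 1 -> c <= rho x e) ->
  c <= expR (fine (\int[mu]_(t in `]s, e]) dxLinfN bc (u^~ t))%E) * rho x0 s.
Proof.
move=> S fin x01 hc.
have [m [M [m0 M0 hM]]] := slab_bounds S.
have [K0 K00 hK] := slab_L1 S.
have [B1 B10 hB1] := @ker_bounded R 1.
have [B2 B20 hB2] := @integral_norm_ker2 R.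
set E := expR _; have E0 : 0 < E by exact: expR_gt0.
have se := slab_lt S.
pose C := 2 + (1 + 1 + (1 + 6 * M / m) * B2) + 1.
have C3 : 0 <= 6 * M / m by rewrite !mulr_ge0// ?invr_ge0 ltW.
have C0 : 0 < C by rewrite !addr_gt0// ?mulr_gt0 ?ltr_pwDl.
apply/ler_addgt0Pr => r r0.
pose w := Num.min (r / (E * C)) (m / 4).
have w0 : 0 < w by rewrite lt_min !divr_gt0// mulr_gt0.
have wr : w <= r / (E * C) by rewrite ge_min lexx.
have wm : 4 * w <= m by rewrite mulrC -ler_pdivlMr// ge_min lexx orbT.
have [d1 d10 osc] := slab_osc S w0.
have [d2 d20 uni] := slab_uniform S w0.
pose h := Num.min 1 (Num.min (d1 / 2) (d2 / 2)).
have h0 : 0 < h by rewrite !lt_min ltr01 !divr_gt0.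
have h1 : h <= 1 by rewrite ge_min lexx.
have hd1 : h < d1.
  apply: (@le_lt_trans _ _ (d1 / 2)); first by rewrite !ge_min lexx orbT.
  by rewrite ltr_pdivrMr// ltr_pMr// ltr1n.
have hd2 : h < d2.
  apply: (@le_lt_trans _ _ (d2 / 2)); first by rewrite !ge_min lexx !orbT.
  by rewrite ltr_pdivrMr// ltr_pMr// ltr1n.
pose KK := K0 * (B1 / h) * (B2 / h).
have KK0 : 0 <= KK by rewrite !mulr_ge0// ?invr_ge0 ltW.
have es0 : 0 <= KK * (e - s) by rewrite mulr_ge0// subr_ge0 ltW.
pose eps := Num.min w (w / (KK * (e - s) + 1)).
have KK1 : 0 < KK * (e - s) + 1 by rewrite ltr_wpDl.
have eps0 : 0 < eps by rewrite lt_min w0 divr_gt0.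
have epsw : eps <= w by rewrite ge_min lexx.
have epsK : eps * KK * (e - s) <= w.
  have : eps * (KK * (e - s) + 1) <= w by rewrite -ler_pdivlMr// ge_min lexx orbT.
  rewrite mulrDr mulr1 mulrA; apply: le_trans; rewrite lerDl ltW//.
have B := @min_density_backward bc rho u s e S fin m M K0 B1 B2 m0 M0 hM K00 hK B10 B20
  _ hB2 h w h0 h1 w0 wm _ _ x0 c eps eps0 x01 hc.
apply: (@le_trans _ _ (E * (rho x0 s + 2 * w + (eps + w + (1 + 6 * M / m) * B2 * w)
   + eps * KK * (e - s)))).
  apply: B.
  - by move=> h' a y h'0; have := hB1 h' a y h'0; rewrite expr1.
  - by move=> a y t ca Oy Sy st; exact: osc hd1 h1 ca Oy Sy st.
  - move=> x y t xx yy xy st; apply/ltW/uni => //; try exact: cell01.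
      exact: le_lt_trans xy hd2.
    by rewrite subrr normr0.
apply: (@le_trans _ _ (E * (rho x0 s + C * w))).
  by rewrite ler_wpM2l ?(ltW E0)//; exact: arith_sum.
by rewrite mulrDr lerD2l mulrA mulrC -ler_pdivlMr// mulr_gt0.
Qed.

End Backward.

(** * The mass equation of a weak solution *)

Section Solution.
Context {R : realType}.
Local Notation mu := (@lebesgue_measure R).
Implicit Types (bc : boundary) (v g : R -> R) (s e t x y c : R).

Let mO : measurable (@Omega R) := measurable_Omega.

(** Via [|v| <= 1 + v ^ 2]. *)
Lemma LpN2_L1 v M : measurable_fun Omega v -> (LpN Omega 2%:E v <= M%:E)%E ->
  mu.-integrable Omega (EFin \o v) /\ \int[mu]_(x in Omega) `|v x| <= 1 + M ^+ 2.
Proof.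
move=> mv H.
pose I := (\int[mu]_(x in Omega) (v x ^+ 2)%:E)%E.
have I0 : (0 <= I)%E by apply: integral_ge0 => x _; rewrite lee_fin sqr_ge0.
have E : LpN Omega 2%:E v = (I `^ 2^-1)%E.
  rewrite /LpN unlock; congr (_ `^ _)%E.
  rewrite /I [RHS]integral_mkcond; apply: eq_integral => x _.
  rewrite /= [v \_ _]/patch /= [RHS]patchE; case: ifP => _ /=.
    by rewrite powR_mulrn// real_normK// num_real.
  by rewrite normr0 powR0// pnatr_eq0.
move: H; rewrite E => H.
have IM : (I <= (M ^+ 2)%:E)%E.
  case: I I0 H {E} => [i| |]//=.
    rewrite !lee_fin => i0; rewrite powR12_sqrt// => H.
    rewrite -(sqr_sqrtr i0) ler_sqr ?nnegrE ?sqrtr_ge0//.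
    by rewrite (le_trans (sqrtr_ge0 i)).
  by rewrite invr_eq0 pnatr_eq0.
have mv2 : measurable_fun Omega (fun x => v x ^+ 2) by exact: measurable_funX.
have i2 : mu.-integrable Omega (EFin \o (fun x => v x ^+ 2)).
  apply/integrableP; split; first exact/measurable_EFinP.
  under eq_integral => x _ do rewrite /= ger0_norm ?sqr_ge0//.
  by rewrite (le_lt_trans IM)// ltry.
have i1 := integrable_OmegaD (integrable_Omega_cst 1) i2.
have le : {ae mu, forall x, Omega x -> `|v x| <= 1 + v x ^+ 2}.
  apply: aeW => x _; rewrite -(real_normK (num_real (v x))).
  have := sqr_ge0 (`|v x| - 2^-1); have := normr_ge0 (v x); nra.
have iv := (Omega_ae_le mv i1 le).1; split => //.
apply: (@le_trans _ _ (\int[mu]_(x in Omega) (1 + v x ^+ 2))).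
  exact: Omega_ae_le_int (integrable_Omega_norm iv) i1 le.
rewrite OmegaD//; last exact: integrable_Omega_cst.
rewrite Omega_cst lerD2l -lee_fin.
by rewrite /Rintegral fineK// ge0_fin_numE// (le_lt_trans IM)// ltry.
Qed.

Lemma sqrt_measurable (D : set R) : measurable D -> measurable_fun D (@Num.sqrt R).
Proof.
move=> mD; apply: measurable_funTS.
by apply: continuous_measurable_fun; exact: sqrt_continuous.
Qed.

Section Flow.
Variables (bc : boundary) (alpha gamma : R) (rho0 m0 : R -> R) (rho w u : R -> R -> R).
Hypothesis sol : global_entropy_weak_solution bc alpha gamma rho0 m0 rho w.
Hypothesis vel : is_velocity bc rho w u.

Lemma rho_cell_cont a b : 0 <= a ->
  {within cell bc `*` `[a, b], continuous (fun z : R * R => rho z.1 z.2)}.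
Proof.
move=> a0; case: sol => + _ _; apply: continuous_subspaceW => -[x t] [/= cx].
rewrite !in_itv/= => /andP[at_ _]; split => /=.
  by case: bc cx.
by rewrite ?in_itv/= ?andbT (le_trans a0).
Qed.

Section UpTo.
Variable T : R.
Hypothesis T0 : 0 < T.

Let itT (t : R) : (`]0, T[%classic : set R) t -> 0 <= t <= T.
Proof. by rewrite /= in_itv/= => /andP[/ltW -> /ltW ->]. Qed.

Lemma rho_bounded : exists2 M : R, 0 < M &
  forall x t, Omega x -> 0 <= t <= T -> `|rho x t| <= M.
Proof.
have [p [q [_ _ _ _ H]]] := cell_bounds (ltW T0) (@rho_cell_cont 0 T (lexx 0)).
exists (`|rho p.1 p.2| + `|rho q.1 q.2| + 1).
  by rewrite ltr_wpDl// addr_ge0.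
move=> x t Ox tT; have /andP[h1 h2] := H x t (cell_Omega bc Ox) tT.
rewrite ler_norml; apply/andP; split.
  have := ler_norm (- rho p.1 p.2); rewrite normrN.
  by have := normr_ge0 (rho q.1 q.2); lra.
have := ler_norm (rho q.1 q.2); have := normr_ge0 (rho p.1 p.2); lra.
Qed.

Lemma rho_time_cont t c : 0 < t < T -> 0 < c -> exists2 d, 0 < d &
  forall x t', Omega x -> 0 <= t' <= T -> `|t - t'| < d -> `|rho x t - rho x t'| < c.
Proof.
move=> /andP[t0 tT] c0.
have cK : compact (cell bc `*` `[0, T]%classic : set (R * R)).
  by apply: compact_setX; [case: bc; exact: segment_compact|exact: segment_compact].
have [d d0 hd] := uniformly_continuous_on cK (@rho_cell_cont 0 T (lexx 0)) c0.
exists d => // x t' Ox t'T tt; apply: (hd (x, t) (x, t')).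
- by split => /=; [exact: cell_Omega|rewrite in_itv/= !ltW].
- by split => /=; [exact: cell_Omega|rewrite in_itv/=].
- by split; rewrite /= /ball/= ?subrr ?normr0.
Qed.

Lemma rho_measurable : jointly_measurable Omega T rho.
Proof. by case: sol => _ _ [? [? [_ _ /(_ _ T0)[? [? [? [[[_ [] ] ]]]]]]]]. Qed.

Lemma w_measurable : jointly_measurable Omega T w.
Proof. by case: sol => _ _ [? [? [_ _ /(_ _ T0)[? [? [? [[_ _ [[]]]]]]]]]]. Qed.

Lemma w_L1 : exists2 K : R, 0 <= K & {ae mu, forall t, 0 < t < T ->
  mu.-integrable Omega (EFin \o w^~ t) /\ \int[mu]_(x in Omega) `|w x t| <= K}.
Proof.
case: sol => _ _ [? [? [_ _ /(_ _ T0)[? [? [? [[_ _ [[mw [M hM]] _] _ _]] _ _ _ _]]]]]].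
exists (1 + M ^+ 2); first by rewrite addr_ge0// sqr_ge0.
apply: ae_imp (hM) => t H tT; apply: LpN2_L1; last by apply: H; rewrite in_itv.
by apply: (measurable_slice _ _ _ mw) => //=; rewrite in_itv.
Qed.

Lemma mass_equation psi : Psi bc T psi ->
  \int[mu]_(x in Omega) (rho0 x * psi x 0)
  + stint Omega T (fun x t => rho x t * dt psi x t)
  + stint Omega T (fun x t => Num.sqrt (rho x t) * w x t * dx psi x t) = 0.
Proof. by case: sol => _ _ [? [? [_ _ /(_ _ T0)[? [? [? [[_ _ _ H _]] _ _ _ _]]]]]]; exact: H. Qed.

Definition mass g t := \int[mu]_(x in Omega) (rho x t * g x).
Definition momentum g t := \int[mu]_(x in Omega) (Num.sqrt (rho x t) * w x t * derive1 g x).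

Lemma rho_slice t : 0 < t < T -> mu.-integrable Omega (EFin \o rho^~ t).
Proof.
move=> tT; have [M M0 hM] := rho_bounded.
apply: (@bounded_integrable_Omega _ _ M).
  by apply: (measurable_slice _ _ _ rho_measurable) => //=; rewrite in_itv.
by move=> x Ox; apply: hM => //; move: tT => /andP[/ltW -> /ltW ->].
Qed.

Lemma rho_g_integrable g t : smooth g -> 0 < t < T ->
  mu.-integrable Omega (EFin \o (fun x => rho x t * g x)).
Proof.
move=> sg tT; have [c c0 hc] := smooth_bounded sg.
exact: (Omega_mul_bounded (rho_slice tT) (smooth_measurable mO sg) hc).1.
Qed.

Lemma sqrt_rho_bound M x t : 0 < M -> `|rho x t| <= M -> `|Num.sqrt (rho x t)| <= Num.sqrt M.
Proof.
move=> M0 h; rewrite ger0_norm ?sqrtr_ge0//.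
by apply: ler_wsqrtr; rewrite (le_trans (ler_norm _)).
Qed.

Let mD : measurable ((Omega : set R) `*` (`]0, T[%classic : set R)).
Proof. exact: measurableX. Qed.

Lemma sqrt_rho_measurable : measurable_fun (Omega `*` `]0, T[) (fun z : R * R => Num.sqrt (rho z.1 z.2)).
Proof.
apply: (@measurableT_comp _ _ _ _ _ _ (@Num.sqrt R)) => //.
  exact: sqrt_measurable.
exact: rho_measurable.
Qed.

Lemma momentum_slice t : 0 < t < T -> mu.-integrable Omega (EFin \o w^~ t) ->
  mu.-integrable Omega (EFin \o (fun x => Num.sqrt (rho x t) * w x t)).
Proof.
move=> tT iw; have [M M0 hM] := rho_bounded.
have tT' : 0 <= t <= T by move: tT => /andP[/ltW -> /ltW ->].
have ms : measurable_fun Omega (fun x => Num.sqrt (rho x t)).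
  by apply: (measurable_slice _ _ _ sqrt_rho_measurable) => //=; rewrite in_itv.
have bs x : Omega x -> `|Num.sqrt (rho x t)| <= Num.sqrt M.
  by move=> Ox; apply: sqrt_rho_bound => //; exact: hM.
have := (Omega_mul_bounded iw ms bs).1.
by apply: eq_integrable => // x _ /=; rewrite mulrC.
Qed.

Lemma mass_measurable g : smooth g -> measurable_fun `]0, T[ (mass g).
Proof.
move=> sg.
apply: (@measurable_space_integral _ Omega `]0, T[%classic
  (fun z => rho z.1 z.2 * g z.1)) => //.
apply: measurable_funM; first exact: rho_measurable.
apply: measurable_funTS.
apply: (@measurableT_comp _ _ _ _ _ _ g) => //.
exact: smooth_measurable.
Qed.

Lemma momentum_measurable g : smooth g -> measurable_fun `]0, T[ (momentum g).
Proof.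
move=> sg.
apply: (@measurable_space_integral _ Omega `]0, T[%classic
  (fun z => Num.sqrt (rho z.1 z.2) * w z.1 z.2 * derive1 g z.1)) => //.
apply: measurable_funM.
  by apply: measurable_funM; [exact: sqrt_rho_measurable|exact: w_measurable].
apply: measurable_funTS.
apply: (@measurableT_comp _ _ _ _ _ _ (derive1 g)) => //.
exact: (smooth_measurable _ (smooth_derive1 sg)).
Qed.

Lemma mass_integrable g : smooth g -> mu.-integrable `]0, T[ (EFin \o mass g).
Proof.
move=> sg; have [M M0 hM] := rho_bounded; have [c c0 hc] := smooth_bounded sg.
apply: (@ae_le_integrable _ _ _ mu `]0, T[%classic (mass g) (fun=> c * M) _ _ _ _).1 => //.
- exact: mass_measurable.
- exact: integrable_cst_itv.
apply: aeW => t /= tT; have tT2 := itT tT; move: tT; rewrite in_itv/= => tT.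
have ir := rho_slice tT.
apply: (le_trans (Omega_mul_bounded ir (smooth_measurable mO sg) hc).2).
rewrite ler_wpM2l ?(ltW c0)//.
rewrite -[leRHS]Omega_cst; apply: Omega_ae_le_int.
- exact: integrable_Omega_norm.
- exact: integrable_Omega_cst.
- by apply: aeW => x Ox; exact: hM.
Qed.

Lemma momentum_integrable g : smooth g -> mu.-integrable `]0, T[ (EFin \o momentum g).
Proof.
move=> sg; have [M M0 hM] := rho_bounded.
have [c c0 hc] := smooth_bounded (smooth_derive1 sg).
have [K K0 hK] := w_L1.
apply: (@ae_le_integrable _ _ _ mu `]0, T[%classic (momentum g)
  (fun=> c * (Num.sqrt M * K)) _ _ _ _).1 => //.
- exact: momentum_measurable.
- exact: integrable_cst_itv.
apply: ae_imp (hK) => t H tT; have tT2 := itT tT.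
move: tT; rewrite /= in_itv/= => tT.
have [iw wK] := H tT.
have isw := momentum_slice tT iw.
have mg : measurable_fun Omega (derive1 g).
  exact: (smooth_measurable _ (smooth_derive1 sg)).
apply: (le_trans (Omega_mul_bounded isw mg hc).2).
rewrite ler_wpM2l ?(ltW c0)//.
apply: (@le_trans _ _ (\int[mu]_(x in Omega) (Num.sqrt M * `|w x t|))).
  apply: Omega_ae_le_int.
  - exact: integrable_Omega_norm.
  - by apply: integrable_OmegaZl; exact: integrable_Omega_norm.
  - by apply: aeW => x Ox; rewrite normrM ler_wpM2r//; apply: sqrt_rho_bound => //; exact: hM.
by rewrite OmegaZl ?ler_wpM2l ?sqrtr_ge0//; exact: integrable_Omega_norm.
Qed.

Lemma mass_continuous g t : smooth g -> 0 < t < T -> {for t, continuous (mass g)}.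
Proof.
move=> sg tT; have [c c0 hc] := smooth_bounded sg.
apply/cvgrPdist_le => q q0.
have [d d0 hd] := rho_time_cont tT (divr_gt0 q0 c0).
near=> t'.
have t'T : 0 < t' < T.
  have -> : (0 < t' < T) = (t' \in `]0, T[) by rewrite in_itv.
  by near: t'; apply: near_in_itvoo; rewrite in_itv.
have t'T2 : 0 <= t' <= T by move: t'T => /andP[/ltW -> /ltW ->].
have td : `|t - t'| < d.
  by near: t'; apply/nbhs_ballP; exists d.
rewrite /mass -OmegaB; [|exact: rho_g_integrable|exact: rho_g_integrable].
rewrite -[leRHS]Omega_cst.
apply: (Omega_ae_le _ (integrable_Omega_cst q) _).2.
  apply: Omega_measurable; apply: integrable_OmegaB; exact: rho_g_integrable.
apply: aeW => x Ox; rewrite -mulrBl normrM.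
apply: (@le_trans _ _ (q / c * c)); last by rewrite divfK// gt_eqF.
by apply: ler_pM => //; [exact/ltW/hd|exact: hc].
Unshelve. all: by end_near. Qed.

(** Test functions [g x * f t] turn the mass equation into a weak equation in time;
    the one for [f] vanishing before [t1 > 0] does not see the initial density. *)
Lemma mass_increment g t1 t2 : mass_test bc g -> 0 < t1 -> t1 < t2 -> t2 < T ->
  mass g t2 - mass g t1 = \int[mu]_(t in `]t1, t2]) momentum g t.
Proof.
move=> ag t10 t12 t2T; have sg := ag.1.
apply: (@weak_increment _ T) => //.
- exact: mass_integrable.
- exact: momentum_integrable.
- by apply: mass_continuous => //; apply/andP; split; lra.
- by apply: mass_continuous => //; apply/andP; split; lra.
move=> f sf f0 [T' TT' fT'].
have := mass_equation (Psi_prod ag sf TT' fT').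
rewrite (_ : \int[mu]_(x in Omega) _ = 0); last first.
  transitivity (\int[mu]_(x in Omega) (0 : R)); last by rewrite Omega_cst.
  by apply: eq_Rintegral => x _; rewrite f0 ?mulr0// ltW.
rewrite add0r => E; rewrite -[RHS]E; congr (_ + _).
  rewrite /stint; apply: eq_Rintegral => t /set_mem /=; rewrite in_itv/= => tT.
  rewrite mulrC /mass -OmegaZl; last exact: rho_g_integrable.
  by apply: eq_Rintegral => x _; rewrite dt_prod//; ring.
have mf D : measurable D -> measurable_fun D f by move=> ?; exact: smooth_measurable.
rewrite /stint; apply: (@ae_eq_Rintegral _ _ _ mu `]0, T[%classic) => //.
- by apply: measurable_funM; [exact: momentum_measurable|exact: mf].
- under [X in measurable_fun _ X]eq_fun => t do
    under eq_Rintegral => x _ do rewrite dx_prod//.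
  apply: (@measurable_space_integral _ Omega `]0, T[%classic
    (fun z => Num.sqrt (rho z.1 z.2) * w z.1 z.2 * (derive1 g z.1 * f z.2))) => //.
  apply: measurable_funM.
    by apply: measurable_funM; [exact: sqrt_rho_measurable|exact: w_measurable].
  apply: measurable_funTS; apply: measurable_funM.
    apply: (@measurableT_comp _ _ _ _ _ _ (derive1 g)) => //.
    exact: (smooth_measurable _ (smooth_derive1 sg)).
  by apply: (@measurableT_comp _ _ _ _ _ _ f) => //; exact: mf.
have [K K0 hK] := w_L1.
apply: ae_imp (hK) => t H; rewrite /= in_itv/= => tT.
have [iw _] := H tT.
have isw := momentum_slice tT iw.
have [c c0 hc] := smooth_bounded (smooth_derive1 sg).
have mg : measurable_fun Omega (derive1 g).
  exact: (smooth_measurable _ (smooth_derive1 sg)).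
rewrite mulrC /momentum -OmegaZl; last exact: (Omega_mul_bounded isw mg hc).1.
by apply: eq_Rintegral => x _; rewrite dx_prod//; ring.
Qed.

End UpTo.

End Flow.
End Solution.

(** * Blow-up *)

Section Positive.
Context {R : realType}.
Local Notation mu := (@lebesgue_measure R).
Variables (bc : boundary) (alpha gamma : R) (rho0 m0 : R -> R) (rho w u : R -> R -> R).
Hypothesis sol : global_entropy_weak_solution bc alpha gamma rho0 m0 rho w.
Hypothesis vel : is_velocity bc rho w u.

Let mO : measurable (@Omega R) := measurable_Omega.

(** As [rho] is bounded below on the slab, [u] is integrable like [w], and
    [sqrt rho * w] equals [rho * u]. *)
Lemma slab_of_solution s e : 0 < s -> s < e ->
  (forall x t, cell bc x -> s <= t <= e -> 0 < rho x t) -> slab bc rho u s e.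
Proof.
move=> s0 se pos.
pose T := e + 1.
have T0 : 0 < T by rewrite /T; lra.
have sub : (`]s, e]%classic : set R) `<=` (`]0, T[%classic : set R).
  by move=> t /=; rewrite !in_itv/= /T => /andP[? ?]; apply/andP; split; lra.
have mD : measurable ((Omega : set R) `*` (`]0, T[%classic : set R)) by exact: measurableX.
have sub2 : (Omega : set R) `*` (`]s, e]%classic : set R) `<=`
    (Omega : set R) `*` (`]0, T[%classic : set R).
  by move=> z [? /sub ?].
have cont := @rho_cell_cont _ _ _ _ _ _ _ _ sol s e (ltW s0).
have itT t : s <= t <= e -> 0 < t < T.
  by move=> /andP[? ?]; rewrite /T; apply/andP; split; lra.
have Vel x t : Omega x -> s <= t <= e -> u x t = w x t / Num.sqrt (rho x t).
  move=> Ox st; case: vel => _ _; apply => //; last exact: pos (cell_Omega bc Ox) st.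
  by case/andP: (itT t st).
have [p [q [p1 p2 _ _ low]]] := cell_bounds (ltW se) cont.
have c0 : 0 < rho p.1 p.2 by exact: pos.
split => //.
- move=> bcP x t; case: sol => _ /(_ t)[+ _] _; rewrite bcP; exact.
- exact: (measurable_funS mD sub2 (rho_measurable sol T0)).
- by case: vel => /(_ T) mu _ _; exact: (measurable_funS mD sub2 mu).
- have [K K0 hK] := w_L1 sol T0.
  pose c := Num.sqrt (rho p.1 p.2).
  have cp : 0 < c by rewrite sqrtr_gt0.
  exists (c^-1 * K); first by rewrite mulr_ge0// invr_ge0 ltW.
  apply: ae_imp (hK) => t H st.
  have st2 : s <= t <= e by case/andP: st => /ltW -> ->.
  have [iw wK] := H (itT t st2).
  have mut : measurable_fun Omega (u^~ t).
    case: vel => /(_ T) mu _ _; apply: (measurable_slice _ _ _ mu) => //=.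
    by rewrite in_itv; exact: itT.
  have ub : {ae mu, forall x, Omega x -> `|u x t| <= c^-1 * `|w x t|}.
    apply: aeW => x Ox; rewrite Vel// normrM mulrC ler_wpM2r//.
    rewrite ger0_norm ?invr_ge0 ?sqrtr_ge0// lef_pV2 ?posrE ?sqrtr_gt0//; last first.
      exact: pos (cell_Omega bc Ox) st2.
    by apply: ler_wsqrtr; case/andP: (low x t (cell_Omega bc Ox) st2).
  have icw := integrable_OmegaZl c^-1 (integrable_Omega_norm iw).
  have iu := (Omega_ae_le mut icw ub).1; split => //.
  apply: (le_trans (Omega_ae_le_int (integrable_Omega_norm iu) icw ub)).
  by rewrite OmegaZl ?ler_wpM2l ?invr_ge0 ?(ltW cp)//; exact: integrable_Omega_norm.
move=> g ag t1 t2 st1 t12 t2e.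
have t1p : 0 < t1 by exact: lt_le_trans st1.
have t2T : t2 < T by rewrite /T; lra.
have := mass_increment sol T0 ag t1p t12 t2T; rewrite /mass => ->.
apply: eq_Rintegral => t /set_mem /=; rewrite in_itv/= => /andP[t1t tt2].
have st : s <= t <= e by apply/andP; split; lra.
apply: eq_Rintegral => x /set_mem Ox.
have rp : 0 < rho x t by exact: pos (cell_Omega bc Ox) st.
congr (_ * _); rewrite Vel// mulrCA mulrC; congr (_ * _).
by rewrite -{2}(sqr_sqrtr (ltW rp)) expr2 mulfK// gt_eqF// sqrtr_gt0.
Qed.

End Positive.

Section Blowup.
Context {R : realType}.
Local Notation mu := (@lebesgue_measure R).
Variables (bc : boundary) (alpha gamma : R) (rho0 m0 : R -> R) (rho w u : R -> R -> R).
Hypothesis sol : global_entropy_weak_solution bc alpha gamma rho0 m0 rho w.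
Hypothesis vel : is_velocity bc rho w u.

Lemma unit_cell_point t x : Omega_bar bc x ->
  exists2 y, 0 <= y <= 1 & rho y t = rho x t.
Proof.
case: sol => _ /(_ t)[+ _] _.
case: bc => [_|per _] /=; first by rewrite in_itv/=; exists x.
have pern n y : rho (y + n%:R) t = rho y t.
  elim: n y => [|n IH] y; first by rewrite addr0.
  by rewrite -natr1 addrA per.
have /andP[f1 f2] := floor_itv x; move: f1 f2; rewrite intrD.
set n := Num.floor x => f1 f2; exists (x - n%:~R); first by apply/andP; split; lra.
case: n {f1 f2} => n; first by rewrite -[LHS](pern n) /= subrK.
by rewrite NegzE mulrNz opprK; exact: pern.
Qed.

(** If the integrals stayed below [A], the backward bound would keep [rho x0 s] above
    a fixed positive multiple of [exp (- A)] for [s] near [T1], while it tends to the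
    vacuum value [rho x0 T1 = 0]. *)
Lemma gradient_integral_large T1 T0 x0 A b : 0 <= T1 -> T1 < T0 -> T1 < b ->
  0 <= x0 <= 1 -> rho x0 T1 = 0 ->
  (forall x t, Omega_bar bc x -> T1 < t <= T0 -> 0 < rho x t) ->
  exists2 s, T1 < s < b & (A%:E <= \int[mu]_(t in `]s, b]) dxLinfN bc (u^~ t))%E.
Proof.
move=> T1p T10 T1b x01 van pos; apply: contrapT => /forall2NP small.
pose e := Num.min T0 b.
have T1e : T1 < e by rewrite lt_min T10.
have eT0 : e <= T0 by rewrite ge_min lexx.
have eb : e <= b by rewrite ge_min lexx orbT.
have Obar x : cell bc x -> Omega_bar bc x by case: bc.
have [p [q [p1 p2 _ _ low]]] :=
  cell_bounds (lexx e) (@rho_cell_cont _ _ _ _ _ _ _ _ sol e e (le_trans T1p (ltW T1e))).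
pose c := rho p.1 p.2.
have c0 : 0 < c.
  apply: pos; first exact: Obar.
  by case/andP: p2 => p3 p4; rewrite (lt_le_trans T1e p3) (le_trans p4).
have cx x : 0 <= x <= 1 -> c <= rho x e.
  by move=> /(cell01 bc) cx; have := low x e cx; rewrite lexx => /(_ isT)/andP[].
have bound s : T1 < s < e -> c <= expR A * rho x0 s.
  move=> /andP[T1s se].
  have sp : 0 < s by rewrite (le_lt_trans T1p).
  have S : slab bc rho u s e.
    apply: (slab_of_solution sol vel) => // x t cxx /andP[st te].
    by apply: pos; [exact: Obar|rewrite (lt_le_trans T1s st) (le_trans te)].
  have IA : (\int[mu]_(t in `]s, e]) dxLinfN bc (u^~ t) < A%:E)%E.
    rewrite ltNge; apply/negP => h; case: (small s) => []; last first.
      apply; apply: (le_trans h); apply: lower_integral_subset => [t|t /=].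
        exact: dxLinfN_ge0.
      by rewrite !in_itv/= => /andP[-> /le_trans ->].
    by rewrite T1s (lt_le_trans se).
  have I0 : (0 <= \int[mu]_(t in `]s, e]) dxLinfN bc (u^~ t))%E.
    by apply: integral_ge0 => t _; exact: dxLinfN_ge0.
  have IAy := lt_trans IA (ltry A).
  have := slab_backward_bound S IAy x01 cx.
  move=> /le_trans; apply; rewrite ler_wpM2r//.
    by rewrite ltW// (slab_pos S)//; [exact: cell01|rewrite lexx ltW].
  rewrite ler_expR -lee_fin fineK ?ltW//.
  by rewrite ge0_fin_numE.
have q0 : 0 < c / expR A by rewrite divr_gt0// expR_gt0.
have cK : compact (cell bc `*` `[T1, e]%classic : set (R * R)).
  by apply: compact_setX; [case: bc; exact: segment_compact|exact: segment_compact].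
have [d d0 hd] := uniformly_continuous_on cK (@rho_cell_cont _ _ _ _ _ _ _ _ sol T1 e T1p) q0.
pose s := T1 + Num.min d (e - T1) / 2.
have m0' : 0 < Num.min d (e - T1) by rewrite lt_min d0 subr_gt0.
have md : Num.min d (e - T1) <= d by rewrite ge_min lexx.
have me : Num.min d (e - T1) <= e - T1 by rewrite ge_min lexx orbT.
have sT : T1 < s by rewrite /s; lra.
have se : s < e by rewrite /s; lra.
have sd : `|T1 - s| < d by rewrite /s opprD addNKr normrN gtr0_norm; lra.
have := hd (x0, T1) (x0, s); rewrite /= van sub0r normrN => H.
have {}H : `|rho x0 s| < c / expR A.
  apply: H.
  - by split => /=; [exact: cell01|rewrite in_itv/= lexx ltW].
  - by split => /=; [exact: cell01|rewrite in_itv/= !ltW].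
  - by split; rewrite /= /ball/= ?subrr ?normr0.
have := bound s; rewrite sT se => /(_ isT); apply/negP; rewrite -ltNge.
by rewrite mulrC -ltr_pdivlMr ?expR_gt0// (le_lt_trans (ler_norm _)).
Qed.

End Blowup.

Unset Implicit Arguments.

Theorem theorem4 (R : realType) (bc : boundary) (alpha gamma : R)
    (rho0 m0 : R -> R) (rho w u : R -> R -> R)
    (T0 T1 rho_low : R) (Omega0 : set R) :
  2^-1 < alpha -> 1 <= gamma ->
  initial_data bc alpha rho0 m0 ->
  global_entropy_weak_solution bc alpha gamma rho0 m0 rho w ->
  is_velocity bc rho w u ->
  (exists x t, [/\ Omega_bar bc x, 0 <= t & rho x t = 0]) ->
  0 < T0 -> 0 <= T1 < T0 ->
  0 < rho_low ->
  (forall t, T0 <= t -> rho_low <= inf [set rho x t | x in Omega_bar bc]) ->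
  Omega0 !=set0 -> Omega0 `<=` Omega_bar bc ->
  (forall x, Omega0 x -> rho x T1 = 0) ->
  (forall x, (Omega_bar bc `\` Omega0) x -> 0 < rho x T1) ->
  (forall x t, Omega_bar bc x -> T1 < t <= T0 -> 0 < rho x t) ->
  (forall eta : R, 0 < eta ->
    (\int[lebesgue_measure]_(s in `[t, (T1 + eta)%R]) dxLinfN bc (u^~ s))%E
      @[t --> T1^'+] --> +oo%E) /\
  (forall T2 : R, 0 < T2 < T0 ->
    (\int[lebesgue_measure]_(s in `[0%R, T2]) W1infN bc (u^~ s) < +oo)%E ->
    exists2 T3 : R, T2 <= T3 < T0 &
      (\int[lebesgue_measure]_(s in `[0%R, t]) dxLinfN bc (u^~ s))%E
        @[t --> T3^'-] --> +oo%E).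
Proof.
move=> _ _ _ sol vel _ _ /andP[T1p T10] _ _ [x1 Ox1] O0 van _ pos.
have [x0 x01 x0v] := unit_cell_point sol T1 (O0 _ Ox1).
rewrite (van _ Ox1) in x0v.
have large A b : T1 < b ->
    exists2 s, T1 < s < b & (A%:E <= \int[lebesgue_measure]_(t in `]s, b]) dxLinfN bc (u^~ t))%E.
  by move=> T1b; exact: (gradient_integral_large sol vel A T1p T10 T1b x01 x0v pos).
have ge0 t : (0 <= dxLinfN bc (u^~ t))%E by exact: dxLinfN_ge0.
split.
  move=> eta eta0; apply/cvgeyPge => A.
  have T1b : T1 < T1 + eta by rewrite ltrDl.
  have [s /andP[T1s _] As] := large A _ T1b.
  near=> t; apply: (le_trans As); apply: lower_integral_subset => // r /=.
  rewrite !in_itv/= => /andP[sr ->]; rewrite andbT.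
  by rewrite (le_trans _ (ltW sr))//; near: t; exact: nbhs_right_le.
move=> T2 /andP[T20 T2T] _.
  (* The integral over [0, t] contains a right neighbourhood of T1, hence is
     infinite, as soon as t > T1: any time in (T1, T0) after T2 will do. *)
pose T3 := Num.max T2 ((T1 + T0) / 2).
have T13 : T1 < T3 by rewrite lt_max; apply/orP; right; lra.
exists T3; first by rewrite le_max lexx /= gt_max T2T; lra.
apply/cvgeyPge => A.
have [s /andP[T1s _] As] := large A ((T1 + T3) / 2) ltac:(lra).
near=> t; apply: (le_trans As); apply: lower_integral_subset => // r /=.
rewrite !in_itv/= => /andP[sr rb]; rewrite (le_trans T1p (ltW (lt_trans T1s sr)))/=.
by rewrite (le_trans rb)//; near: t; apply: nbhs_left_ge; lra.
Unshelve. all: by end_near. Qed.
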